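(* Let $\varphi:X\to X$ be an expanding open map on a compact metrizable space $X$ and let $c:X\to[0,\infty)$ be continuous. Let $\mathcal L_c:C(X)\to C(X)$ be the Ruelle–Perron–Frobenius operator $\mathcal L_cf(y)=\sum_{x\in\varphi^{-1}(y)}c(x)f(x)$. Then $h_\varphi(\mu)<\infty$ for all $\mu\in\mathrm{Inv}(X,\varphi)$ and $$\ln r(\mathcal L_c)=\max_{\mu\in\mathrm{Inv}(X,\varphi)}\Big(\int_X\ln c\,d\mu+h_\varphi(\mu)\Big)=\max_{\mu\in\mathrm{Erg}(X,\varphi)}\Big(\int_X\ln c\,d\mu+h_\varphi(\mu)\Big),$$ where $r(\mathcal L_c)$ is the spectral radius of $\mathcal L_c$ (in particular both maxima are attained).
   Context: A continuous map $\varphi$ on a compact space $X$ is expanding if $X$ admits a compatible metric $d$ and constants $\varepsilon>0$, $\theta>1$ with $d(\varphi(x),\varphi(y))\ge\theta d(x,y)$ whenever $d(x,y)<\varepsilon$. An open expanding map is a local homeomorphism, so $\varphi^{-1}(y)$ is finite for each $y$. $\mathrm{Inv}(X,\varphi)$, $\mathrm{Erg}(X,\varphi)$: $\varphi$-invariant, resp. ergodic, Borel probability measures; $h_\varphi(\mu)$: Kolmogorov–Sinai entropy; convention $\ln0=-\infty$. *)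

(* Defs.v *)
From HB Require Import structures.
From mathcomp Require Import all_boot all_order all_algebra.
From mathcomp Require Import all_classical all_reals all_analysis.
Set Implicit Arguments. Unset Strict Implicit. Unset Printing Implicit Defensive.
Import Order.TTheory GRing.Theory Num.Theory.
Import numFieldNormedType.Exports.
Local Open Scope classical_set_scope.
Local Open Scope ring_scope.

Definition borel (X : ptopologicalType) := g_sigma_algebraType (@open X).

Definition compatible_metric (R : realType) (X : topologicalType)
  (d : X -> X -> R) : Prop :=
  [/\ (forall x y, 0 <= d x y),
      (forall x y, d x y = 0 <-> x = y),
      (forall x y, d x y = d y x),
      (forall x y z, d x z <= d x y + d y z) &
      (forall A : set X, open A <->
         (forall x, A x -> exists2 r : R, 0 < r & [set y | d x y < r] `<=` A))].

Definition expanding (R : realType) (X : topologicalType) (phi : X -> X) : Prop :=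
  continuous phi /\
  exists d : X -> X -> R, compatible_metric d /\
    exists eps theta : R, [/\ 0 < eps, 1 < theta &
      forall x y, d x y < eps -> theta * d x y <= d (phi x) (phi y)].

Definition open_map (X : topologicalType) (phi : X -> X) : Prop :=
  forall U : set X, open U -> open (phi @` U).

Definition phi_invariant (R : realType) (X : ptopologicalType) (phi : X -> X)
  (mu : probability (borel X) R) : Prop :=
  forall A : set (borel X), measurable A -> mu (phi @^-1` A) = mu A.

Definition phi_ergodic (R : realType) (X : ptopologicalType) (phi : X -> X)
  (mu : probability (borel X) R) : Prop :=
  phi_invariant phi mu /\
  forall A : set (borel X), measurable A -> phi @^-1` A = A ->
    mu A = 0%E \/ mu A = 1%E.

Definition etaR (R : realType) (t : R) : R := if t == 0 then 0 else - (t * ln t).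

Definition mpartition (X : ptopologicalType) (k : nat)
  (P : 'I_k -> set (borel X)) : Prop :=
  [/\ (forall i, measurable (P i)),
      (forall i j, i != j -> P i `&` P j = set0) &
      (forall x, exists i, P i x)].

Definition join_cell (X : ptopologicalType) (phi : X -> X) (k n : nat)
  (P : 'I_k -> set (borel X)) (w : {ffun 'I_n -> 'I_k}) : set (borel X) :=
  [set x | forall i : 'I_n, P (w i) (iter i phi x)].

Definition join_entropy (R : realType) (X : ptopologicalType) (phi : X -> X)
  (mu : probability (borel X) R) (k : nat) (P : 'I_k -> set (borel X))
  (n : nat) : R :=
  \sum_(w : {ffun 'I_n -> 'I_k}) etaR (fine (mu (join_cell phi P w))).

Definition entropy_partition (R : realType) (X : ptopologicalType)
  (phi : X -> X) (mu : probability (borel X) R) (k : nat)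
  (P : 'I_k -> set (borel X)) : R :=
  limn (fun n => join_entropy phi mu P n.+1 / n.+1%:R).

Definition KSentropy (R : realType) (X : ptopologicalType) (phi : X -> X)
  (mu : probability (borel X) R) : \bar R :=
  ereal_sup [set (entropy_partition phi mu (projT2 P))%:E |
             P in [set P : {k : nat & 'I_k -> set (borel X)} |
                   mpartition (projT2 P)] ]%classic.

Definition lnE (R : realType) (t : R) : \bar R :=
  if t <= 0 then -oo%E else (ln t)%:E.

Definition pressure_fun (R : realType) (X : ptopologicalType) (phi : X -> X)
  (c : X -> R) (mu : probability (borel X) R) : \bar R :=
  ((\int[mu]_(x in setT) lnE (c x)) + KSentropy phi mu)%E.

Definition CX (R : realType) (X : topologicalType) : set (X -> R) :=
  [set f | continuous f].

Definition RPF (R : realType) (X : ptopologicalType) (phi : X -> X)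
  (c : X -> R) (f : X -> R) : X -> R :=
  fun y => (\sum_(x \in [set x | phi x = y]) (c x * f x))%R.

(* The complexification of L_c - lambda, lambda = a + i b, acting on
   complex-valued continuous functions f1 + i f2 represented as pairs. *)
Definition RPF_shift (R : realType) (X : ptopologicalType) (phi : X -> X)
  (c : X -> R) (lam : R * R) (f : (X -> R) * (X -> R)) :
  (X -> R) * (X -> R) :=
  (fun y => RPF phi c f.1 y - lam.1 * f.1 y + lam.2 * f.2 y,
   fun y => RPF phi c f.2 y - lam.1 * f.2 y - lam.2 * f.1 y).

(* spectrum of L_c on C(X; C): lambda such that L_c - lambda is not a
   bijection of C(X; C) (bounded inverse is automatic by open mapping). *)
Definition RPF_spectrum (R : realType) (X : ptopologicalType) (phi : X -> X)
  (c : X -> R) : set (R * R) :=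
  [set lam | ~ ((forall f g, CX f.1 -> CX f.2 -> CX g.1 -> CX g.2 ->
                   RPF_shift phi c lam f = RPF_shift phi c lam g -> f = g) /\
                (forall g, CX g.1 -> CX g.2 ->
                   exists2 f, CX f.1 /\ CX f.2 & RPF_shift phi c lam f = g))].

Definition spectral_radius (R : realType) (X : ptopologicalType) (phi : X -> X)
  (c : X -> R) : R :=
  sup [set Num.sqrt (lam.1 ^+ 2 + lam.2 ^+ 2) | lam in RPF_spectrum phi c].

(* Main.v *)
Require Import Defs.
From HB Require Import structures.
From mathcomp Require Import all_boot all_order all_algebra.
From mathcomp Require Import all_classical all_reals all_analysis.
From mathcomp Require Import measurable_realfun ring lra.
Set Implicit Arguments. Unset Strict Implicit. Unset Printing Implicit Defensive.
Import Order.TTheory GRing.Theory Num.Theory.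
Import numFieldNormedType.Exports.
Local Open Scope classical_set_scope.
Local Open Scope ring_scope.

(** The spectral radius of [L_c] equals the growth rate r of the sup norms of [L_c^n 1]; for every
    [lam > r] a truncated Neumann series gives a continuous u > 0 with [L_c u <= lam u].

    Upper bound: if [L_w 1 <= 1] with w > 0, Gibbs' inequality gives [h(mu) <= - int ln w dmu];
    applied to [w = (c + k) u / (lam u o phi)] with lam slightly above r and k small this yields
    [h(mu) + int ln c dmu <= ln r]. Conversely, conditional probabilities on a fine partition,
    smoothed by tent functions, give w > 0 with [L_w 1 <= 1 + e] and
    [- int ln w dmu <= h(mu) + e].

    Existence: averages of Birkhoff sums under the weights of [L_c^n] converge along an ultrafilter
    to a positive normalised invariant functional l such that [l g <= ln lam - ln r] whenever
    [L_(c e^g) 1 <= lam]. By the Riesz theorem l is a measure, and the choice [g = ln w - ln (c + k)]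
    shows that it is an equilibrium state. Maximising successively the values at a countable
    separating family of continuous functions selects an extreme equilibrium functional, and the
    conditional measures on an invariant set of intermediate measure would contradict extremality,
    so the resulting measure is ergodic. If r = 0, any ergodic measure is an equilibrium state, since
    the upper bound is then -oo. *)

(** * Compact metric spaces *)

(** Zeros of [c] are the first obstacle: [ln c] is unbounded, and [L_c] need not have a positive
    eigenfunction. Supersolutions, available for every [lam] above the growth rate, replace
    eigenfunctions, and [c + k] with [k > 0] replaces [c] in the logarithms; [k] tends to 0 only
    when the pressure of a single measure is computed, by monotone convergence. The second obstacle
    is the behaviour of entropy under limits of measures. Limits are taken among functionals subject
    to the inequalities [l g <= ln lam - ln r], which are closed conditions that do not mention
    entropy: they say that [l] is tangent to the convex pressure function. Entropy comes back for
    one fixed measure. With [g = ln w - ln (c + k)] the weight [c e^g = w c / (c + k)] is at most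
    [w], so [L_(c e^g) 1 <= 1 + e], and tangency gives [ln r <= int ln (c + k) dmu - int ln w dmu +
    e <= int ln (c + k) dmu + h(mu) + 2 e]. The same closedness lets maxima be attained along
    ultralimits, which produces an extreme functional without an ergodic decomposition. *)

Section compact_metric.
Context (R : realType) (X : ptopologicalType) (d : X -> X -> R).
Hypothesis dm : compatible_metric d.

Lemma d_ge0 x y : 0 <= d x y. Proof. by case: dm. Qed.
Lemma d_eq0 x y : d x y = 0 <-> x = y. Proof. by case: dm. Qed.
Lemma dxx x : d x x = 0. Proof. exact/d_eq0. Qed.
Lemma dC x y : d x y = d y x. Proof. by case: dm. Qed.
Lemma d_tri y x z : d x z <= d x y + d y z. Proof. by case: dm. Qed.

Lemma open_dball x r : open [set y | d x y < r].
Proof.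
case: dm => _ _ _ _ /(_ [set y | d x y < r]) [_]; apply => y /= xy.
exists (r - d x y); first by rewrite subr_gt0.
by move=> z /= yz; apply: le_lt_trans (d_tri y x z) _; rewrite -ltrBrDl.
Qed.

Lemma nbhs_dball x r : 0 < r -> nbhs x [set y | d x y < r].
Proof.
move=> r0; apply: open_nbhs_nbhs; split; first exact: open_dball.
by rewrite /= dxx.
Qed.

Lemma open_dballP (A : set X) : open A -> forall x, A x ->
  exists2 r : R, 0 < r & forall y, d x y < r -> A y.
Proof. by case: dm => _ _ _ _ /(_ A) [+ _] => /[apply]. Qed.

Lemma dcontinuousP (f : X -> R) : continuous f <->
  forall x (e : R), 0 < e -> exists2 r : R, 0 < r & forall y, d x y < r -> `|f x - f y| < e.
Proof.
split=> [cf x e e0|H x].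
  have := cf x; move/cvgrPdist_lt => /(_ e e0).
  rewrite nbhsE /= => -[U [oU Ux] UU].
  by have [r r0 rU] := open_dballP oU Ux; exists r => // y /rU /UU.
apply/cvgrPdist_lt => e e0; have [r r0 rP] := H x e e0.
by apply: filterS (nbhs_dball x r0) => y /= /rP.
Qed.

Lemma dcontinuous_map (phi : X -> X) : continuous phi ->
  forall x (e : R), 0 < e -> exists2 r : R, 0 < r & forall y, d x y < r -> d (phi x) (phi y) < e.
Proof.
move=> cf x e e0.
have := cf x _ (nbhs_dball (phi x) e0).
rewrite nbhsE /= => -[U [oU Ux] UU].
by have [r r0 rU] := open_dballP oU Ux; exists r => // y /rU /UU.
Qed.

Lemma lipschitz_continuous (f : X -> R) k :
  (forall x y, `|f x - f y| <= k * d x y) -> continuous f.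
Proof.
move=> fk; apply/dcontinuousP => x e e0.
have k0 : 0 < `|k| + 1 by rewrite ltr_wpDl.
exists (e / (`|k| + 1)); first by rewrite divr_gt0.
move=> y xy; apply: le_lt_trans (fk x y) _.
apply: (@le_lt_trans _ _ ((`|k| + 1) * d x y)).
  by rewrite ler_wpM2r ?d_ge0// (le_trans (ler_norm _))// lerDl.
by rewrite mulrC -ltr_pdivlMr.
Qed.

Hypothesis cX : compact [set: X].

Lemma fin_cover (r : X -> R) : (forall x, 0 < r x) ->
  exists s : seq X, forall y, exists2 x, x \in s & d x y < r x.
Proof.
move=> r0; have := cX; rewrite compact_cover => /(_ X setT (fun x => [set y | d x y < r x])).
case=> [x _|y _|D' _ D'P]; first exact: open_dball.
  by exists y => //=; rewrite dxx.
exists (finmap.enum_fset D') => y; have [x xD xy] := D'P y I.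
by exists x.
Qed.

Lemma seq_min_pos (I : eqType) (s : seq I) (f : I -> R) : (forall i, 0 < f i) ->
  exists2 e : R, 0 < e & forall i, i \in s -> e <= f i.
Proof.
move=> f0; elim: s => [|i s [e e0 eP]]; first by exists 1.
exists (Num.min (f i) e); first by rewrite lt_min f0.
by move=> j; rewrite inE ge_min => /predU1P[->|/eP ->]; rewrite ?lexx ?orbT.
Qed.

(** The form in which compactness is used throughout: [Q x r] means that the scale [r] is good at
    [x]. A finite subcover leaves finitely many local scales, and their minimum works everywhere
    because [Q] passes to smaller scales. *)
Lemma compact_unif (Q : X -> R -> Prop) :
  (forall x (r s : R), s <= r -> Q x r -> Q x s) ->
  (forall x0, exists r e : R, [/\ 0 < r, 0 < e & forall x, d x0 x < r -> Q x e]) ->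
  exists2 e : R, 0 < e & forall x, Q x e.
Proof.
move=> Qs /choice[r /choice[e H]].
have r0 x : 0 < r x by case: (H x).
have e0 x : 0 < e x by case: (H x).
have [s sP] := fin_cover r0; have [e1 e10 e1P] := seq_min_pos s e0.
exists e1 => // x; have [x0 x0s x0x] := sP x.
by apply: (Qs _ _ _ (e1P _ x0s)); case: (H x0) => _ _; apply.
Qed.

Lemma fin_net (r : R) : 0 < r -> exists s : seq X, forall y, exists2 x, x \in s & d x y < r.
Proof. by move=> r0; apply: (@fin_cover (fun=> r)). Qed.

Lemma dunif_continuous (f : X -> R) : continuous f -> forall e : R, 0 < e ->
  exists2 r : R, 0 < r & forall x y, d x y < r -> `|f x - f y| < e.
Proof.
move=> /dcontinuousP cf e e0.
apply: (@compact_unif (fun x r => forall y, d x y < r -> `|f x - f y| < e)).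
  by move=> x r s sr H y xy; apply: H; apply: lt_le_trans xy sr.
move=> x0; have [r r0 rP] := cf x0 (e/2) (divr_gt0 e0 (ltr0Sn _ _)).
exists (r/2), (r/2); split; rewrite ?divr_gt0// => x x0x y xy.
have h1 : `|f x0 - f x| < e/2 by apply: rP; lra.
have h2 : `|f x0 - f y| < e/2 by apply: rP; have := d_tri x x0 y; lra.
rewrite (splitr e); apply: le_lt_trans (ltrD h1 h2).
by rewrite (distrC (f x0)); apply: le_trans (ler_normD _ _); rewrite addrA subrK.
Qed.

Lemma bounded_continuous (f : X -> R) : continuous f ->
  exists2 M : R, 0 < M & forall x, `|f x| <= M.
Proof.
move=> /dcontinuousP cf.
(* Boundedness is recast as the existence of a uniform scale [e]; the bound is then [e^-1]. *)
have [e e0 eP] : exists2 e : R, 0 < e & forall x, e * `|f x| <= 1.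
  apply: compact_unif => [x r s sr H|x0].
    by apply: le_trans H; rewrite ler_wpM2r.
  have [r r0 rP] := cf x0 1 ltr01.
  have k0 : 0 < `|f x0| + 1 by rewrite ltr_wpDl.
  exists r, (`|f x0| + 1)^-1; split; rewrite ?invr_gt0//.
  move=> x /rP fx; rewrite mulrC ler_pdivrMr// mul1r.
  have := ler_normB (f x0) (f x0 - f x).
  by rewrite opprB addrCA subrr addr0; move/le_trans; apply; rewrite lerD2l ltW.
exists e^-1; first by rewrite invr_gt0.
by move=> x; rewrite -[_^-1]mul1r ler_pdivlMr// mulrC.
Qed.

End compact_metric.

(** * Distance functions and tent functions *)

Section distance_to_set.
Context (R : realType) (X : ptopologicalType) (d : X -> X -> R).
Hypothesis dm : compatible_metric d.

(* Capping the distance at 1 keeps the infimum meaningful when [K] is empty. *)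
Definition dset (K : set X) x := inf [set r : R | r = 1 \/ exists2 y, K y & r = d x y].

Lemma dset_nonempty K x : [set r : R | r = 1 \/ exists2 y, K y & r = d x y] !=set0.
Proof. by exists 1; left. Qed.

Lemma dset_lb K x : lbound [set r : R | r = 1 \/ exists2 y, K y & r = d x y] 0.
Proof. by move=> r [->|[y _ ->]] //; exact: d_ge0. Qed.

Lemma dset_ge0 K x : 0 <= dset K x.
Proof. by apply: lb_le_inf; [exact: dset_nonempty|exact: dset_lb]. Qed.

Lemma dset_le1 K x : dset K x <= 1.
Proof. by apply: ge_inf; [exists 0; exact: dset_lb|left]. Qed.

Lemma dset_le K x y : K y -> dset K x <= d x y.
Proof. by move=> Ky; apply: ge_inf; [exists 0; exact: dset_lb|right; exists y]. Qed.

Lemma dset_in K x : K x -> dset K x = 0.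
Proof.
move=> Kx; apply/le_anti; rewrite dset_ge0 andbT.
by have := dset_le x Kx; rewrite (dxx dm).
Qed.

Lemma dset_lt K x r : r <= 1 -> dset K x < r -> exists2 y, K y & d x y < r.
Proof.
move=> r1 /(inf_lt (dset_nonempty K x))[].
move=> s [->|[y Ky ->]] sr; last by exists y.
by have := lt_le_trans sr r1; rewrite ltxx.
Qed.

Lemma dset_lip K x y : `|dset K x - dset K y| <= 1 * d x y.
Proof.
rewrite mul1r.
wlog: x y / dset K x >= dset K y.
  move=> H; have [h|/ltW h] := leP (dset K y) (dset K x); first exact: H.
  by rewrite distrC (dC dm); exact: H.
move=> h; rewrite ger0_norm ?subr_ge0// lerBlDl -lerBlDr.
apply: lb_le_inf => [|r]; first exact: dset_nonempty.
move=> [->|[z Kz ->]].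
  by rewrite lerBlDr (le_trans (dset_le1 _ _))// lerDl d_ge0.
by rewrite lerBlDl (le_trans (dset_le _ Kz))// d_tri.
Qed.

Lemma dset_continuous K : continuous (dset K).
Proof. by apply: (lipschitz_continuous dm (k := 1)); exact: dset_lip. Qed.

Lemma dset_closed K x : closed K -> ~ K x -> 0 < dset K x.
Proof.
move=> cK nKx; have oC : open (~` K) by exact: closed_openC.
have [r r0 rP] := open_dballP dm oC (nKx : (~` K) x).
apply: (@lt_le_trans _ _ (Num.min r 1)); first by rewrite lt_min r0 ltr01.
rewrite leNgt; apply/negP => /dset_lt[|y Ky].
  by rewrite ge_min lexx orbT.
by rewrite lt_min => /andP[/rP].
Qed.

Definition tent K r x := Num.max 0 (1 - dset K x / r).

Lemma tent_continuous K r : continuous (tent K r).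
Proof.
move=> x; apply: (@continuous_max R X (fun=> 0) (fun x => 1 - dset K x / r)).
  exact: cvg_cst.
by apply: cvgB; [exact: cvg_cst|apply: cvgMl; exact: dset_continuous].
Qed.

Lemma tent_ge0 K r x : 0 <= tent K r x.
Proof. by rewrite le_max lexx. Qed.

Lemma tent_le1 K r x : 0 < r -> tent K r x <= 1.
Proof. by move=> r0; rewrite ge_max ler01 gerBl divr_ge0 ?dset_ge0// ltW. Qed.

Lemma tent_in K r x : K x -> tent K r x = 1.
Proof. by move=> Kx; rewrite /tent dset_in// mul0r subr0; apply/max_idPr. Qed.

(** The condition [r <= 1] reflects the cap in [dset]: only a value below 1 comes from an actual
    point of [K]. *)
Lemma tent_supp K r x : 0 < r -> r <= 1 -> tent K r x != 0 -> exists2 y : X, K y & d x y < r.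
Proof.
move=> r0 r1; rewrite /tent; have [h|h] := leP (dset K x / r) 1.
  move=> hn; apply: dset_lt => //; rewrite lt_neqAle; apply/andP; split.
    apply: contraNN hn => /eqP ->.
    by rewrite (divff (lt0r_neq0 r0)) subrr maxxx.
  by rewrite ler_pdivrMr// mul1r in h.
by rewrite (max_idPl _) ?eqxx// subr_le0 ltW.
Qed.

Lemma tent_lim K x : closed K -> (fun n => tent K n.+1%:R^-1 x) @ \oo --> (\1_K x : R).
Proof.
move=> cK; rewrite indicE; case: (boolP (x \in K)) => [/set_mem Kx|/negP nKx].
  by rewrite (_ : (fun n => _) = cst 1); [exact: cvg_cst|apply/funext => n; exact: tent_in].
have {}nKx : ~ K x by move=> h; apply: nKx; rewrite inE.
have h := dset_closed cK nKx.
apply: cvg_near_cst; near=> n; rewrite /tent; apply/max_idPl => /=.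
rewrite subr_le0 invrK.
have : n%:R >= (dset K x)^-1 by near: n; exact: nbhs_infty_ger.
rewrite -[_^-1]mul1r ler_pdivrMr// mulrC => /le_trans; apply.
by rewrite ler_wpM2l ?dset_ge0// ler_nat.
Unshelve. all: by end_near.
Qed.

End distance_to_set.

(** * The transfer operator *)

Record expanding_system (R : realType) (X : ptopologicalType) (phi : X -> X)
    (d : X -> X -> R) (eps theta : R) : Prop := ExpandingSystem {
  es_metric : compatible_metric d;
  es_compact : compact [set: X];
  es_continuous : continuous phi;
  es_open : open_map phi;
  es_eps : 0 < eps;
  es_theta : 1 < theta;
  es_expand : forall x y, d x y < eps -> theta * d x y <= d (phi x) (phi y) }.

(** Fibres as duplicate-free lists, so that sums over neighbouring fibres can be matched by a
    permutation. [fset_set] is empty on infinite sets; [finite_fiber] rules this case out. *)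
Definition preimages (X : ptopologicalType) (phi : X -> X) (y : X) : seq X :=
  finmap.enum_fset (fset_set [set x | phi x = y]).

Section transfer.
Context (R : realType) (X : ptopologicalType) (phi : X -> X)
  (d : X -> X -> R) (eps theta : R).
Hypothesis ES : expanding_system phi d eps theta.

Let dm := es_metric ES.
Let cX := es_compact ES.
Let e0 := es_eps ES.
Let t1 := es_theta ES.
Let t0 : 0 < theta := lt_trans ltr01 (es_theta ES).
Local Notation pre := (preimages phi).

Lemma expand_le x y : d x y < eps -> d x y <= d (phi x) (phi y).
Proof.
move=> xy; apply: le_trans (es_expand ES xy).
by rewrite ler_peMl ?(d_ge0 dm)// ltW.
Qed.

Lemma locally_injective x y : d x y < eps -> phi x = phi y -> x = y.
Proof.
move=> xy pxy; apply/(d_eq0 dm); apply/le_anti; rewrite (d_ge0 dm) andbT.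
by apply: le_trans (expand_le xy) _; rewrite pxy (dxx dm).
Qed.

(** Two points of a fibre in one ball of radius [eps / 2] coincide by local injectivity, so choosing
    a net point near each point injects the fibre into a fixed finite net. *)
Lemma separated_fiber_size : exists N : nat, forall y (t : seq X), uniq t ->
  (forall x, x \in t -> phi x = y) -> (size t <= N)%N.
Proof.
have [s sP] := fin_net dm cX (divr_gt0 e0 (ltr0Sn R 1)).
exists (size s) => y t ut tP.
pose g x := s2val (cid2 (sP x)).
have gs x : g x \in s by rewrite /g; case: cid2.
have gx x : d (g x) x < eps / 2 by rewrite /g; case: cid2.
rewrite -(size_map g); apply: uniq_leq_size.
  rewrite map_inj_in_uniq// => x x' xt x't gg.
  apply: locally_injective; last by rewrite (tP _ xt) (tP _ x't).
  rewrite (splitr eps); apply: le_lt_trans (d_tri dm (g x) _ _) _.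
  by rewrite ltrD// ?(dC dm x)// gg.
by move=> _ /mapP[x _ ->].
Qed.

Lemma finite_fiber y : finite_set [set x | phi x = y].
Proof.
have [N NP] := separated_fiber_size.
have [//|inf] := pselect (finite_set [set x | phi x = y]); exfalso.
have [B BA] := infinite_set_fset N.+1 inf.
rewrite leqNgt ltnS (NP y)//; exact: finmap.fset_uniq.
Qed.

Lemma mem_preimages y x : (x \in pre y) = (phi x == y).
Proof.
rewrite /preimages; apply/idP/eqP => h.
  by move: h; rewrite in_fset_set; [move/set_mem|exact: finite_fiber].
by rewrite in_fset_set; [apply/mem_set|exact: finite_fiber].
Qed.

Lemma uniq_preimages y : uniq (pre y).
Proof. exact: finmap.fset_uniq. Qed.

Lemma size_preimages : exists N : nat, forall y, (size (pre y) <= N)%N.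
Proof.
have [N NP] := separated_fiber_size; exists N => y.
by apply: (NP y); [exact: uniq_preimages|move=> x; rewrite mem_preimages => /eqP].
Qed.

(** Inverse branches of uniform size: openness provides them near each point, compactness makes the
    size uniform, and expansion makes them contract by [theta]. *)
Lemma lifting : exists2 e : R, 0 < e & forall x y, d (phi x) y < e ->
  exists z, [/\ phi z = y, d x z < eps & theta * d x z <= d (phi x) y].
Proof.
have e20 : 0 < eps / 2 := divr_gt0 e0 (ltr0Sn R 1).
suff [e e_gt0 eP] : exists2 e : R, 0 < e & forall x y, d (phi x) y < e ->
    exists2 z, phi z = y & d x z < eps.
  exists e => // x y /eP[z zy xz]; exists z; split=> //.
  by rewrite -zy; exact: (es_expand ES).
apply: (compact_unif dm cX) => [x r s sr H y xy|x0].
  by apply: H; apply: lt_le_trans xy sr.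
(* Half of [eps], because [x] and the lifted point [z] are both compared with [x0] and must end up
   within [eps] of each other. *)
have oU := es_open ES (open_dball dm x0 (eps / 2)).
have [|s s0 sP] := open_dballP dm oU (_ : _ (phi x0)).
  by exists x0 => //=; rewrite (dxx dm).
have [r r0 rP] := dcontinuous_map dm (es_continuous ES) x0 (divr_gt0 s0 (ltr0Sn R 1)).
exists (Num.min r (eps / 2)), (s / 2); split; rewrite ?lt_min ?r0 ?divr_gt0//.
move=> x; rewrite lt_min => /andP[/rP xr xe] y xy.
have [|z /= z0 zy] := sP y; first by have := d_tri dm (phi x) (phi x0) y; lra.
exists z => //; have := d_tri dm x0 x z; rewrite (dC dm x x0); lra.
Qed.

(** Lifting gives an injection from the fibre of [y] to that of [y'] and one in the other direction;
    the fibres are finite, so the first one is a bijection. *)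
Lemma preimages_matching : exists2 e : R, 0 < e & forall y y', d y y' < e ->
  exists2 h : X -> X, (forall x, x \in pre y -> d x (h x) <= d y y') &
    perm_eq (map h (pre y)) (pre y').
Proof.
have [e e_gt0 eP] := lifting.
(* The bound [eps / 2] gives injectivity: [h x = h x'] forces [d x x' <= 2 * d y y' < eps]. *)
pose e' := Num.min e (eps / 2).
have inj y y' : d y y' < e' -> exists h : X -> X,
    [/\ forall x, x \in pre y -> d x (h x) <= d y y', uniq (map h (pre y)) &
       {subset map h (pre y) <= pre y'}].
  rewrite lt_min => /andP[ye ye2].
  have H x : exists z, x \in pre y ->
      [/\ phi z = y', d x z < eps & theta * d x z <= d y y'].
    have [xy|_] := boolP (x \in pre y); last by exists x.
    move: xy; rewrite mem_preimages => /eqP xy.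
    by have [|z] := eP x y'; rewrite xy// => zP; exists z.
  have [h hP] := choice H.
  have hd x : x \in pre y -> d x (h x) <= d y y'.
    move=> /hP[_ _]; apply: le_trans.
    by rewrite ler_peMl ?(d_ge0 dm)// ltW.
  exists h; split=> //.
    rewrite map_inj_in_uniq ?uniq_preimages// => x x' xy x'y hh.
    apply: locally_injective; last first.
      by move: xy x'y; rewrite !mem_preimages => /eqP -> /eqP ->.
    have := d_tri dm (h x) x x'; have := hd _ xy; have := hd _ x'y.
    rewrite -hh (dC dm x'); lra.
  by move=> _ /mapP[x xy ->]; rewrite mem_preimages; apply/eqP; case: (hP _ xy).
exists e' => [|y y' yy']; first by rewrite lt_min e_gt0 divr_gt0.
have [h [hd hu hs]] := inj _ _ yy'.
have [h' [_ hu' hs']] := inj y' y (eq_ind _ (fun r => r < e') yy' _ (dC dm y y')).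
exists h => //; apply: uniq_perm => //; first exact: uniq_preimages.
have sz : (size (pre y') <= size (map h (pre y)))%N.
  by rewrite size_map -(size_map h'); exact: uniq_leq_size.
by have [_] := uniq_min_size hu hs sz.
Qed.

Lemma RPFE (c f : X -> R) y : RPF phi c f y = \sum_(x <- pre y) c x * f x.
Proof. by rewrite /RPF fsbig_finite//; exact: finite_fiber. Qed.

(** After matching the fibres the two sums are compared term by term; uniform continuity bounds each
    term and [size_preimages] bounds their number. *)
Lemma RPF_continuous (c f : X -> R) : continuous c -> continuous f ->
  continuous (RPF phi c f).
Proof.
move=> cc cf; apply/(dcontinuousP dm) => y e e_gt0.
have [N NP] := size_preimages.
have [r r0 rP] := preimages_matching.
have cg : continuous (fun x => c x * f x) by move=> x; apply: cvgM; [exact: cc|exact: cf].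
have en0 : 0 < e / N.+1%:R by rewrite divr_gt0.
have [s s0 sP] := dunif_continuous dm cX cg en0.
exists (Num.min r s) => [|y']; first by rewrite lt_min r0.
rewrite lt_min => /andP[yr ys]; have [h hd hp] := rP _ _ yr.
rewrite !RPFE -(perm_big _ hp)/= big_map -sumrB.
apply: (@le_lt_trans _ _ (\sum_(x <- pre y) e / N.+1%:R)).
  apply: le_trans (ler_norm_sum _ _ _) _.
  rewrite big_seq [leRHS]big_seq; apply: ler_sum => x xy.
  by apply/ltW/sP; apply: le_lt_trans ys; exact: hd.
rewrite big_const_seq count_predT iter_addr addr0 -(mulr_natr (e / N.+1%:R)) mulrAC.
rewrite ltr_pdivrMr// ltr_pM2l// ltr_nat ltnS; exact: NP.
Qed.

Lemma RPFD (c f g : X -> R) y :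
  RPF phi c (fun x => f x + g x) y = RPF phi c f y + RPF phi c g y.
Proof. by rewrite !RPFE -big_split/=; apply: eq_bigr => x _; rewrite mulrDr. Qed.

Lemma RPFZ (c f : X -> R) a y : RPF phi c (fun x => a * f x) y = a * RPF phi c f y.
Proof. by rewrite !RPFE mulr_sumr; apply: eq_bigr => x _; rewrite mulrCA. Qed.

Lemma RPF_weightM (c g f : X -> R) y :
  RPF phi (fun x => c x * g x) f y = RPF phi c (fun x => g x * f x) y.
Proof. by rewrite !RPFE; apply: eq_bigr => x _; rewrite mulrA. Qed.

Lemma RPF_pullback (c f g : X -> R) y :
  RPF phi c (fun x => g (phi x) * f x) y = g y * RPF phi c f y.
Proof.
rewrite !RPFE mulr_sumr [LHS]big_seq [RHS]big_seq; apply: eq_bigr => x.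
by rewrite mem_preimages => /eqP ->; rewrite mulrCA.
Qed.

Section positive_weight.
Variable c : X -> R.
Hypothesis c_ge0 : forall x, 0 <= c x.
Local Notation L := (RPF phi c).

Lemma RPF_ge0 f y : (forall x, 0 <= f x) -> 0 <= L f y.
Proof. by move=> f0; rewrite RPFE; apply: sumr_ge0 => x _; rewrite mulr_ge0. Qed.

Lemma RPF_le f g y : (forall x, f x <= g x) -> L f y <= L g y.
Proof. by move=> fg; rewrite !RPFE; apply: ler_sum => x _; rewrite ler_wpM2l. Qed.

Lemma RPF_norm f y : `|L f y| <= L (fun x => `|f x|) y.
Proof.
rewrite !RPFE; apply: le_trans (ler_norm_sum _ _ _) _.
by apply: ler_sum => x _; rewrite normrM ger0_norm.
Qed.

Lemma iter_RPF_ge0 n f y : (forall x, 0 <= f x) -> 0 <= iter n L f y.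
Proof. by move=> f0; elim: n y => //= n IH y; exact: RPF_ge0. Qed.

Lemma iter_RPF_le n f g y : (forall x, f x <= g x) -> iter n L f y <= iter n L g y.
Proof. by move=> f0; elim: n y => //= n IH y; exact: RPF_le. Qed.

Lemma iter_RPF_norm n f y : `|iter n L f y| <= iter n L (fun x => `|f x|) y.
Proof.
by elim: n y => //= n IH y; apply: le_trans (RPF_norm _ _) _; exact: RPF_le.
Qed.

End positive_weight.

Lemma iter_RPFD (c : X -> R) n (f g : X -> R) y : iter n (RPF phi c) (fun x => f x + g x) y =
  iter n (RPF phi c) f y + iter n (RPF phi c) g y.
Proof.
elim: n y => //= n IH y; rewrite -RPFD; congr RPF.
by apply/funext => x; exact: IH.
Qed.

Lemma iter_RPFZ (c : X -> R) n (f : X -> R) a y : iter n (RPF phi c) (fun x => a * f x) y =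
  a * iter n (RPF phi c) f y.
Proof.
elim: n y => //= n IH y; rewrite -RPFZ; congr RPF.
by apply/funext => x; exact: IH.
Qed.

Lemma iter_RPF_continuous (c : X -> R) n (f : X -> R) : continuous c -> continuous f ->
  continuous (iter n (RPF phi c) f).
Proof. by move=> cc cf; elim: n => //= n IH; exact: RPF_continuous. Qed.

Lemma iter_RPF_bound (c : X -> R) n (f : X -> R) M y : (forall x, 0 <= c x) -> (forall x, `|f x| <= M) ->
  `|iter n (RPF phi c) f y| <= M * iter n (RPF phi c) (cst 1) y.
Proof.
move=> c0 fM; apply: le_trans (iter_RPF_norm c0 _ _ _) _; rewrite -iter_RPFZ.
by apply: iter_RPF_le => // x /=; rewrite mulr1.
Qed.

End transfer.

Lemma geometric_small (R : realType) (C rho e : R) : 0 <= rho -> rho < 1 -> 0 < e ->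
  exists2 N, (0 < N)%N & forall n, (N <= n)%N -> C * rho ^+ n <= e.
Proof.
move=> r0 r1 e0.
have /cvgrPdist_le/(_ _ e0)[N _ NP] : geometric C rho @ \oo --> 0.
  by apply: cvg_geometric; rewrite ger0_norm.
exists N.+1 => // n /ltnW Nn; apply: le_trans (NP n Nn).
by rewrite sub0r normrN ler_norm.
Qed.

Lemma geometric_le0 (R : realType) (C rho x : R) : 0 <= rho -> rho < 1 ->
  (forall n, x <= C * rho ^+ n) -> x <= 0.
Proof.
move=> r0 r1 H; rewrite leNgt; apply/negP => x0.
have [N _ /(_ _ (leqnn N)) NP] := geometric_small C r0 r1 (divr_gt0 x0 (ltr0Sn R 1)).
by have := le_trans (H N) NP; lra.
Qed.

Section geometric_series.
Context (R : realType) (X : ptopologicalType) (d : X -> X -> R).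
Hypothesis dm : compatible_metric d.

Lemma geometric_series_continuous (u : nat -> X -> R) K rho :
  0 <= rho -> rho < 1 -> (forall n, continuous (u n)) ->
  (forall n x, `|u n x| <= K * rho ^+ n) ->
  exists2 s : X -> R, continuous s &
    forall x, (fun n => \sum_(k < n) u k x) @ \oo --> s x.
Proof.
move=> r0 r1 cu uK; have r1' : 0 < 1 - rho by rewrite subr_gt0.
pose S n x := \sum_(k < n) u k x.
have SE n : S n.+1 = fun x => S n x + u n x.
  by apply/funext => x; rewrite /S big_ord_recr.
have cS n : continuous (S n).
  elim: n => [|n IH] x.
    by rewrite (_ : S 0%N = cst 0); [exact: cvg_cst|apply/funext => z; rewrite /S big_ord0].
  by rewrite SE; apply: cvgD; [exact: IH|exact: cu].
(* The exact value of the geometric sum is kept, so that the two sides of the induction step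
   agree. *)
have Sd n j x : `|S (n + j)%N x - S n x| <= K * (rho ^+ n - rho ^+ (n + j)) / (1 - rho).
  elim: j => [|j IH]; first by rewrite addn0 !subrr normr0 mulr0 mul0r.
  rewrite addnS SE addrAC; apply: le_trans (ler_normD _ _) _.
  apply: le_trans (lerD IH (uK _ _)) _.
  rewrite le_eqVlt; apply/orP; left; apply/eqP.
  by rewrite exprS; field; rewrite gt_eqF.
have K0 : 0 <= K by have := uK 0%N point; rewrite expr0 mulr1; exact: le_trans.
have Sd' n m x : (n <= m)%N -> `|S m x - S n x| <= K / (1 - rho) * rho ^+ n.
  move=> nm; rewrite -(subnKC nm); apply: le_trans (Sd _ _ _) _.
  rewrite [leRHS]mulrAC ler_wpM2r ?invr_ge0 ?(ltW r1')//.
  by rewrite ler_wpM2l// gerBl exprn_ge0.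
have cvgS x : cvgn (fun n => S n x).
  apply/cauchy_cvgP/cauchy_ballP => e e0; rewrite near_simpl.
  have [N _ NP] := geometric_small (K / (1 - rho)) r0 r1 (divr_gt0 e0 (ltr0Sn R 2)).
  exists ([set m | (N <= m)%N], [set m | (N <= m)%N]) => /=.
    by split; exact: nbhs_infty_ge.
  move=> [m n] /= [Nm Nn]; rewrite /ball/=.
  have := le_trans (Sd' _ _ x Nm) (NP _ (leqnn N)).
  have := le_trans (Sd' _ _ x Nn) (NP _ (leqnn N)).
  move=> h1 h2; rewrite -(subrK (S N x) (S m x)) -addrA.
  apply: le_lt_trans (ler_normD _ _) _; rewrite (distrC (S N x)); lra.
exists (fun x => limn (fun n => S n x)); last by move=> x; exact: cvgS.
have Sl n x : `|limn (S ^~ x) - S n x| <= K / (1 - rho) * rho ^+ n.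
  have h : (fun m => `|S m x - S n x|) @ \oo --> `|limn (S ^~ x) - S n x|.
    by apply: cvg_norm; apply: cvgB; [exact: cvgS|exact: cvg_cst].
  rewrite -(cvg_lim (@Rhausdorff R) h); apply: limr_le; first by apply/cvg_ex; eexists; exact: h.
  by near=> m; apply: Sd'; near: m; exact: nbhs_infty_ge.
apply/(dcontinuousP dm) => x e e0.
have [N _ /(_ _ (leqnn N)) NP] := geometric_small (K / (1 - rho)) r0 r1 (divr_gt0 e0 (ltr0Sn R 3)).
have [r rgt0 rP] := (dcontinuousP dm (S N)).1 (cS N) x (e/4) (divr_gt0 e0 (ltr0Sn R 3)).
exists r => // y /rP xy.
have h1 := le_trans (Sl N x) NP; have h2 := le_trans (Sl N y) NP.
rewrite (_ : _ - _ = (limn (S ^~ x) - S N x) + (S N x - S N y) + (S N y - limn (S^~ y))); last first.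
  by ring.
apply: le_lt_trans (ler_normD _ _) _; rewrite (distrC (S N y)).
have := ler_normD (limn (S ^~ x) - S N x) (S N x - S N y); lra.
Unshelve. all: by end_near.
Qed.

End geometric_series.

(** * Growth rate of the iterates and supersolutions *)

Section growth_rate.
Context (R : realType) (X : ptopologicalType) (phi : X -> X)
  (d : X -> X -> R) (eps theta : R).
Hypothesis ES : expanding_system phi d eps theta.
Let dm := es_metric ES.
Let cX := es_compact ES.
Variable c : X -> R.
Hypothesis cc : continuous c.
Hypothesis c_ge0 : forall x, 0 <= c x.
Local Notation L := (RPF phi c).

(** By positivity the sup norm of [L^n 1] is the operator norm of [L^n], so the infimum of these
    numbers is Gelfand's limit of the [n]-th roots of the norms. *)
Definition growth_bounds := [set lam : R | 0 < lam /\
  exists C, forall n y, iter n L (cst 1) y <= C * lam ^+ n].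

Definition growth_rate := inf growth_bounds.

Lemma RPF1_bound : exists2 M : R, 0 < M & forall y, L (cst 1) y <= M.
Proof.
have [N NP] := size_preimages ES; have [M M0 MP] := bounded_continuous dm cX cc.
exists (N.+1%:R * M) => [|y]; first by rewrite mulr_gt0.
rewrite (RPFE ES); apply: (@le_trans _ _ (\sum_(x <- preimages phi y) M)).
  by apply: ler_sum => x _; rewrite mulr1; apply: le_trans (ler_norm _) (MP x).
rewrite big_const_seq count_predT iter_addr addr0 -(mulr_natl M).
by rewrite ler_wpM2r ?(ltW M0)// ler_nat ltnW// ltnS NP.
Qed.

Lemma iter_RPF_supersolution u lam n y : (forall x, 0 <= u x) -> 0 <= lam ->
  (forall y, L u y <= lam * u y) -> iter n L u y <= lam ^+ n * u y.
Proof.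
move=> u0 l0 Lu; elim: n y => [|n IH] y; first by rewrite expr0 mul1r.
rewrite iterS; apply: le_trans (RPF_le ES c_ge0 (g := fun x => lam ^+ n * u x) _ IH) _.
by rewrite (RPFZ ES) exprSr -mulrA ler_wpM2l// exprn_ge0.
Qed.

Lemma growth_bounds_nonempty : growth_bounds !=set0.
Proof.
have [M M0 MP] := RPF1_bound; exists M; split=> //; exists 1 => n y.
rewrite mul1r -[leRHS]mulr1; apply: (@iter_RPF_supersolution (cst 1)) => //.
  exact: ltW.
by move=> z; rewrite mulr1.
Qed.

Lemma growth_bounds_lb : lbound growth_bounds 0.
Proof. by move=> r [/ltW]. Qed.

Lemma growth_bounds_C lam : growth_bounds lam -> exists2 C : R, 0 < C &
  forall n y, iter n L (cst 1) y <= C * lam ^+ n.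
Proof.
move=> [l0 [C CP]]; exists C => //.
by have := CP 0%N point; rewrite expr0 mulr1 /=; apply: lt_le_trans.
Qed.

Lemma growth_bounds_up lam lam' : lam <= lam' -> growth_bounds lam -> growth_bounds lam'.
Proof.
move=> ll gl; have [C C0 CP] := growth_bounds_C gl; case: gl => l0 _.
split; first exact: lt_le_trans ll.
exists C => n y; apply: le_trans (CP _ _) _.
by rewrite ler_wpM2l ?(ltW C0)// lerXn2r// nnegrE ltW// (lt_le_trans l0).
Qed.

Lemma growth_rate_ge0 : 0 <= growth_rate.
Proof. exact: lb_le_inf growth_bounds_nonempty growth_bounds_lb. Qed.

Lemma growth_rate_lt lam : growth_rate < lam -> growth_bounds lam.
Proof.
move=> /(inf_lt growth_bounds_nonempty)[r gr rl].
exact: growth_bounds_up (ltW rl) gr.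
Qed.

Lemma growth_rate_le lam : growth_bounds lam -> growth_rate <= lam.
Proof. by move=> gl; apply: ge_inf => //; exists 0; exact: growth_bounds_lb. Qed.

Lemma growth_rate_gt lam N : 0 < lam -> lam < growth_rate ->
  exists n y, (N <= n)%N /\ lam ^+ n < iter n L (cst 1) y.
Proof.
move=> l0 lr; apply: contrapT => H.
have {}H n y : (N <= n)%N -> iter n L (cst 1) y <= lam ^+ n.
  by move=> Nn; rewrite leNgt; apply/negP => h; apply: H; exists n, y.
suff : growth_bounds lam by move/growth_rate_le; rewrite leNgt lr.
split=> //; have [M [M0 MP]] : growth_bounds !=set0 := growth_bounds_nonempty.
(* The finitely many iterates below [N] are bounded functions and are absorbed into the constant. *)
have {MP}[K KP] : exists K : R, forall n y, (n < N)%N -> iter n L (cst 1) y <= K * lam ^+ n.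
  elim: N {H} => [|k [K KP]]; first by exists 0.
  have [B B0 BP] := bounded_continuous dm cX
    (iter_RPF_continuous ES (n := k) cc (@cst_continuous X R 1)).
  exists (Num.max K (B / lam ^+ k)) => n y; rewrite ltnS leq_eqVlt => /predU1P[->|nk].
    apply: (@le_trans _ _ (B / lam ^+ k * lam ^+ k)).
      rewrite divfK ?expf_neq0 ?gt_eqF//.
      exact: le_trans (ler_norm _) (BP y).
    by rewrite ler_wpM2r ?exprn_ge0 ?(ltW l0)// le_max lexx orbT.
  apply: le_trans (KP _ _ nk) _.
  by rewrite ler_wpM2r ?exprn_ge0 ?(ltW l0)// le_max lexx.
exists (Num.max K 1) => n y; have [nN|Nn] := ltnP n N.
  apply: le_trans (KP _ _ nN) _.
  by rewrite ler_wpM2r ?exprn_ge0 ?(ltW l0)// le_max lexx.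
apply: le_trans (H _ _ Nn) _.
by rewrite -{1}[lam ^+ n]mul1r ler_wpM2r ?exprn_ge0 ?(ltW l0)// le_max lexx orbT.
Qed.

(* u is a truncated Neumann series of lam - L applied to 1. *)
Lemma supersolution lam : growth_rate < lam ->
  exists u : X -> R, [/\ continuous u, forall x, 1 <= u x & forall y, L u y <= lam * u y].
Proof.
move=> rl; pose l1 := (growth_rate + lam) / 2.
have rl1 : growth_rate < l1 by rewrite /l1; lra.
have l1l : l1 < lam by rewrite /l1; lra.
have gl1 := growth_rate_lt rl1; have [C C0 CP] := growth_bounds_C gl1.
have l10 : 0 < l1 by case: gl1.
have l0 : 0 < lam := lt_trans l10 l1l.
(* The truncation length is chosen so that the first omitted term [v N] is at most the leading term
   1. *)
have [||N N0 /(_ _ (leqnn N)) NP] := @geometric_small R C (l1 / lam) 1 _ _ ltr01.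
- by rewrite divr_ge0// ltW.
- by rewrite ltr_pdivrMr// mul1r.
pose v k x := iter k L (cst 1) x / lam ^+ k.
have v0 k x : 0 <= v k x by rewrite divr_ge0 ?exprn_ge0 ?(ltW l0)// (iter_RPF_ge0 ES).
pose u n x := \sum_(k < n) v k x.
(* [L] maps [v k] to [lam] times [v k.+1], so the partial sum loses its first term 1 and gains
   [v n]. *)
have Lu n y : L (u n) y = lam * (u n y - 1 + v n y).
  elim: n y => [|n IH] y.
    rewrite /u big_ord0 sub0r /v /= expr0 divr1 addNr mulr0.
    rewrite (_ : (fun x => _) = fun x => 0 * 1); last by apply/funext=> x; rewrite mul0r big_ord0.
    by rewrite (RPFZ ES) mul0r.
  rewrite /u (_ : (fun x => _) = fun x => u n x + (lam ^+ n)^-1 * iter n L (cst 1) x); last first.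
    by apply/funext=> x; rewrite big_ord_recr /= -/(u n x) [X in _ + X]mulrC.
  rewrite (RPFD ES) (RPFZ ES) IH big_ord_recr/= -/(u n y) /v /= exprS.
  by field; rewrite !gt_eqF ?exprn_gt0.
exists (u N); split.
- rewrite /u => x; elim: N {N0 NP} => [|n IH].
    by under eq_fun do rewrite big_ord0; exact: cvg_cst.
  under eq_fun do rewrite big_ord_recr/=.
  apply: cvgD; first exact: IH.
  by apply: cvgMl; apply: (iter_RPF_continuous ES) => //; exact: cst_continuous.
- move=> x; rewrite /u; case: N N0 {NP} => // n _.
  rewrite big_ord_recl /= {1}/v /= expr0 divr1 lerDl.
  by apply: sumr_ge0.
move=> y; rewrite Lu ler_wpM2l ?(ltW l0)// -addrA gerDl addrC subr_le0.
apply: le_trans NP; rewrite /v expr_div_n mulrA.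
by rewrite ler_wpM2r ?invr_ge0 ?exprn_ge0 ?(ltW l0).
Qed.

(** [h1 + i h2] is a complex eigenfunction with eigenvalue [a + i b]. The numbers [al] and [be] of
    the proof are the real and imaginary parts of its [n]-th power, and squared moduli multiply. *)
Lemma eigen_iter (a b : R) (h1 h2 : X -> R) n y :
  (forall y, L h1 y = a * h1 y - b * h2 y) -> (forall y, L h2 y = a * h2 y + b * h1 y) ->
  (iter n L h1 y) ^+ 2 + (iter n L h2 y) ^+ 2 =
    (a ^+ 2 + b ^+ 2) ^+ n * (h1 y ^+ 2 + h2 y ^+ 2).
Proof.
move=> H1 H2.
suff [al [be [E1 E2 E3]]] : exists al be : R,
    [/\ forall y, iter n L h1 y = al * h1 y - be * h2 y,
        forall y, iter n L h2 y = al * h2 y + be * h1 y &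
        al ^+ 2 + be ^+ 2 = (a ^+ 2 + b ^+ 2) ^+ n].
  by rewrite E1 E2 -E3; ring.
elim: n => [|n [al [be [E1 E2 E3]]]].
  by exists 1, 0; split => [z|z|] /=; rewrite ?expr0; ring.
exists (al * a - be * b), (al * b + be * a); split => [z|z|].
- rewrite iterS (_ : iter n L h1 = fun x => al * h1 x + (- be) * h2 x).
    by rewrite (RPFD ES) !(RPFZ ES) H1 H2; ring.
  by apply/funext => x; rewrite E1 mulNr.
- rewrite iterS (_ : iter n L h2 = fun x => al * h2 x + be * h1 x).
    by rewrite (RPFD ES) !(RPFZ ES) H1 H2; ring.
  by apply/funext => x; rewrite E2.
by rewrite [RHS]exprS -E3; ring.
Qed.

End growth_rate.

(** * Spectral radius *)

Section spectrum.
Context (R : realType) (X : ptopologicalType) (phi : X -> X)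
  (d : X -> X -> R) (eps theta : R).
Hypothesis ES : expanding_system phi d eps theta.
Let dm := es_metric ES.
Let cX := es_compact ES.
Variable c : X -> R.
Hypothesis cc : continuous c.
Hypothesis c_ge0 : forall x, 0 <= c x.
Local Notation L := (RPF phi c).
Local Notation r0 := (growth_rate phi c).

Let ratio (a b lam : R) : 0 < lam -> lam < Num.sqrt (a ^+ 2 + b ^+ 2) ->
  let q := a ^+ 2 + b ^+ 2 in [/\ 0 < q, 0 <= lam / Num.sqrt q & lam / Num.sqrt q < 1].
Proof.
move=> l0 lq q; have s0 := lt_trans l0 lq; split; first by rewrite -sqrtr_gt0.
  by rewrite divr_ge0 ?ltW.
by rewrite ltr_pdivrMr// mul1r.
Qed.

(** The difference of two solutions is an eigenfunction whose modulus is multiplied by [|a + i b|]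
    under [L], while [L^n] grows at most like [lam ^+ n] for some smaller [lam]. *)
Lemma shift_injective (a b : R) : r0 < Num.sqrt (a ^+ 2 + b ^+ 2) ->
  forall f g, CX f.1 -> CX f.2 -> CX g.1 -> CX g.2 ->
  RPF_shift phi c (a, b) f = RPF_shift phi c (a, b) g -> f = g.
Proof.
move=> rab f g f1 f2 g1 g2.
have [lam gl [l0 lq]] : exists2 lam, growth_bounds phi c lam &
    0 < lam /\ lam < Num.sqrt (a ^+ 2 + b ^+ 2).
  have h := growth_rate_ge0 ES cc c_ge0.
  exists ((r0 + Num.sqrt (a ^+ 2 + b ^+ 2)) / 2); last by lra.
  by apply: (growth_rate_lt ES cc c_ge0); lra.
have [C C0 CP] := growth_bounds_C gl.
have [q0 rho0 rho1] := ratio l0 lq; set q := a ^+ 2 + b ^+ 2 in q0 rho0 rho1 *.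
rewrite /RPF_shift /= => -[/funeqP e1 /funeqP e2].
pose h1 x := f.1 x - g.1 x; pose h2 x := f.2 x - g.2 x.
have LB u v y : L (fun x => u x - v x) y = L u y - L v y.
  under [X in L X]eq_fun do rewrite -mulN1r.
  by rewrite (RPFD ES) (RPFZ ES) mulN1r.
have H1 y : L h1 y = a * h1 y - b * h2 y.
  by rewrite LB; have := e1 y; rewrite /h1 /h2; lra.
have H2 y : L h2 y = a * h2 y + b * h1 y.
  by rewrite LB; have := e2 y; rewrite /h1 /h2; lra.
have ch1 : continuous h1 by move=> x; apply: cvgB; [exact: f1|exact: g1].
have ch2 : continuous h2 by move=> x; apply: cvgB; [exact: f2|exact: g2].
have [M1 M10 M1P] := bounded_continuous dm cX ch1.
have [M2 M20 M2P] := bounded_continuous dm cX ch2.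
have zero y : h1 y ^+ 2 + h2 y ^+ 2 <= 0.
  apply: (@geometric_le0 _ ((M1 * C) ^+ 2 + (M2 * C) ^+ 2) ((lam / Num.sqrt q) ^+ 2)).
  - exact: exprn_ge0.
  - by rewrite exprn_ilt1.
  move=> n; have := eigen_iter ES n y H1 H2; rewrite -/q => E.
  have qn : 0 < q ^+ n by rewrite exprn_gt0.
  rewrite -(ler_pM2l qn) -E.
  have -> : q ^+ n * (((M1 * C) ^+ 2 + (M2 * C) ^+ 2) * (lam / Num.sqrt q) ^+ 2 ^+ n) =
      (M1 * (C * lam ^+ n)) ^+ 2 + (M2 * (C * lam ^+ n)) ^+ 2.
    rewrite expr_div_n sqr_sqrtr ?(ltW q0)// expr_div_n.
    rewrite -exprM mulnC exprM; field; exact: lt0r_neq0.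
  have B M h : 0 < M -> (forall x, `|h x| <= M) ->
      (iter n L h y) ^+ 2 <= (M * (C * lam ^+ n)) ^+ 2.
    move=> M0 hM; rewrite -[leLHS]real_normK ?num_real//.
    rewrite lerXn2r// ?nnegrE ?mulr_ge0 ?exprn_ge0 ?(ltW M0) ?(ltW C0) ?(ltW l0)//.
    apply: le_trans (iter_RPF_bound ES n y c_ge0 hM) _.
    by rewrite ler_wpM2l ?(ltW M0).
  by apply: lerD; exact: B.
have h10 y : h1 y = 0.
  by have := zero y; have := sqr_ge0 (h1 y); have := sqr_ge0 (h2 y) => *;
     apply/eqP; rewrite -sqrf_eq0; apply/eqP; lra.
have h20 y : h2 y = 0.
  by have := zero y; have := sqr_ge0 (h1 y); have := sqr_ge0 (h2 y) => *;
     apply/eqP; rewrite -sqrf_eq0; apply/eqP; lra.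
rewrite (surjective_pairing f) (surjective_pairing g).
by congr pair; apply/funext => y; apply/eqP; rewrite -subr_eq0; apply/eqP; [exact: h10|exact: h20].
Qed.

(** With [z = a + i b], the solution is minus the Neumann series of [z^-(n+1) L^n g], whose terms
    decay like [(lam / |z|)^n]. *)
Lemma shift_surjective (a b : R) : r0 < Num.sqrt (a ^+ 2 + b ^+ 2) ->
  forall g, CX g.1 -> CX g.2 ->
  exists2 f, CX f.1 /\ CX f.2 & RPF_shift phi c (a, b) f = g.
Proof.
move=> rab [g1 g2] /= cg1 cg2.
have [lam gl [l0 lq]] : exists2 lam, growth_bounds phi c lam &
    0 < lam /\ lam < Num.sqrt (a ^+ 2 + b ^+ 2).
  have h := growth_rate_ge0 ES cc c_ge0.
  exists ((r0 + Num.sqrt (a ^+ 2 + b ^+ 2)) / 2); last by lra.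
  by apply: (growth_rate_lt ES cc c_ge0); lra.
have [C C0 CP] := growth_bounds_C gl.
have [q0 rho0 rho1] := ratio l0 lq; set q := a ^+ 2 + b ^+ 2 in q0 rho0 rho1 *.
set s := Num.sqrt q in rho0 rho1.
have s0 : 0 < s by rewrite sqrtr_gt0.
have [M1 M10 M1P] := bounded_continuous dm cX cg1.
have [M2 M20 M2P] := bounded_continuous dm cX cg2.
(* ab n is the n-th power of the complex inverse of a + i b *)
pose ab n := iter n (fun z : R * R => ((a * z.1 + b * z.2) / q, (a * z.2 - b * z.1) / q)) (1, 0).
have ab0 : ab 0%N = (1, 0) by [].
have abS n : (ab n).1 = a * (ab n.+1).1 - b * (ab n.+1).2 /\
             (ab n).2 = a * (ab n.+1).2 + b * (ab n.+1).1.
  by rewrite /ab iterS /=; split; rewrite /q; field; exact: lt0r_neq0.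
have abN n : (ab n).1 ^+ 2 + (ab n).2 ^+ 2 = (s ^+ n)^-1 ^+ 2.
  have ss : s ^+ 2 = q by rewrite sqr_sqrtr// ltW.
  elim: n => [|n IH]; first by rewrite ab0 /= expr0 invr1 expr1n expr0n addr0.
  have [E1 E2] := abS n.
  have -> : (s ^+ n.+1)^-1 ^+ 2 = (s ^+ n)^-1 ^+ 2 / q.
    by rewrite (exprSr s) invfM exprMn -ss (exprVn s).
  by rewrite -IH E1 E2 /q; field; exact: lt0r_neq0.
have ab1 n : `|(ab n).1| <= (s ^+ n)^-1.
  have h : 0 <= (s ^+ n)^-1 by rewrite invr_ge0 exprn_ge0// ltW.
  rewrite -(ger0_norm h) -ler_sqr ?nnegrE// !real_normK ?num_real// -abN.
  by rewrite lerDl sqr_ge0.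
have ab2 n : `|(ab n).2| <= (s ^+ n)^-1.
  have h : 0 <= (s ^+ n)^-1 by rewrite invr_ge0 exprn_ge0// ltW.
  rewrite -(ger0_norm h) -ler_sqr ?nnegrE// !real_normK ?num_real// -abN.
  by rewrite lerDr sqr_ge0.
(* [u1] and [u2] are the real and imaginary parts of [z^-(n+1) L^n (g1 + i g2)]. *)
pose u1 n x := (ab n.+1).1 * iter n L g1 x - (ab n.+1).2 * iter n L g2 x.
pose u2 n x := (ab n.+1).1 * iter n L g2 x + (ab n.+1).2 * iter n L g1 x.
have cu1 n : continuous (u1 n).
  by move=> x; apply: cvgB; apply: cvgMl_tmp; apply: (iter_RPF_continuous ES).
have cu2 n : continuous (u2 n).
  by move=> x; apply: cvgD; apply: cvgMl_tmp; apply: (iter_RPF_continuous ES).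
pose K := (M1 + M2) * C / s.
have term (al M : R) (g : X -> R) n x : `|al| <= (s ^+ n.+1)^-1 -> 0 < M ->
    (forall x, `|g x| <= M) -> `|al * iter n L g x| <= M * C / s * (lam / s) ^+ n.
  move=> hal M0 gM; rewrite normrM.
  apply: le_trans (ler_pM _ _ hal (iter_RPF_bound ES n x c_ge0 gM)) _ => //.
  rewrite mulrCA -!mulrA ler_wpM2l ?(ltW M0)// mulrC.
  rewrite expr_div_n exprS invfM.
  rewrite [leRHS](_ : _ = C * lam ^+ n * (s^-1 * (s ^+ n)^-1)); last by field; rewrite !gt_eqF ?exprn_gt0.
  by rewrite ler_wpM2r// ?mulr_ge0 ?invr_ge0 ?exprn_ge0 ?(ltW s0)//.
have KE n : K * (lam / s) ^+ n = M1 * C / s * (lam / s) ^+ n + M2 * C / s * (lam / s) ^+ n.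
  by rewrite /K; ring.
have u1K n x : `|u1 n x| <= K * (lam / s) ^+ n.
  by rewrite KE; apply: le_trans (ler_normB _ _) _; apply: lerD; apply: term.
have u2K n x : `|u2 n x| <= K * (lam / s) ^+ n.
  by rewrite KE addrC; apply: le_trans (ler_normD _ _) _; apply: lerD; apply: term.
have [f1 cf1 f1P] := geometric_series_continuous dm rho0 rho1 cu1 u1K.
have [f2 cf2 f2P] := geometric_series_continuous dm rho0 rho1 cu2 u2K.
pose S1 n x := \sum_(k < n) u1 k x; pose S2 n x := \sum_(k < n) u2 k x.
have Lcvg (S : nat -> X -> R) (f : X -> R) y : (forall x, S ^~ x @ \oo --> f x) ->
    (fun n => L (S n) y) @ \oo --> L f y.
  move=> Sf; rewrite (RPFE ES).
  rewrite (_ : (fun n => _) = fun n => \sum_(x <- preimages phi y) c x * S n x); last first.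
    by apply/funext => n; rewrite (RPFE ES).
  elim: (preimages phi y) => [|x t IH].
    rewrite big_nil (_ : (fun n => _) = cst 0); first exact: cvg_cst.
    by apply/funext => n; rewrite big_nil.
  rewrite big_cons (_ : (fun n => _) = fun n => c x * S n x + \sum_(z <- t) c z * S n z).
    by apply: cvgD => //; apply: cvgMl_tmp; exact: Sf.
  by apply/funext => n; rewrite big_cons.
(* Telescoping in complex form: [(L - z) S_n = z^-n L^n g - g], and the first term on the right
   tends to 0. *)
have LS n y : L (S1 n) y - a * S1 n y + b * S2 n y =
    (ab n).1 * iter n L g1 y - (ab n).2 * iter n L g2 y - g1 y /\
    L (S2 n) y - a * S2 n y - b * S1 n y =
    (ab n).1 * iter n L g2 y + (ab n).2 * iter n L g1 y - g2 y.
  elim: n y => [|n IH] y.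
    have L0 : L (fun=> 0) y = 0.
      by rewrite (RPFE ES) big1// => x _; rewrite mulr0.
    rewrite /S1 /S2 !big_ord0 ab0 /=.
    by under eq_fun do rewrite big_ord0; under [X in L X y - _ - _]eq_fun do rewrite big_ord0;
       rewrite L0; split; ring.
  have S1S x : S1 n.+1 x = S1 n x + u1 n x by rewrite /S1 big_ord_recr.
  have S2S x : S2 n.+1 x = S2 n x + u2 n x by rewrite /S2 big_ord_recr.
  rewrite (funext S1S) (funext S2S) (RPFD ES c (S1 n) (u1 n)) (RPFD ES c (S2 n) (u2 n)).
  have [IH1 IH2] := IH y; have [E1 E2] := abS n.
  have Lu1 : L (u1 n) y = (ab n.+1).1 * iter n.+1 L g1 y - (ab n.+1).2 * iter n.+1 L g2 y.
    rewrite /u1; under [X in L X]eq_fun do rewrite -mulNr.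
    by rewrite (RPFD ES) !(RPFZ ES) mulNr.
  have Lu2 : L (u2 n) y = (ab n.+1).1 * iter n.+1 L g2 y + (ab n.+1).2 * iter n.+1 L g1 y.
    by rewrite /u2 (RPFD ES) !(RPFZ ES).
  rewrite Lu1 Lu2 /u1 /u2; split.
    transitivity (L (S1 n) y - a * S1 n y + b * S2 n y +
       ((ab n.+1).1 * iter n.+1 L g1 y - (ab n.+1).2 * iter n.+1 L g2 y) -
       (a * (ab n.+1).1 - b * (ab n.+1).2) * iter n L g1 y +
       (a * (ab n.+1).2 + b * (ab n.+1).1) * iter n L g2 y); first by ring.
    by rewrite IH1 -E1 -E2; ring.
  transitivity (L (S2 n) y - a * S2 n y - b * S1 n y +
       ((ab n.+1).1 * iter n.+1 L g2 y + (ab n.+1).2 * iter n.+1 L g1 y) -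
       (a * (ab n.+1).1 - b * (ab n.+1).2) * iter n L g2 y -
       (a * (ab n.+1).2 + b * (ab n.+1).1) * iter n L g1 y); first by ring.
  by rewrite IH2 -E1 -E2; ring.
have term0 (al : nat -> R) (g : X -> R) y : (forall n, `|al n| <= (s ^+ n)^-1) -> CX g ->
    (fun n => al n * iter n L g y) @ \oo --> (0 : R).
  move=> hal cg; have [M M0 MP] := bounded_continuous dm cX cg.
  apply/cvgrPdist_le => e e_gt0.
  have [N _ NP] := geometric_small (M * C) rho0 rho1 e_gt0.
  exists N => // n /= Nn; rewrite sub0r normrN; apply: le_trans (NP n Nn).
  rewrite normrM; apply: le_trans (ler_pM _ _ (hal n) (iter_RPF_bound ES n y c_ge0 MP)) _ => //.
  rewrite mulrCA -!mulrA ler_wpM2l ?(ltW M0)// mulrC expr_div_n mulrA.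
  by rewrite ler_wpM2r// invr_ge0 exprn_ge0// ltW.
have lim_eq (F : nat -> R) (x y : R) : F @ \oo --> x -> F @ \oo --> y -> x = y.
  by move=> Fx Fy; exact: (cvg_unique (@Rhausdorff R) Fx Fy).
have LN (f : X -> R) y : L (fun x => - f x) y = - L f y.
  by under [X in L X]eq_fun do rewrite -mulN1r; rewrite (RPFZ ES) mulN1r.
exists (fun x => - f1 x, fun x => - f2 x); first by split=> x; apply: cvgN; [exact: cf1|exact: cf2].
rewrite /RPF_shift /=; congr pair; apply/funext => y; rewrite LN.
  have E : L f1 y - a * f1 y + b * f2 y = 0 - 0 - g1 y.
    apply: (lim_eq (fun n => L (S1 n) y - a * S1 n y + b * S2 n y)).
      by apply: cvgD; [apply: cvgB; [exact: Lcvg|]|]; apply: cvgMl_tmp; [exact: f1P|exact: f2P].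
    under eq_fun do rewrite (LS _ y).1.
    by apply: cvgB; [apply: cvgB; exact: term0|exact: cvg_cst].
  by move: E; lra.
have E : L f2 y - a * f2 y - b * f1 y = 0 + 0 - g2 y.
  apply: (lim_eq (fun n => L (S2 n) y - a * S2 n y - b * S1 n y)).
    by apply: cvgB; [apply: cvgB; [exact: Lcvg|]|]; apply: cvgMl_tmp; [exact: f2P|exact: f1P].
  under eq_fun do rewrite (LS _ y).2.
  by apply: cvgB; [apply: cvgD; exact: term0|exact: cvg_cst].
by move: E; lra.
Qed.

(* If [r0 - L] maps v to 1, then comparing v with the positive resolvent at a slightly
   larger parameter shows v > 0, so v is a supersolution for a parameter below [r0]. *)
Lemma growth_rate_in_spectrum : 0 < r0 -> RPF_spectrum phi c (r0, 0).
Proof.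
move=> r0_gt0 [_ /(_ (cst (-1), cst 0))[||[v w] /= [cv _]]].
- exact: cst_continuous.
- exact: cst_continuous.
rewrite /RPF_shift /= => -[/funeqP vE _].
have {}vE y : L v y = r0 * v y - 1 by have := vE y; rewrite /=; lra.
have [M M0 MP] := bounded_continuous dm cX cv.
(* Since [|v| <= M], the excess [(lam - r0) * v] is at least [- 1/2], hence
   [L v = r0 v - 1 <= lam v]. The intermediate [l1] controls the growth of [L^n]. *)
pose lam := r0 + (2 * M)^-1; pose l1 := r0 + (4 * M)^-1.
have i2 : 0 < (2 * M)^-1 by rewrite invr_gt0; lra.
have i4 : (2 * M)^-1 = 2 * (4 * M)^-1 by field; exact: lt0r_neq0.
have l1r : r0 < l1 by rewrite /l1; lra.
have ll : l1 < lam by rewrite /l1 /lam; lra.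
have l0 : 0 < lam by rewrite /lam; lra.
have [C C0 CP] := growth_bounds_C (growth_rate_lt ES cc c_ge0 l1r).
have Lv y : L v y <= lam * v y.
  have E : (2 * M)^-1 * M = 2^-1 by field; exact: lt0r_neq0.
  have : - ((2 * M)^-1 * v y) <= (2 * M)^-1 * M.
    rewrite -mulrN ler_wpM2l ?(ltW i2)//; apply: le_trans (ler_norm _) _.
    by rewrite normrN.
  by rewrite vE /lam E mulrDl; lra.
have Lnv n y : iter n L v y <= lam ^+ n * v y.
  elim: n y => [|n IH] y; first by rewrite expr0 mul1r.
  rewrite iterS; apply: le_trans (RPF_le ES c_ge0 (g := fun x => lam ^+ n * v x) _ IH) _.
  by rewrite (RPFZ ES) exprSr -mulrA ler_wpM2l// exprn_ge0// ltW.
(* [lam^n v] lies above [L^n v], which is at least [- M C l1^n]; dividing by [lam^n] leaves a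
   negative bound that tends to 0. *)
have v0 y : 0 <= v y.
  rewrite -oppr_le0; apply: (@geometric_le0 _ (M * C) (l1 / lam)).
  - by rewrite divr_ge0 ?ltW// (lt_trans r0_gt0).
  - by rewrite ltr_pdivrMr// mul1r.
  move=> n; have ln0 : 0 < lam ^+ n by rewrite exprn_gt0.
  rewrite -(ler_pM2l ln0) expr_div_n.
  have -> : lam ^+ n * (M * C * (l1 ^+ n / lam ^+ n)) = M * (C * l1 ^+ n).
    by field; exact: lt0r_neq0.
  have h1 := Lnv n y; have := iter_RPF_bound ES n y c_ge0 MP.
  rewrite ler_norml => /andP[h2 _].
  rewrite mulrN lerNl; apply: le_trans h1; apply: le_trans h2.
  by rewrite lerN2 ler_wpM2l ?(ltW M0).
have v1 y : 1 <= r0 * v y.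
  by have := RPF_ge0 ES c_ge0 y v0; rewrite vE; lra.
(* From [v <= M] the constant 1 dominates [v / M], so [L v <= (r0 - M^-1) v]; the entry [r0 / 2]
   only keeps the parameter positive. *)
pose r' := Num.max (r0 / 2) (r0 - M^-1).
have r'lt : r' < r0 by rewrite gt_max; apply/andP; split; [lra|rewrite gtrBl invr_gt0].
have r'0 : 0 < r' by rewrite lt_max divr_gt0.
suff : growth_bounds phi c r'.
  by move=> /(growth_rate_le); rewrite leNgt r'lt.
split=> //; exists (r0 * M) => n y.
have Lv' z : L v z <= r' * v z.
  rewrite vE; apply: (@le_trans _ _ ((r0 - M^-1) * v z)).
    rewrite mulrBl lerB// -[leRHS](mulVf (lt0r_neq0 M0)).
    by rewrite ler_wpM2l ?invr_ge0 ?(ltW M0)//; apply: le_trans (ler_norm _) (MP z).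
  by rewrite ler_wpM2r// le_max lexx orbT.
have h1 : iter n L (cst 1) y <= r0 * iter n L v y.
  by rewrite -(iter_RPFZ ES); apply: (iter_RPF_le ES).
apply: le_trans h1 _; rewrite -mulrA ler_wpM2l ?(ltW r0_gt0)//.
apply: le_trans (iter_RPF_supersolution ES c_ge0 n y v0 (ltW r'0) Lv') _.
rewrite mulrC ler_wpM2r ?exprn_ge0 ?(ltW r'0)//.
exact: le_trans (ler_norm _) (MP y).
Qed.

Lemma spectral_radiusE : spectral_radius phi c = r0.
Proof.
rewrite /spectral_radius; set A := (X in sup X).
have ub : ubound A r0.
  move=> _ [[a b] /= lamS <-]; rewrite leNgt; apply/negP => rab; apply: lamS; split.
    exact: shift_injective.
  exact: shift_surjective.
have rge0 := growth_rate_ge0 ES cc c_ge0.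
move: (rge0); rewrite le_eqVlt => /predU1P[r00|r0_gt0]; last first.
  have Ar : A r0.
    exists (r0, 0); first exact: growth_rate_in_spectrum.
    by rewrite /= expr0n addr0 sqrtr_sqr ger0_norm.
  apply/le_anti/andP; split; first by apply: ge_sup => //; exists r0.
  by apply: ub_le_sup => //; exists r0.
(* For [r0 = 0] the spectrum may be left possibly empty, since the supremum of the empty set is 0 by
   convention. *)
have [->|/set0P[z Az]] := eqVneq A set0; first by rewrite sup0.
apply/le_anti/andP; split; first by apply: ge_sup => //; exists z.
apply: (@le_trans _ _ z); last by apply: ub_le_sup => //; exists r0.
by case: Az => l _ <-; rewrite -r00 sqrtr_ge0.
Qed.

End spectrum.

(** * Entropy *)

Section finite_gibbs.
Context (R : realType).

(** The factor [t] neutralises the default value of [ln 0], so entropies can be written without a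
    case distinction. *)
Lemma etaRE (t : R) : etaR t = t * - ln t.
Proof. by rewrite /etaR; case: eqP => [->|_]; rewrite ?mul0r// mulrN. Qed.

Lemma ln_le_sub1 (x : R) : 0 < x -> ln x <= x - 1.
Proof. by move=> x0; have := @le_ln1Dx R (x - 1); rewrite (addrC 1) subrK; apply; lra. Qed.

(** [ln (q / p) <= q / p - 1], multiplied by [p], bounds each term by the difference [q - p]. Where
    [q] vanishes so does [p], which keeps the default value of [ln 0] out of the sum. *)
Lemma gibbs (T : finType) (p q : T -> R) :
  (forall t, 0 <= p t) -> (forall t, 0 <= q t) -> (forall t, q t = 0 -> p t = 0) ->
  \sum_t q t <= \sum_t p t ->
  \sum_t p t * - ln (p t) <= \sum_t p t * - ln (q t).
Proof.
move=> p0 q0 qp sqp.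
have H t : p t * - ln (p t) <= p t * - ln (q t) + (q t - p t).
  move: (p0 t); rewrite le_eqVlt => /predU1P[<-|pt0].
    by rewrite !mul0r add0r subr0.
  have qt0 : 0 < q t.
    rewrite lt_neqAle q0 andbT eq_sym; apply/negP => /eqP /qp pt.
    by rewrite pt ltxx in pt0.
  have := ln_le_sub1 (divr_gt0 qt0 pt0); rewrite ln_div ?posrE// => h.
  have : p t * (ln (q t) - ln (p t)) <= p t * (q t / p t - 1) by rewrite ler_wpM2l// ltW.
  rewrite mulrBr mulrBr mulr1 mulrCA divff ?gt_eqF// mulr1 !mulrN; lra.
apply: (@le_trans _ _ (\sum_t (p t * - ln (q t) + (q t - p t)))); first exact: ler_sum.
by rewrite big_split/= gerDl sumrB subr_le0.
Qed.

End finite_gibbs.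

Section random_variables.
Context (R : realType) (dO : measure_display) (O : measurableType dO)
  (mu : probability O R).

Definition prob (A : set O) : R := fine (mu A).

Lemma prob_ge0 A : 0 <= prob A.
Proof. by apply: fine_ge0. Qed.

Lemma probE A : measurable A -> mu A = (prob A)%:E.
Proof. by move=> mA; rewrite fineK// fin_num_measure. Qed.

Lemma prob_le A B : measurable A -> measurable B -> A `<=` B -> prob A <= prob B.
Proof.
move=> mA mB AB; rewrite -lee_fin -!probE//.
by apply: le_measure; rewrite ?inE.
Qed.

Lemma probU A B : measurable A -> measurable B -> A `&` B = set0 ->
  prob (A `|` B) = prob A + prob B.
Proof. by move=> mA mB AB; rewrite /prob measureU// fineD// fin_num_measure. Qed.

Lemma prob0 : prob set0 = 0.
Proof. by rewrite /prob measure0. Qed.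

Lemma probT : prob setT = 1.
Proof. by rewrite /prob probability_setT. Qed.

(** Finite partitions are encoded as maps to a finite type: joins become pairs and coarsenings
    become compositions. *)
Definition rv (T : Type) (xi : O -> T) := forall t, measurable (xi @^-1` [set t]).
Definition pr (T : Type) (xi : O -> T) t := prob (xi @^-1` [set t]).

Lemma pr_ge0 (T : Type) (xi : O -> T) t : 0 <= pr xi t.
Proof. exact: prob_ge0. Qed.

Lemma rv_mem (T : finType) (xi : O -> T) (r : seq T) : rv xi -> measurable [set x | xi x \in r].
Proof.
move=> mxi; elim: r => [|t r IH].
  by rewrite (_ : [set _ | _] = set0)//; apply/seteqP; split.
rewrite (_ : [set _ | _] = xi @^-1` [set t] `|` [set x | xi x \in r]).
  exact: measurableU.
apply/seteqP; split => x /=; rewrite inE; first by move=> /predU1P[|]; [left|right].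
by move=> [->|->]; rewrite ?eqxx ?orbT.
Qed.

Lemma rv_pred (T : finType) (xi : O -> T) (P : pred T) : rv xi -> measurable [set x | P (xi x)].
Proof.
move=> mxi; rewrite (_ : [set _ | _] = [set x | xi x \in enum P]); first exact: rv_mem.
by apply/seteqP; split => x /=; rewrite mem_enum.
Qed.

Lemma rv_comp (T S : finType) (xi : O -> T) (f : T -> S) : rv xi -> rv (f \o xi).
Proof.
move=> mxi s; rewrite (_ : _ @^-1` _ = [set x | f (xi x) == s]).
  exact: (rv_pred (fun t => f t == s)).
by apply/seteqP; split => x /= /eqP.
Qed.

Lemma rv_pair (T S : finType) (xi : O -> T) (ze : O -> S) : rv xi -> rv ze ->
  rv (fun x => (xi x, ze x)).
Proof.
move=> mxi mze [t s]; rewrite (_ : _ @^-1` _ = xi @^-1` [set t] `&` ze @^-1` [set s]).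
  exact: measurableI.
by apply/seteqP; split => x /= [-> ->].
Qed.

Lemma prob_mem (T : finType) (xi : O -> T) (r : seq T) : rv xi -> uniq r ->
  prob [set x | xi x \in r] = \sum_(t <- r) pr xi t.
Proof.
move=> mxi; elim: r => [|t r IH] /=.
  by rewrite big_nil (_ : [set _ | _] = set0) ?prob0//; apply/seteqP; split.
move=> /andP[tr ur]; rewrite big_cons -IH// /pr -probU//; last first.
- by apply/seteqP; split => x //= -[->]; rewrite (negPf tr).
- exact: rv_mem.
congr prob; apply/seteqP; split => x /=; rewrite inE; first by move=> /predU1P[|]; [left|right].
by move=> [->|->]; rewrite ?eqxx ?orbT.
Qed.

Lemma prob_pred (T : finType) (xi : O -> T) (P : pred T) : rv xi ->
  prob [set x | P (xi x)] = \sum_(t | P t) pr xi t.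
Proof.
move=> mxi; rewrite -big_enum -prob_mem ?enum_uniq//.
by congr prob; apply/seteqP; split => x /=; rewrite mem_enum.
Qed.

Lemma pr_sum1 (T : finType) (xi : O -> T) : rv xi -> \sum_t pr xi t = 1.
Proof.
move=> mxi; rewrite -(prob_pred predT mxi) -probT.
by congr prob; apply/seteqP; split.
Qed.

Lemma pr_comp (T S : finType) (xi : O -> T) (f : T -> S) s : rv xi ->
  pr (f \o xi) s = \sum_(t | f t == s) pr xi t.
Proof.
move=> mxi; rewrite -(prob_pred (fun t => f t == s) mxi); congr prob.
by apply/seteqP; split => x /= /eqP.
Qed.

Lemma pr_comp_ge (T S : finType) (xi : O -> T) (f : T -> S) t : rv xi ->
  pr xi t <= pr (f \o xi) (f t).
Proof.
move=> mxi; rewrite pr_comp// (bigD1 t)//= lerDl; apply: sumr_ge0 => i _.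
exact: pr_ge0.
Qed.

Lemma expect_comp (T S : finType) (xi : O -> T) (f : T -> S) (F : S -> R) : rv xi ->
  \sum_t pr xi t * F (f t) = \sum_s pr (f \o xi) s * F s.
Proof.
move=> mxi; rewrite (partition_big f predT)//=; apply: eq_bigr => s _.
by rewrite pr_comp// mulr_suml; apply: eq_bigr => t /eqP ->.
Qed.

Definition ent (T : finType) (xi : O -> T) : R := \sum_t pr xi t * - ln (pr xi t).

Lemma ent_comp (T S : finType) (xi : O -> T) (f : T -> S) : rv xi ->
  ent (f \o xi) <= ent xi.
Proof.
move=> mxi; rewrite /ent -(expect_comp f (fun s => - ln (pr (f \o xi) s)) mxi).
apply: ler_sum => t _; have := pr_ge0 xi t; rewrite le_eqVlt => /predU1P[<-|p0].
  by rewrite !mul0r.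
rewrite ler_wpM2l ?(ltW p0)// lerN2 ler_ln ?posrE//; first exact: pr_comp_ge.
by apply: lt_le_trans p0 _; exact: pr_comp_ge.
Qed.

Lemma ent_inj (T S : finType) (xi : O -> T) (f : T -> S) (g : S -> T) : rv xi ->
  cancel f g -> ent (f \o xi) = ent xi.
Proof.
move=> mxi fg; apply/le_anti/andP; split; first exact: ent_comp.
have {1}-> : xi = g \o (f \o xi) by apply/funext => x /=; rewrite fg.
exact: ent_comp _ (rv_comp _ mxi).
Qed.

(** The left side is the conditional entropy of [xi] given [ze]. Gibbs' inequality is applied with
    the competitor [q t s * pr ze s], where [q] is any positive substochastic kernel. *)
Lemma cond_ent_le (T S : finType) (xi : O -> T) (ze : O -> S) (q : T -> S -> R) :
  rv xi -> rv ze -> (forall t s, 0 < q t s) -> (forall s, \sum_t q t s <= 1) ->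
  ent (fun x => (xi x, ze x)) - ent ze <=
    \sum_u pr (fun x => (xi x, ze x)) u * - ln (q u.1 u.2).
Proof.
move=> mxi mze q0 q1; set z := fun x => _; have mz : rv z := rv_pair mxi mze.
have le2 u : pr z u <= pr ze u.2 := pr_comp_ge snd u mz.
rewrite lerBlDr {2}/ent -[X in _ + X](expect_comp snd (fun s => - ln (pr ze s)) mz).
rewrite -big_split /=.
apply: le_trans (_ : _ <= \sum_u pr z u * - ln (q u.1 u.2 * pr ze u.2)) _; last first.
  apply: ler_sum => u _; have := pr_ge0 z u; rewrite le_eqVlt => /predU1P[<-|p0].
    by rewrite !mul0r addr0.
  rewrite lnM ?posrE// ?(lt_le_trans p0)// opprD mulrDr//.
apply: gibbs => [u|u|u|].
- exact: pr_ge0.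
- by rewrite mulr_ge0 ?pr_ge0// ltW.
- move=> /eqP; rewrite mulf_eq0 gt_eqF//= => /eqP h.
  by apply/le_anti; rewrite pr_ge0 -h le2.
rewrite (pr_sum1 mz) -(pr_sum1 mze).
rewrite -(pair_bigA _ (fun t s => q t s * pr ze s))/= exchange_big/=.
by apply: ler_sum => s _; rewrite -mulr_suml ler_piMl ?pr_ge0.
Qed.

Lemma pr_marginal2 (T S : finType) (xi : O -> T) (ze : O -> S) s : rv xi -> rv ze ->
  \sum_t pr (fun x => (xi x, ze x)) (t, s) = pr ze s.
Proof.
move=> mxi mze; rewrite [RHS](pr_comp snd s (rv_pair mxi mze) : pr ze s = _).
transitivity (\sum_t \sum_(s' | s' == s) pr (fun x => (xi x, ze x)) (t, s')).
  by apply: eq_bigr => t _; rewrite big_pred1_eq.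
by rewrite pair_big_dep/=; apply: eq_big => [|[]].
Qed.

Lemma pr_marginal1 (T S : finType) (xi : O -> T) (ze : O -> S) t : rv xi -> rv ze ->
  \sum_s pr (fun x => (xi x, ze x)) (t, s) = pr xi t.
Proof.
move=> mxi mze; rewrite [RHS](pr_comp fst t (rv_pair mxi mze) : pr xi t = _).
transitivity (\sum_(t' | t' == t) \sum_s pr (fun x => (xi x, ze x)) (t', s)).
  by rewrite big_pred1_eq.
by rewrite pair_big_dep/=; apply: eq_big => [[a b]|[]]//=; rewrite andbT.
Qed.

(** Gibbs' inequality against the coupling that makes [xi] and [ch] conditionally independent given
    [ze]. *)
Lemma ent_submodular (T S U : finType) (xi : O -> T) (ze : O -> S) (ch : O -> U) :
  rv xi -> rv ze -> rv ch ->
  ent (fun x => (xi x, (ze x, ch x))) + ent ze <=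
    ent (fun x => (xi x, ze x)) + ent (fun x => (ze x, ch x)).
Proof.
move=> mxi mze mch.
pose z x := (xi x, (ze x, ch x)); pose a x := (xi x, ze x); pose b x := (ze x, ch x).
have ma : rv a := rv_pair mxi mze. have mb : rv b := rv_pair mze mch.
have mz : rv z := rv_pair mxi mb.
pose fa (u : T * (S * U)) := (u.1, u.2.1).
have lea u : pr z u <= pr a (fa u) := pr_comp_ge fa u mz.
have leb u : pr z u <= pr b u.2 := pr_comp_ge snd u mz.
have lez u : pr z u <= pr ze u.2.1 := pr_comp_ge (fst \o snd) u mz.
have -> : ent ze = \sum_u pr z u * - ln (pr ze u.2.1).
  by rewrite (expect_comp (fst \o snd) (fun s => - ln (pr ze s)) mz).
have -> : ent a = \sum_u pr z u * - ln (pr a (fa u)).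
  by rewrite (expect_comp fa (fun s => - ln (pr a s)) mz).
have -> : ent b = \sum_u pr z u * - ln (pr b u.2).
  by rewrite (expect_comp snd (fun s => - ln (pr b s)) mz).
rewrite -lerBrDr -big_split/= -sumrB.
apply: le_trans (_ : _ <= \sum_u pr z u * - ln (pr a (fa u) * pr b u.2 / pr ze u.2.1)) _; last first.
  apply: ler_sum => u _; have := pr_ge0 z u; rewrite le_eqVlt => /predU1P[<-|p0].
    by rewrite !mul0r addr0 subr0.
  have h1 := lt_le_trans p0 (lea u); have h2 := lt_le_trans p0 (leb u).
  have h3 := lt_le_trans p0 (lez u).
  by rewrite ln_div ?posrE ?mulr_gt0// lnM ?posrE// -mulrDr -mulrBr le_eqVlt; apply/orP; left; apply/eqP; congr (_ * _); ring.
apply: gibbs => [u|u|u|].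
- exact: pr_ge0.
- by rewrite !mulr_ge0 ?invr_ge0 ?pr_ge0.
- move=> /eqP; rewrite !mulf_eq0 invr_eq0 => /orP[/orP[]|] /eqP h; apply/le_anti;
  by rewrite pr_ge0 andbT -h ?lea ?leb ?lez.
rewrite (pr_sum1 mz) -(pr_sum1 mze).
rewrite -(pair_bigA _ (fun t v => pr a (t, v.1) * pr b v / pr ze v.1))/= exchange_big/=.
rewrite (eq_bigr (fun v => \sum_t pr a (t, v.1) * pr b (v.1, v.2) / pr ze v.1)); last by case.
rewrite -(pair_bigA _ (fun s w => \sum_t pr a (t, s) * pr b (s, w) / pr ze s))/=.
apply: ler_sum => s _.
have Ea : \sum_t pr a (t, s) = pr ze s := pr_marginal2 s mxi mze.
have Eb : \sum_w pr b (s, w) = pr ze s := pr_marginal1 s mze mch.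
under eq_bigr do rewrite -mulr_suml -mulr_suml Ea.
have [z0|n0] := eqVneq (pr ze s) 0.
  by rewrite big1 ?z0// => w _; rewrite invr0 mulr0.
rewrite (eq_bigr (fun w => pr b (s, w))); first by rewrite Eb.
by move=> w _; rewrite mulrAC divff// mul1r.
Qed.

End random_variables.

Section words.
Context (T : finType) (n : nat).

Definition wcons (u : T * {ffun 'I_n -> T}) : {ffun 'I_n.+1 -> T} :=
  [ffun i => if unlift ord0 i is Some j then u.2 j else u.1].
Definition wuncons (w : {ffun 'I_n.+1 -> T}) : T * {ffun 'I_n -> T} :=
  (w ord0, [ffun j => w (lift ord0 j)]).
Definition wrcons (u : {ffun 'I_n -> T} * T) : {ffun 'I_n.+1 -> T} :=
  [ffun i => if unlift ord_max i is Some j then u.1 j else u.2].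
Definition wunrcons (w : {ffun 'I_n.+1 -> T}) : {ffun 'I_n -> T} * T :=
  ([ffun j => w (lift ord_max j)], w ord_max).

Lemma wconsK : cancel wcons wuncons.
Proof.
move=> [t w]; rewrite /wuncons /wcons ffunE unlift_none; congr pair.
by apply/ffunP => j; rewrite !ffunE liftK.
Qed.

Lemma wrconsK : cancel wrcons wunrcons.
Proof.
move=> [w t]; rewrite /wunrcons /wrcons ffunE unlift_none; congr pair.
by apply/ffunP => j; rewrite !ffunE liftK.
Qed.

End words.

(** * Entropy of itineraries *)

Section dynamics.
Context (R : realType) (X : ptopologicalType) (phi : X -> X).
Hypothesis mphi : forall A : set (borel X), measurable A -> measurable (phi @^-1` A : set (borel X)).

Definition itin (T : finType) (g : X -> T) n x : {ffun 'I_n -> T} :=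
  [ffun i : 'I_n => g (iter i phi x)].

Lemma itinS (T : finType) (g : X -> T) n x : itin g n.+1 x = wcons (g x, itin g n (phi x)).
Proof.
apply/ffunP => i; rewrite !ffunE; case: unliftP => [j ->|->] //=.
by rewrite ffunE -iterSr.
Qed.

Lemma itinSr (T : finType) (g : X -> T) n x :
  itin g n.+1 x = wrcons (itin g n x, g (iter n phi x)).
Proof.
apply/ffunP => i; rewrite !ffunE; case: unliftP => [j ->|->] //=.
by rewrite ffunE /bump leqNgt ltn_ord.
Qed.

Lemma rv_phi (T : finType) (g : borel X -> T) : rv g -> rv (g \o phi : borel X -> T).
Proof. by move=> mg t; apply: (mphi (mg t)). Qed.

Lemma rv_iter (T : finType) (g : borel X -> T) n : rv g -> rv (g \o iter n phi : borel X -> T).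
Proof.
move=> mg; elim: n => [//|n IH].
rewrite (_ : _ \o _ = (g \o iter n phi) \o phi); first exact: rv_phi.
by apply/funext => x; rewrite /= -iterSr.
Qed.

Lemma rv_itin (T : finType) (g : borel X -> T) n : rv g -> rv (itin g n : borel X -> _).
Proof.
move=> mg; elim: n => [w|n IH].
  rewrite (_ : _ @^-1` _ = setT)//.
  by apply/seteqP; split => // x _; apply/ffunP => -[].
rewrite (_ : itin g n.+1 = wcons (n:=n) \o (fun x => (g x, (itin g n \o phi) x))).
  by apply: rv_comp; apply: rv_pair => //; exact: rv_phi.
by apply/funext => x; rewrite itinS.
Qed.

Arguments rv_itin {T g} n _.
Arguments rv_iter {T g} n _.

Variable mu : probability (borel X) R.
Hypothesis inv : phi_invariant phi mu.

Lemma pr_phi (T : finType) (g : borel X -> T) t : rv g -> pr mu (g \o phi) t = pr mu g t.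
Proof. by move=> mg; rewrite /pr /prob -(inv (mg t)). Qed.

Lemma ent_phi (T : finType) (g : borel X -> T) : rv g -> ent mu (g \o phi) = ent mu g.
Proof. by move=> mg; apply: eq_bigr => t _; rewrite pr_phi. Qed.

Section one_partition.
Context (T : finType) (g : borel X -> T).
Hypothesis mg : rv g.
Local Notation H n := (ent mu (itin g n)).

(** By invariance ([dentE]) this is the conditional entropy of the present symbol given the next [n]
    symbols. *)
Definition dent n := H n.+1 - H n.

Lemma ent_itin0 : H 0 = 0.
Proof.
apply: big1 => w _; rewrite (_ : pr _ _ _ = 1) ?ln1 ?oppr0 ?mulr0//.
rewrite /pr -[RHS](probT mu); congr prob.
by apply/seteqP; split => // x _; apply/ffunP => -[].
Qed.

Lemma ent_itin_cons n : ent mu (fun x => (g x, (itin g n \o phi) x)) = H n.+1.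
Proof.
rewrite -(ent_inj mu (rv_pair mg (rv_phi (rv_itin n mg))) (@wconsK T n)); congr ent.
by apply/funext => x; rewrite itinS.
Qed.

Lemma dentE n : dent n =
  ent mu (fun x => (g x, (itin g n \o phi) x)) - ent mu (itin g n \o phi).
Proof. by rewrite ent_itin_cons ent_phi//; exact: rv_itin. Qed.

Lemma dent_ge0 n : 0 <= dent n.
Proof.
rewrite subr_ge0 (_ : itin g n = (fst \o @wunrcons T n) \o itin g n.+1).
  by apply: ent_comp; exact: rv_itin.
by apply/funext => x; rewrite /comp itinSr wrconsK.
Qed.

(** Submodularity for the present symbol, the next [n] symbols and the symbol at time [n.+1]: more
    conditioning lowers the conditional entropy. *)
Lemma dent_dec n : dent n.+1 <= dent n.
Proof.
have mi := rv_itin n mg; have mip := rv_phi mi.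
have mc := rv_iter n.+1 mg.
have E2 : ent mu (fun x => ((itin g n \o phi) x, (g \o iter n.+1 phi) x)) = H n.+1.
  rewrite -(ent_phi (rv_itin n.+1 mg)).
  rewrite -(ent_inj mu (rv_pair mip mc) (@wrconsK T n)); congr ent.
  by apply/funext => x; rewrite /= itinSr -iterSr.
have mz := rv_pair mg (rv_pair mip mc).
pose f (u : T * ({ffun 'I_n -> T} * T)) := wcons (u.1, wrcons u.2).
pose f' (w : {ffun 'I_n.+2 -> T}) := ((wuncons w).1, wunrcons (wuncons w).2).
have fK : cancel f f' by move=> [t u]; rewrite /f' /f wconsK /= wrconsK.
have E1 : ent mu (fun x => (g x, ((itin g n \o phi) x, (g \o iter n.+1 phi) x))) = H n.+2.
  rewrite -(ent_inj mu mz fK); congr ent.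
  by apply/funext => x; rewrite /f /= itinS itinSr -iterSr.
have : H n.+2 + H n <= H n.+1 + H n.+1.
  rewrite -E1 -{1}(ent_phi mi) -{2}E2 -ent_itin_cons.
  exact: (ent_submodular mu mg mip mc).
by rewrite /dent; lra.
Qed.

Lemma dent_cvg : cvgn dent.
Proof.
apply: nonincreasing_is_cvgn; first by apply/nonincreasing_seqP; exact: dent_dec.
by exists 0 => _ [n _ <-]; exact: dent_ge0.
Qed.

Definition entr := limn dent.

Lemma entr_le n : entr <= dent n.
Proof.
apply: limr_le; first exact: dent_cvg.
exists n => // m /= nm; apply: (@nonincreasing_seqP _ _ dent).1 => //.
exact: dent_dec.
Qed.

Lemma dent_le_entr e : 0 < e -> exists n, dent n <= entr + e.
Proof.
move=> e0; have /cvgrPdist_le/(_ _ e0)[n _ nP] := dent_cvg.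
exists n; have := nP n (leqnn n); rewrite distrC => /(le_trans (ler_norm _)) /=.
by rewrite -/entr; lra.
Qed.

(** [H n.+1] is the telescoping sum of the increments, so this is their Cesaro mean. It identifies
    [entr] with the entropy of the theorem. *)
Lemma ent_mean_cvg : (fun n => H n.+1 / n.+1%:R) @ \oo --> entr.
Proof.
have := cesaro dent_cvg; rewrite /arithmetic_mean.
rewrite (_ : (fun n => _ * _) = fun n => H n.+1 / n.+1%:R)//.
apply/funext => n; rewrite mulrC; congr (_ / _).
by rewrite /series/= telescope_sumr// ent_itin0 subr0.
Qed.

End one_partition.

Lemma itin_comp (T S : finType) (g : X -> T) (f : T -> S) n :
  itin (f \o g) n = (fun w : {ffun 'I_n -> T} => [ffun i => f (w i)]) \o itin g n.
Proof. by apply/funext => x; apply/ffunP => i; rewrite !ffunE. Qed.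

Lemma entr_comp (T S : finType) (g : borel X -> T) (f : T -> S) : rv g ->
  entr (f \o g) <= entr g.
Proof.
move=> mg; have mf := rv_comp f mg.
apply: (ler_cvg_to (ent_mean_cvg mf) (ent_mean_cvg mg)); apply: nearW => n.
rewrite ler_wpM2r ?invr_ge0// itin_comp; apply: ent_comp; exact: rv_itin.
Qed.

Lemma entropy_partitionE k (p : borel X -> 'I_k) : rv p ->
  entropy_partition phi mu (fun i => p @^-1` [set i]) = entr p.
Proof.
move=> mp; apply: cvg_lim; first exact: Rhausdorff.
rewrite (_ : (fun n => _) = fun n => ent mu (itin p n.+1) / n.+1%:R); first exact: ent_mean_cvg.
apply/funext => n; congr (_ / _); apply: eq_bigr => w _; rewrite etaRE /pr /prob.
rewrite (_ : join_cell _ _ _ = itin p n.+1 @^-1` [set w])//.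
apply/seteqP; split => x /= => [H|<- i]; last by rewrite ffunE.
by apply/ffunP => i; rewrite ffunE; exact: H.
Qed.

Lemma KSentropy_ge (T : finType) (g : borel X -> T) : rv g -> ((entr g)%:E <= KSentropy phi mu)%E.
Proof.
move=> mg; have me : rv (enum_rank \o g) := rv_comp _ mg.
have h : entr g <= entr (enum_rank \o g).
  rewrite {1}(_ : g = enum_val \o (enum_rank \o g)); first exact: entr_comp.
  by apply/funext => x /=; rewrite enum_rankK.
apply: (@le_trans _ _ (entr (enum_rank \o g))%:E); first by rewrite lee_fin.
apply: ereal_sup_ubound; exists (existT (fun k => 'I_k -> set (borel X)) #|T| (fun i => (enum_rank \o g) @^-1` [set i])).
  split => /= [i|i j ij|x]; first exact: me.
    by apply/seteqP; split => x //= -[-> ij']; rewrite ij' eqxx in ij.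
  by exists (enum_rank (g x)).
by rewrite /= entropy_partitionE.
Qed.

Lemma KSentropy_le (K : R) :
  (forall (T : finType) (g : borel X -> T), rv g -> entr g <= K) ->
  (KSentropy phi mu <= K%:E)%E.
Proof.
move=> HK; apply: ge_ereal_sup => _ [[k P] /= [mP dP cP] <-].
have [p pP] := choice cP.
have PE i : P i = p @^-1` [set i].
  apply/seteqP; split => x /= => [Pi|<-]; last exact: pP.
  apply/eqP; apply/negPn/negP => /dP => E.
  by have : (P (p x) `&` P i) x by []; rewrite E.
have mp : rv (p : borel X -> 'I_k) by move=> i; rewrite -PE.
by rewrite (funext PE) entropy_partitionE// lee_fin; exact: HK.
Qed.

Lemma KSentropy_ge0 : (0 <= KSentropy phi mu)%E.
Proof.
have m1 : rv (fun _ : borel X => tt).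
  by move=> []; rewrite (_ : _ @^-1` _ = setT)//; apply/seteqP; split.
apply: le_trans (KSentropy_ge m1); rewrite lee_fin.
by apply: limr_ge; [exact: dent_cvg|apply: nearW => n; exact: dent_ge0].
Qed.

End dynamics.
Arguments rv_itin {X phi} mphi {T g} n _.

Section convexity.
Context (R : realType) (X : ptopologicalType) (phi : X -> X).
Hypothesis mphi : forall A : set (borel X), measurable A -> measurable (phi @^-1` A : set (borel X)).
Variables (mu mu1 mu2 : probability (borel X) R) (t : R).
Hypotheses (inv : phi_invariant phi mu) (inv1 : phi_invariant phi mu1)
  (inv2 : phi_invariant phi mu2).
Hypotheses (t0 : 0 < t) (t1 : t < 1).
Hypothesis mix : forall A : set (borel X), measurable A ->
  prob mu A = t * prob mu1 A + (1 - t) * prob mu2 A.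

(** The last term is the entropy of the coin that selects the component. It does not depend on [g],
    so it disappears after division by the length of the itinerary. *)
Lemma ent_mix (T : finType) (g : borel X -> T) : rv g ->
  ent mu g <= t * ent mu1 g + (1 - t) * ent mu2 g + (t * - ln t + (1 - t) * - ln (1 - t)).
Proof.
move=> mg; have s0 : 0 < 1 - t by rewrite subr_gt0.
have half (s a b : R) : 0 < s -> 0 <= a -> 0 <= b ->
    s * a * - ln (s * a + b) <= s * (a * - ln a) + a * (s * - ln s).
  move=> s_gt0; rewrite le_eqVlt => /predU1P[<-|a0] b0.
    by rewrite !(mulr0, mul0r) addr0.
  rewrite [leRHS](_ : _ = s * a * - ln (s * a)).
    have sa : 0 < s * a by rewrite mulr_gt0.
    rewrite ler_wpM2l ?(ltW sa)// lerN2 ler_ln ?posrE ?lerDl//.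
    by rewrite ltr_wpDr.
  by rewrite lnM ?posrE//; ring.
rewrite -[X in _ <= _ + X]mul1r.
rewrite (_ : 1 * _ = (\sum_i pr mu1 g i) * (t * - ln t) + (\sum_i pr mu2 g i) * ((1 - t) * - ln (1 - t))).
  rewrite /ent !mulr_sumr !mulr_suml -!big_split/=; apply: ler_sum => i _.
  rewrite {1 2}/pr mix// -/(pr _ _ _) -/(pr mu2 _ _) mulrDl.
  have h1 := half t (pr mu1 g i) ((1 - t) * pr mu2 g i) t0 (pr_ge0 _ _ _).
  have h2 := half (1 - t) (pr mu2 g i) (t * pr mu1 g i) s0 (pr_ge0 _ _ _).
  have {}h1 := h1 (mulr_ge0 (ltW s0) (pr_ge0 _ _ _)).
  have {}h2 := h2 (mulr_ge0 (ltW t0) (pr_ge0 _ _ _)).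
  rewrite [X in ln X]addrC in h2.
  by apply: le_trans (lerD h1 h2) _; rewrite addrACA.
by rewrite !pr_sum1// !mul1r.
Qed.

Lemma entr_mix (T : finType) (g : borel X -> T) : rv g ->
  entr phi mu g <= t * entr phi mu1 g + (1 - t) * entr phi mu2 g.
Proof.
move=> mg; set K := t * - ln t + (1 - t) * - ln (1 - t).
have cK : (fun n => K / n.+1%:R) @ \oo --> (0 : R).
  by rewrite -[X in _ --> X](mulr0 K); apply: cvgMl_tmp; exact: cvg_harmonic.
have c12 : (fun n => t * (ent mu1 (itin phi g n.+1) / n.+1%:R) +
    (1 - t) * (ent mu2 (itin phi g n.+1) / n.+1%:R) + K / n.+1%:R) @ \oo -->
    t * entr phi mu1 g + (1 - t) * entr phi mu2 g + 0.
  apply: cvgD => //; apply: cvgD; apply: cvgMl_tmp; exact: ent_mean_cvg.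
rewrite -[leRHS]addr0; apply: (ler_cvg_to (ent_mean_cvg mphi inv mg) c12).
apply: nearW => n; rewrite !mulrA -!mulrDl ler_wpM2r ?invr_ge0//.
exact: ent_mix (rv_itin mphi n.+1 mg).
Qed.

End convexity.

(** * Integration of bounded functions *)

(** * Borel measures and positive functionals *)

Section bounded_measurable.
Context (R : realType) (dO : measure_display) (O : measurableType dO).

Definition bmf (f : O -> R) := measurable_fun setT f /\ exists M : R, forall x, `|f x| <= M.

Lemma bmf_cst a : bmf (cst a).
Proof. by split; [exact: measurable_cst|exists `|a|]. Qed.

Lemma bmfD f g : bmf f -> bmf g -> bmf (fun x => f x + g x).
Proof.
move=> [mf [M fM]] [mg [K gK]]; split; first exact: measurable_funD.
by exists (M + K) => x; apply: le_trans (ler_normD _ _) _; rewrite lerD.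
Qed.

Lemma bmfZ a f : bmf f -> bmf (fun x => a * f x).
Proof.
move=> [mf [M fM]]; split; first by apply: measurable_funM => //; exact: measurable_cst.
by exists (`|a| * M) => x; rewrite normrM ler_wpM2l.
Qed.

Lemma bmfN f : bmf f -> bmf (fun x => - f x).
Proof. by move=> /(bmfZ (-1)); under eq_fun do rewrite mulN1r. Qed.

Lemma bmf_indic A : measurable A -> bmf (\1_A).
Proof.
by move=> mA; split; [exact: measurable_indic|exists 1 => x; rewrite indicE; case: (x \in A); rewrite ?normr1 ?normr0].
Qed.

Variable mu : probability O R.

Lemma bmf_integrable f : bmf f -> mu.-integrable setT (EFin \o f).
Proof.
move=> [mf [M fM]]; apply: measurable_bounded_integrable => //.
  by apply: (le_lt_trans (probability_le1 mu measurableT)); rewrite ltry.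
exists M; split; first exact: num_real.
by move=> K MK x _; apply: le_trans (fM x) (ltW MK).
Qed.

Definition Ex (f : O -> R) : R := Rintegral mu setT f.

Lemma ExE f : bmf f -> (\int[mu]_x (f x)%:E)%E = (Ex f)%:E.
Proof. by move=> bf; rewrite /Ex /Rintegral fineK// integrable_fin_num//; exact: bmf_integrable. Qed.

Lemma ExD f g : bmf f -> bmf g -> Ex (fun x => f x + g x) = Ex f + Ex g.
Proof. by move=> bf bg; rewrite /Ex RintegralD//; exact: bmf_integrable. Qed.

Lemma ExZ a f : bmf f -> Ex (fun x => a * f x) = a * Ex f.
Proof. by move=> bf; rewrite /Ex RintegralZl//; exact: bmf_integrable. Qed.

Lemma ExN f : bmf f -> Ex (fun x => - f x) = - Ex f.
Proof. by move=> bf; rewrite -mulN1r -ExZ//; under eq_fun do rewrite -mulN1r. Qed.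

Lemma Ex_le f g : bmf f -> bmf g -> (forall x, f x <= g x) -> Ex f <= Ex g.
Proof. by move=> bf bg fg; apply: le_Rintegral => //; exact: bmf_integrable. Qed.

Lemma Ex_cst a : Ex (cst a) = a.
Proof. by rewrite /Ex Rintegral_cst// -[RHS]mulr1 -[in RHS](probT mu). Qed.

Lemma Ex_indic A : measurable A -> Ex (\1_A) = prob mu A.
Proof. by move=> mA; rewrite /Ex /Rintegral integral_indic// setIT. Qed.

Lemma bmf_rv (T : finType) (xi : O -> T) (F : T -> R) : rv xi -> bmf (fun x => F (xi x)).
Proof.
move=> mxi; rewrite (_ : (fun x => _) = fun x => \sum_t F t * \1_(xi @^-1` [set t]) x).
  elim: (index_enum T) => [|t r IH].
    by under eq_fun do rewrite big_nil; exact: bmf_cst.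
  by under eq_fun do rewrite big_cons; apply: bmfD => //; apply: bmfZ; exact: bmf_indic.
apply/funext => x; rewrite (bigD1 (xi x))//= indicE mem_set// mulr1 big1 ?addr0// => t tx.
by rewrite indicE memNset ?mulr0// => /= xt; rewrite xt eqxx in tx.
Qed.

Lemma Ex_rv (T : finType) (xi : O -> T) (F : T -> R) : rv xi ->
  Ex (fun x => F (xi x)) = \sum_t pr mu xi t * F t.
Proof.
move=> mxi; rewrite (_ : (fun x => _) = fun x => \sum_t F t * \1_(xi @^-1` [set t]) x); last first.
  apply/funext => x; rewrite (bigD1 (xi x))//= indicE mem_set// mulr1 big1 ?addr0// => t tx.
  by rewrite indicE memNset ?mulr0// => /= xt; rewrite xt eqxx in tx.
suff [] : bmf (fun x => \sum_t F t * \1_(xi @^-1` [set t]) x) /\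
    Ex (fun x => \sum_t F t * \1_(xi @^-1` [set t]) x) = \sum_t pr mu xi t * F t by [].
elim: (index_enum T) => [|t r [IH1 IH2]].
  under eq_fun do rewrite big_nil; rewrite big_nil; split; first exact: bmf_cst.
  exact: Ex_cst.
under eq_fun do rewrite big_cons; rewrite big_cons.
have b1 := bmf_indic (mxi t).
by split; [exact: bmfD (bmfZ _ b1) IH1|rewrite ExD ?ExZ ?IH2 ?Ex_indic// 1?mulrC//; exact: bmfZ].
Qed.

End bounded_measurable.

Section borel_measures.
Context (R : realType) (X : ptopologicalType) (d : X -> X -> R).
Hypothesis dm : compatible_metric d.

Lemma open_borel (A : set X) : open A -> measurable (A : set (borel X)).
Proof. by move=> oA; apply: sub_sigma_algebra. Qed.

Lemma closed_borel (A : set X) : closed A -> measurable (A : set (borel X)).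
Proof. by move=> /closed_openC /open_borel /measurableC; rewrite setCK. Qed.

Lemma continuous_borel_fun (f : X -> R) : continuous f -> measurable_fun setT (f : borel X -> R).
Proof.
move=> /continuousP cf; apply: (measurability _ (RGenOpens.measurableE R)).
move=> _ [_ [a [b ->] <-]]; rewrite setTI; apply: open_borel.
exact/cf/interval_open.
Qed.

Lemma continuous_borel_map (phi : X -> X) : continuous phi ->
  forall A : set (borel X), measurable A -> measurable (phi @^-1` A : set (borel X)).
Proof.
move=> /continuousP cp.
have : <<s @open X >> `<=` [set A | measurable (phi @^-1` A : set (borel X))].
  apply: smallest_sub => [|A oA]; last by apply: open_borel; exact: cp.
  split => /= [|A mA|F mF].
  - by rewrite preimage_set0.
  - by rewrite setTD preimage_setC; exact: measurableC.
  - by rewrite preimage_bigcup; exact: bigcupT_measurable.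
by move=> H A mA; exact: H.
Qed.

Section determination.
Variable mu : probability (borel X) R.

Lemma Ex_tent_cvg (K : set X) : closed K ->
  (fun n => Ex mu (tent d K n.+1%:R^-1)) @ \oo --> prob mu K.
Proof.
move=> cK; have mK := closed_borel cK.
have cb n : measurable_fun setT (tent d K n.+1%:R^-1 : borel X -> R).
  by apply: continuous_borel_fun; exact: tent_continuous.
have n0 n : 0 < (n.+1%:R^-1 : R) by rewrite invr_gt0.
have b1 n x : `|tent d K n.+1%:R^-1 x| <= 1.
  by rewrite ger0_norm ?tent_ge0// (tent_le1 dm).
have bt n : bmf (tent d K n.+1%:R^-1 : borel X -> R) by split; [exact: cb|exists 1].
have [|||||_ _] := @dominated_convergence _ (borel X) R mu setT measurableT
  (fun n x => (tent d K n.+1%:R^-1 x)%:E) (fun x => (\1_K x)%:E) (cst 1%E).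
- by move=> n; apply/measurable_EFinP.
- by apply/measurable_EFinP; exact: measurable_indic.
- apply: aeW => x _; apply/cvg_EFin; [exact: nearW|]; rewrite (_ : _ \o _ = fun n => tent d K n.+1%:R^-1 x)//; exact: tent_lim.
- exact: finite_measure_integrable_cst.
- by apply: aeW => x n _; rewrite lee_fin.
rewrite (ExE mu (bmf_indic _ mK)) Ex_indic// => H.
exact: (fine_cvg H).
Qed.

End determination.

(** Tent functions recover the mass of closed sets, hence of open sets, which form a generating
    family stable under intersection. *)
Lemma prob_eq (mu nu : probability (borel X) R) :
  (forall f : X -> R, continuous f -> Ex mu f = Ex nu f) ->
  forall A : set (borel X), measurable A -> mu A = nu A.
Proof.
move=> H.
have Hc (K : set X) : closed K -> prob mu K = prob nu K.
  move=> cK; have h1 := Ex_tent_cvg (mu:=mu) cK; have h2 := Ex_tent_cvg (mu:=nu) cK.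
  rewrite -(cvg_lim (@Rhausdorff R) h1) -(cvg_lim (@Rhausdorff R) h2).
  rewrite (_ : (fun n => Ex mu _) = fun n => Ex nu (tent d K n.+1%:R^-1))//.
  by apply/funext => n; apply: H; exact: tent_continuous.
apply: (@measure_unique _ R (borel X) (@open X) (fun=> setT)) => //.
- by move=> A B; exact: openI.
- by move=> _; exact: openT.
- by rewrite bigcup_const.
- move=> A oA; have mA := open_borel oA.
  transitivity (prob mu A)%:E; first exact: probE.
  transitivity (prob nu A)%:E; last by apply/esym/probE.
  have cA : closed (~` A) by exact: open_closedC.
  have := Hc _ cA; have := probT mu; have := probT nu.
  rewrite -(setvU A) !probU ?setICl//; try exact: measurableC.
  by move=> h1 h2 h3; congr (_%:E); lra.
- by move=> k; apply: (le_lt_trans (probability_le1 mu measurableT)); rewrite ltry.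
Qed.

End borel_measures.

Lemma probability_exists (R : realType) (dO : measure_display) (O : measurableType dO)
    (m : set O -> \bar R) : m set0 = 0%E -> (forall A, (0 <= m A)%E) ->
  semi_sigma_additive m -> m setT = 1%E ->
  exists P : probability O R, forall A, P A = m A.
Proof.
move=> m0 mge ms mT.
pose M : {measure set O -> \bar R} := HB.pack m (isMeasure.Build _ _ _ m m0 mge ms).
pose P : probability O R := HB.pack m (isMeasure.Build _ _ _ m m0 mge ms) (Measure_isProbability.Build _ _ _ M mT).
by exists P.
Qed.

Section pushforward.
Context (R : realType) (X : ptopologicalType) (d : X -> X -> R).
Hypothesis dm : compatible_metric d.
Variable phi : X -> X.
Hypothesis mphi : forall A : set (borel X), measurable A -> measurable (phi @^-1` A : set (borel X)).
Variable mu : probability (borel X) R.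

Let mf : measurable_fun [set: borel X] (phi : borel X -> borel X).
Proof. by move=> _ A mA; rewrite setTI; exact: mphi. Qed.

Lemma pushforward_exists : exists nu : probability (borel X) R,
  (forall A, nu A = mu (phi @^-1` A)) /\
  forall f : borel X -> R, bmf f -> Ex nu f = Ex mu (f \o phi).
Proof.
have [nu nuE] : exists nu : probability (borel X) R,
    forall A, nu A = pushforward mu (phi : borel X -> borel X) A.
  apply: probability_exists.
  - by rewrite /pushforward preimage_set0 measure0.
  - by move=> A; rewrite /pushforward measure_ge0.
  - move=> F mF tF mUF; rewrite /pushforward preimage_bigcup.
    apply: measure_semi_sigma_additive.
    + by move=> n; exact: mphi.
    + apply/trivIsetP => /= i j _ _ ij; rewrite -preimage_setI.
      by move/trivIsetP : tF => /(_ _ _ _ _ ij) ->//; rewrite preimage_set0.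
    + by rewrite -preimage_bigcup; exact: mphi.
  - by rewrite /pushforward preimage_setT probability_setT.
exists nu; split=> // f bf.
have mf' : measurable_fun [set: borel X] (EFin \o f) by apply/measurable_EFinP; case: bf.
have bfp : bmf (f \o phi : borel X -> R).
  case: bf => mf0 [M fM]; split; last by exists M => x; exact: fM.
  exact: measurableT_comp.
rewrite /Ex /Rintegral; congr fine.
have := integral_pushforward mf (mu := mu) (D := setT) mf' _ measurableT.
rewrite preimage_setT => <-; last exact: bmf_integrable.
by apply: eq_measure_integral => A mA _; exact: nuE.
Qed.

Lemma Ex_invariant (f : X -> R) : phi_invariant phi mu -> bmf (f : borel X -> R) ->
  Ex mu (f \o phi) = Ex mu f.
Proof.
move=> inv bf; have [nu [nuE <-//]] := pushforward_exists.
rewrite /Ex /Rintegral; congr fine; apply: eq_measure_integral => A mA _.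
by transitivity (mu (phi @^-1` A)); [exact: nuE|exact: inv].
Qed.

Lemma invariant_of_Ex : (forall f : X -> R, continuous f -> bmf (f : borel X -> R)) ->
  (forall f : X -> R, continuous f -> Ex mu (f \o phi) = Ex mu f) ->
  phi_invariant phi mu.
Proof.
move=> cb H A mA; have [nu [nuE nuf]] := pushforward_exists.
rewrite -nuE; apply: (prob_eq dm) => // f cf.
by rewrite nuf ?H//; exact: cb.
Qed.

End pushforward.

(** * Regularity of Borel probabilities *)

Section regularity.
Context (R : realType) (X : ptopologicalType) (d : X -> X -> R).
Hypothesis dm : compatible_metric d.
Variable mu : probability (borel X) R.

(** Approximation from both sides at once, because this form is stable under complements. *)
Definition regular_set (A : set X) := forall e : R, 0 < e -> exists K U : set X,
  [/\ closed K, open U, K `<=` A, A `<=` U & prob mu (U `\` K) <= e].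

Lemma closed_ge_continuous (f : X -> R) r : continuous f -> closed [set x | r <= f x].
Proof.
move=> /continuousP cf; rewrite (_ : [set x | _] = ~` (f @^-1` [set s | s < r])).
  by apply: open_closedC; apply: cf; exact: open_lt.
by apply/seteqP; split => x /=; rewrite leNgt => /negP.
Qed.

Lemma regular_open (A : set X) : open A -> regular_set A.
Proof.
move=> oA e e0; have cA : closed (~` A) by exact: open_closedC.
pose F n := [set x | A x /\ dset d (~` A) x < n.+1%:R^-1].
pose K n := [set x | n.+1%:R^-1 <= dset d (~` A) x].
have cK n : closed (K n).
  by apply: closed_ge_continuous; exact: (dset_continuous dm).
have FE n : F n = A `\` K n.
  apply/seteqP; split => x [Ax]; first by move=> h; split=> //= h'; move: (lt_le_trans h h'); rewrite ltxx.
  by move=> /negP; rewrite -ltNge.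
have mF n : measurable (F n : set (borel X)).
  by rewrite FE; apply: measurableD; [exact: open_borel|exact: closed_borel].
have : (mu \o F) n @[n --> \oo] --> mu (\bigcap_n F n).
  apply: nonincreasing_cvg_mu => //.
  - by apply: (le_lt_trans (probability_le1 mu (mF _))); rewrite ltry.
  - by apply: bigcapT_measurable.
  - move=> m n mn; apply/subsetPset => x [Ax h]; split=> //; apply: lt_le_trans h _.
    by rewrite lef_pV2 ?posrE// ler_nat.
have -> : \bigcap_n F n = set0.
  apply/seteqP; split => // x H; have [Ax _] := H 0%N I.
  have h := dset_closed dm cA (fun nA => nA Ax).
  have [N _ /(_ _ (leqnn N)) NP] := near_infty_natSinv_lt (PosNum h).
  by have [_ h2] := H N I; have := lt_trans NP h2; rewrite ltxx.
rewrite measure0 => /fine_cvg /= /cvgrPdist_le /(_ e e0) [N _ /(_ _ (leqnn N))].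
rewrite sub0r normrN => NP; exists (K N), A; split=> //.
  move=> x /= h; apply: contrapT => nA; move: h.
  by rewrite /K /= (dset_in dm (nA : (~` A) x)) leNgt invr_gt0 ltr0Sn.
by rewrite -FE; apply: le_trans (ler_norm _) NP.
Qed.

Lemma regular_setC (A : set X) : regular_set A -> regular_set (~` A).
Proof.
move=> rA e /rA[K [U [cK oU KA AU KU]]]; exists (~` U), (~` K); split.
- exact: open_closedC.
- exact: closed_openC.
- exact: subsetC.
- exact: subsetC.
- by rewrite setDE setCK setIC -setDE.
Qed.

Lemma regular_bigcup (A : nat -> set X) : (forall n, regular_set (A n)) ->
  regular_set (\bigcup_n A n).
Proof.
move=> rA e e0.
(* Half of [e] is spread over the differences of [U n] and [K n]; the other half pays for cutting
   the union of the [K n], which need not be closed, down to a finite one. *)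
have e20 n : 0 < e / 2 / (2 ^ n.+1)%:R by rewrite !divr_gt0// ltr0n expn_gt0.
have /choice[K /choice[U H]] n := rA n _ (e20 n).
have cK n : closed (K n) by case: (H n).
have oU n : open (U n) by case: (H n).
have mK n : measurable (K n : set (borel X)) by exact: closed_borel.
have mU n : measurable (U n : set (borel X)) by exact: open_borel.
pose L n := \big[setU/set0]_(i < n) K i.
have mL n : measurable (L n : set (borel X)) by exact: bigsetU_measurable.
have cL n : closed (L n) by rewrite /L; elim: n => [|n IH]; rewrite ?big_ord0 ?big_ord_recr/=; [exact: closed0|exact: closedU].
have mbK : measurable (\bigcup_n K n : set (borel X)) by exact: bigcupT_measurable.
pose F n : set (borel X) := \bigcup_n K n `\` L n.
have mF n : measurable (F n) by exact: measurableD.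
have [N NP] : exists N, prob mu (F N) <= e / 2.
  have : (mu \o F) n @[n --> \oo] --> mu (\bigcap_n F n).
    apply: nonincreasing_cvg_mu => //.
    - by apply: (le_lt_trans (probability_le1 mu (mF _))); rewrite ltry.
    - by apply: bigcapT_measurable.
    - move=> m n mn; apply/subsetPset => x [h1 h2]; split=> // h3; apply: h2.
      by apply: subset_bigsetU h3.
  have -> : \bigcap_n F n = set0.
    apply/seteqP; split => // x Hx; have [[i _ Ki] _] := Hx 0%N I.
    have [_] := Hx i.+1 I; apply.
    by rewrite /L -bigcup_mkord; exists i => /=.
  rewrite measure0 => /fine_cvg /= /cvgrPdist_le /(_ (e/2)) [|N _ /(_ _ (leqnn N))].
    by rewrite divr_gt0.
  by rewrite sub0r normrN => NP; exists N; apply: le_trans (ler_norm _) NP.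
exists (L N), (\bigcup_n U n); split=> //.
- exact: bigcup_open.
- by rewrite /L -bigcup_mkord; apply: bigcup_sub => i _ x Kx; exists i => //; case: (H i) => _ _ KA _ _; exact: KA.
- by apply: subset_bigcup => i _; case: (H i).
pose G n : set (borel X) := U n `\` K n.
have mG n : measurable (G n) by exact: measurableD.
have mbG : measurable (\bigcup_n G n) by exact: bigcupT_measurable.
have mbU : measurable (\bigcup_n U n : set (borel X)) by exact: bigcupT_measurable.
have hG : (mu (\bigcup_n G n) <= (e / 2)%:E)%E.
  apply: (@le_trans _ _ (\sum_(n <oo) mu (G n))%E).
    exact: measure_sigma_subadditive.
  apply: le_trans (epsilon_trick0 xpredT (ltW (divr_gt0 e0 (ltr0Sn R 1)))).
  apply: lee_nneseries => [n _ _|n _]; first exact: measure_ge0.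
  by rewrite probE// lee_fin; case: (H n).
rewrite probE// lee_fin in hG.
rewrite (splitr e); apply: le_trans (lerD hG NP).
rewrite -lee_fin EFinD -!probE//; last by apply: measurableD.
apply: (@le_trans _ _ (mu (\bigcup_n G n `|` F N))); last exact: measureU2.
apply: le_measure; rewrite ?inE; [exact: measurableD|exact: measurableU|].
move=> x [[i _ Ui] nL]; have [Ki|nK] := pselect (K i x).
  by right; split=> //; exists i.
by left; exists i.
Qed.

Lemma borel_regular (A : set (borel X)) : measurable A -> regular_set A.
Proof.
have : <<s @open X >> `<=` regular_set.
  apply: smallest_sub => [|B oB]; last exact: regular_open.
  split.
  - by apply: regular_open; exact: open0.
  - by move=> B rB; rewrite setTD; exact: regular_setC.
  - by move=> F; exact: regular_bigcup.
exact.
Qed.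

Lemma inner_regular (A : set (borel X)) e : measurable A -> 0 < e ->
  exists K : set X, [/\ closed K, K `<=` A & prob mu (A `\` K) <= e].
Proof.
move=> mA /(borel_regular mA)[K [U [cK oU KA AU h]]]; exists K; split=> //.
apply: le_trans h; apply: prob_le => [||x [Ax nK]]; last by split=> //; exact: AU.
  by apply: measurableD => //; exact: closed_borel.
by apply: measurableD; [exact: open_borel|exact: closed_borel].
Qed.

End regularity.

(** A positive normalised functional on [C(X)], stored as a function on all maps [X -> R]; its
    values at discontinuous maps are unconstrained. *)
Record state (R : realType) (X : ptopologicalType) (l : (X -> R) -> R) : Prop := State {
  stateD : forall f g : X -> R, continuous f -> continuous g ->
    l (fun x => f x + g x) = l f + l g;
  stateZ : forall a (f : X -> R), continuous f -> l (fun x => a * f x) = a * l f;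
  state_ge0 : forall f : X -> R, continuous f -> (forall x, 0 <= f x) -> 0 <= l f;
  state1 : l (cst 1) = 1 }.

Section state_theory.
Context (R : realType) (X : ptopologicalType) (l : (X -> R) -> R).
Hypothesis sl : state l.

Lemma contD (f g : X -> R) : continuous f -> continuous g -> continuous (fun x => f x + g x).
Proof. by move=> cf cg x; apply: cvgD; [exact: cf|exact: cg]. Qed.

Lemma contZ a (f : X -> R) : continuous f -> continuous (fun x => a * f x).
Proof. by move=> cf x; apply: cvgMl_tmp; exact: cf. Qed.

Lemma contM (f g : X -> R) : continuous f -> continuous g -> continuous (fun x => f x * g x).
Proof. by move=> cf cg x; apply: cvgM; [exact: cf|exact: cg]. Qed.

Lemma stateB (f g : X -> R) : continuous f -> continuous g ->
  l (fun x => f x - g x) = l f - l g.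
Proof.
move=> cf cg; under eq_fun do rewrite -mulN1r.
by rewrite (stateD sl)// ?(stateZ sl)// ?mulN1r//; exact: contZ.
Qed.

Lemma state_le (f g : X -> R) : continuous f -> continuous g ->
  (forall x, f x <= g x) -> l f <= l g.
Proof.
move=> cf cg fg; rewrite -subr_ge0 -stateB//; apply: (state_ge0 sl).
  by move=> x; apply: cvgB; [exact: cg|exact: cf].
by move=> x; rewrite subr_ge0.
Qed.

Lemma state_cst a : l (cst a) = a.
Proof.
rewrite (_ : cst a = fun x => a * cst 1 x); last by apply/funext => x; rewrite /= mulr1.
by rewrite (stateZ sl) ?(state1 sl) ?mulr1//; exact: cst_continuous.
Qed.

End state_theory.

(** * Riesz representation *)

Section riesz.
Context (R : realType) (X : ptopologicalType) (d : X -> X -> R).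
Hypothesis dm : compatible_metric d.
Hypothesis cX : compact [set: X].
Variable l : (X -> R) -> R.
Hypothesis sl : state l.

(** Its infimum is the classical Riesz content of [K]. The content passes to open sets from inside,
    then to all sets from outside, and Caratheodory's theorem yields the measure. *)
Definition content_dom (K : set X) := [set r : R | exists f : X -> R,
  [/\ continuous f, forall x, 0 <= f x, forall x, K x -> 1 <= f x & r = l f]].
Definition closed_content (K : set X) : R := inf (content_dom K).
Local Notation m := closed_content.

Lemma content_dom1 K : content_dom K 1.
Proof. by exists (cst 1); split; rewrite ?(state1 sl)//; exact: cst_continuous. Qed.

Lemma content_dom_lb K : lbound (content_dom K) 0.
Proof. by move=> _ [f [cf f0 _ ->]]; exact: (state_ge0 sl). Qed.

Lemma content_ge0 K : 0 <= m K.
Proof. by apply: lb_le_inf; [exists 1; exact: content_dom1|exact: content_dom_lb]. Qed.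

Lemma content_le K (f : X -> R) : continuous f -> (forall x, 0 <= f x) -> (forall x, K x -> 1 <= f x) ->
  m K <= l f.
Proof. by move=> cf f0 f1; apply: ge_inf; [exists 0; exact: content_dom_lb|exists f]. Qed.

Lemma content_le1 K : m K <= 1.
Proof. by apply: ge_inf; [exists 0; exact: content_dom_lb|exact: content_dom1]. Qed.

Lemma content_ge K r : (forall f : X -> R, continuous f -> (forall x, 0 <= f x) ->
  (forall x, K x -> 1 <= f x) -> r <= l f) -> r <= m K.
Proof.
by move=> H; apply: lb_le_inf; [exists 1; exact: content_dom1|move=> _ [f [cf f0 f1 ->]]; exact: H].
Qed.

Lemma content0 : m set0 = 0.
Proof.
apply/le_anti; rewrite content_ge0 andbT.
have := @content_le set0 (cst 0); rewrite (state_cst sl); apply => //.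
exact: cst_continuous.
Qed.

Lemma contentT : m setT = 1.
Proof.
apply/le_anti; rewrite content_le1/=; apply: content_ge => f cf _ f1.
rewrite -(state_cst sl 1); apply: state_le => //; first exact: cst_continuous.
by move=> x; exact: f1.
Qed.

Lemma content_mono K K' : K `<=` K' -> m K <= m K'.
Proof. by move=> KK; apply: content_ge => f cf f0 f1; apply: content_le => // x /KK /f1. Qed.

Lemma contentU K K' : m (K `|` K') <= m K + m K'.
Proof.
rewrite -lerBlDr; apply: content_ge => f cf f0 f1; rewrite lerBlDr -lerBlDl.
apply: content_ge => g cg g0 g1; rewrite lerBlDl -(stateD sl)//.
apply: content_le => [|x|x []]; first exact: contD.
- by rewrite addr_ge0.
- by move=> /f1 h; rewrite ler_wpDr.
- by move=> /g1 h; rewrite ler_wpDl.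
Qed.

(** A Urysohn function [h], equal to 1 on [K] and 0 on [K'], splits a competitor [f] for the union
    into competitors [f h] and [f (1 - h)]. *)
Lemma contentU_disjoint K K' : closed K -> closed K' -> K `&` K' = set0 ->
  m K + m K' <= m (K `|` K').
Proof.
move=> cK cK' KK'; apply: content_ge => f cf f0 f1.
have den x : 0 < dset d K x + dset d K' x.
  have [Kx|nKx] := pselect (K x).
    have nK'x : ~ K' x by move=> K'x; have : (K `&` K') x by []; rewrite KK'.
    by rewrite ltr_wpDl ?dset_ge0 ?(dset_closed dm).
  by rewrite ltr_wpDr ?dset_ge0 ?(dset_closed dm).
pose h x := dset d K' x / (dset d K x + dset d K' x).
have ch : continuous h.
  move=> x; apply: cvgM; first exact: dset_continuous.
  by apply: cvgV; [rewrite gt_eqF|apply: cvgD; exact: dset_continuous].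
have h0 x : 0 <= h x by rewrite divr_ge0 ?(dset_ge0 dm)// ltW.
have h1 x : h x <= 1 by rewrite ler_pdivrMr// mul1r lerDr dset_ge0.
have -> : l f = l (fun x => f x * h x) + l (fun x => f x * (1 - h x)).
  rewrite -(stateD sl); [congr l; apply/funext => x; ring|exact: contM|].
  by apply: contM => // x; apply: cvgB; [exact: cvg_cst|exact: ch].
apply: lerD; apply: content_le.
- exact: contM.
- by move=> x; rewrite mulr_ge0.
- move=> x Kx; rewrite /h (dset_in dm Kx) add0r divff ?mulr1; first by apply: f1; left.
  by have := den x; rewrite (dset_in dm Kx) add0r => /lt0r_neq0.
- by apply: contM => // x; apply: cvgB; [exact: cvg_cst|exact: ch].
- by move=> x; rewrite mulr_ge0// subr_ge0.
- by move=> x Kx; rewrite /h (dset_in dm Kx) mul0r subr0 mulr1; apply: f1; right.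
Qed.

Definition inner_set (U : set X) := [set r : R | exists K, [/\ closed K, K `<=` U & r = m K]].
Definition open_content (U : set X) : R := sup (inner_set U).
Local Notation lam := open_content.

Lemma inner_set_ub U : has_ubound (inner_set U).
Proof. by exists 1 => _ [K [_ _ ->]]; exact: content_le1. Qed.

Lemma inner_set_nonempty U : inner_set U !=set0.
Proof. by exists (m set0), set0; split=> //; exact: closed0. Qed.

Lemma open_content_ge U K : closed K -> K `<=` U -> m K <= lam U.
Proof. by move=> cK KU; apply: ub_le_sup; [exact: inner_set_ub|exists K]. Qed.

Lemma open_content_le U r : (forall K, closed K -> K `<=` U -> m K <= r) -> lam U <= r.
Proof.
move=> H; apply: ge_sup; first exact: inner_set_nonempty.
by move=> _ [K [cK KU ->]]; exact: H.
Qed.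

Lemma open_content_ge0 U : 0 <= lam U.
Proof. by rewrite -content0; apply: open_content_ge => //; exact: closed0. Qed.

Definition outer_dom (A : set X) := [set r : R | exists U, [/\ open U, A `<=` U & r = lam U]].
Definition outer_content (A : set X) : R := inf (outer_dom A).
Local Notation out := outer_content.

Lemma outer_dom_nonempty A : outer_dom A !=set0.
Proof. by exists (lam setT), setT; split=> //; exact: openT. Qed.

Lemma outer_dom_lb A : lbound (outer_dom A) 0.
Proof. by move=> _ [U [_ _ ->]]; exact: open_content_ge0. Qed.

Lemma outer_le A U : open U -> A `<=` U -> out A <= lam U.
Proof. by move=> oU AU; apply: ge_inf; [exists 0; exact: outer_dom_lb|exists U]. Qed.

Lemma outer_ge A r : (forall U, open U -> A `<=` U -> r <= lam U) -> r <= out A.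
Proof.
move=> H; apply: lb_le_inf; first exact: outer_dom_nonempty.
by move=> _ [U [oU AU ->]]; exact: H.
Qed.

Lemma outer_ge0 A : 0 <= out A.
Proof. by apply: outer_ge => U _ _; exact: open_content_ge0. Qed.

Lemma outer0 : out set0 = 0.
Proof.
apply/le_anti; rewrite outer_ge0 andbT.
apply: le_trans (outer_le open0 (@subset_refl _ _)) _.
by apply: open_content_le => K _; rewrite subset0 => ->; rewrite content0.
Qed.

Lemma outer_mono A B : A `<=` B -> out A <= out B.
Proof.
by move=> AB; apply: outer_ge => U oU BU; apply: outer_le => //; exact: subset_trans BU.
Qed.

Lemma outer_near A e : 0 < e -> exists U, [/\ open U, A `<=` U & lam U <= out A + e].
Proof.
move=> e0; have [|_ [U [oU AU ->]] h] := @inf_adherent _ (outer_dom A) e e0.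
  by split; [exact: outer_dom_nonempty|exists 0; exact: outer_dom_lb].
by exists U; split=> //; exact: ltW.
Qed.

Lemma outerT : out setT = 1.
Proof.
apply/le_anti/andP; split.
  apply: le_trans (outer_le openT (@subset_refl _ _)) _.
  by apply: open_content_le => K _ _; exact: content_le1.
apply: outer_ge => U _; rewrite subTset => ->; rewrite -contentT.
by apply: open_content_ge => //; exact: closedT.
Qed.

Lemma content_outer K : closed K -> m K <= out K.
Proof. by move=> cK; apply: outer_ge => U oU KU; exact: open_content_ge. Qed.

Lemma closed_decomposition K (U : nat -> set X) : closed K -> (forall n, open (U n)) ->
  K `<=` \bigcup_n U n -> exists (N : nat) (F : nat -> set X),
    [/\ forall n, closed (F n), forall n, F n `<=` U n & K `<=` \big[setU/set0]_(n < N) F n].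
Proof.
move=> cK oU KU.
(* The condition [n%:R * e <= 1] makes the scale bound the index as well, so one use of compactness
   gives both a Lebesgue number and a finite subfamily. *)
have [e e0 eP] : exists2 e : R, 0 < e & forall x, K x -> exists n : nat,
    n%:R * e <= 1 /\ forall y, d x y < e -> U n y.
  apply: (compact_unif dm cX) => [x r s sr H /H[n [n1 nU]]|x0].
    exists n; split; first by apply: le_trans n1; rewrite ler_wpM2l.
    by move=> y /lt_le_trans /(_ sr) /nU.
  have [Kx0|nKx0] := pselect (K x0).
    have [n _ Un] := KU _ Kx0; have [r r0 rP] := open_dballP dm (oU n) Un.
    have r20 : 0 < r / 2 by rewrite divr_gt0.
    exists (r / 2), (Num.min (r / 2) n.+1%:R^-1); split => //.
      by rewrite lt_min r20 invr_gt0 ltr0Sn.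
    move=> x xr _; exists n; split.
      apply: (@le_trans _ _ (n%:R * n.+1%:R^-1)); first by rewrite ler_wpM2l// ge_min lexx orbT.
      by rewrite ler_pdivrMr// mul1r ler_nat.
    move=> y; rewrite lt_min => /andP[xy _]; apply: rP.
    by have := d_tri dm x x0 y; lra.
  have oC : open (~` K) by exact: closed_openC.
  have [r r0 rP] := open_dballP dm oC nKx0.
  by exists r, 1; split=> // x /rP.
pose e' := Num.min e 1.
pose F n := [set x | e' <= dset d (~` U n) x].
have e'0 : 0 < e' by rewrite lt_min e0 ltr01.
exists (Num.truncn e^-1).+1, F; split => [n|n|x].
- by apply: closed_ge_continuous; exact: dset_continuous.
- move=> x h; apply: contrapT => nU.
  by move: h; rewrite /F /= (dset_in dm (nU : (~` U n) x)) leNgt e'0.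
- move=> Kx; have [k [ke kU]] := eP _ Kx.
  rewrite -bigcup_mkord; exists k => /=.
    by rewrite ltnS truncn_ge_nat ?invr_ge0 ?(ltW e0)// -[leRHS]mul1r ler_pdivlMr.
  rewrite /F /= leNgt; apply/negP => /(dset_lt _)[|y nUy].
  + by rewrite ge_min lexx orbT.
  by rewrite lt_min => /andP[/kU].
Qed.

Lemma content_bigU (F : nat -> set X) N :
  m (\big[setU/set0]_(n < N) F n) <= \sum_(n < N) m (F n).
Proof.
elim: N => [|N IH]; first by rewrite !big_ord0 content0.
by rewrite !big_ord_recr/=; apply: le_trans (contentU _ _) _; rewrite lerD2r.
Qed.

Definition riesz_outer (A : set X) : \bar R := (out A)%:E.

Lemma riesz_outer0 : riesz_outer set0 = 0%E. Proof. by rewrite /riesz_outer outer0. Qed.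
Lemma riesz_outer_ge0 A : (0 <= riesz_outer A)%E. Proof. by rewrite lee_fin outer_ge0. Qed.
Lemma riesz_outer_mono : {homo riesz_outer : A B / A `<=` B >-> (A <= B)%E}.
Proof. by move=> A B AB; rewrite lee_fin outer_mono. Qed.

Lemma riesz_outer_subadditive : sigma_subadditive riesz_outer.
Proof.
move=> A; apply/lee_addgt0Pr => e e0.
have ee n : 0 < e / (2 ^ n.+1)%:R :> R by rewrite divr_gt0// ltr0n expn_gt0.
have /choice[U H] n := outer_near (A n) (ee n).
apply: (@le_trans _ _ (\sum_(n <oo) ((out (A n))%:E + (e / (2 ^ n.+1)%:R)%:E))%E); last first.
  by apply: epsilon_trick => [n|]; [rewrite lee_fin outer_ge0|exact: ltW].
apply: (@le_trans _ _ (\sum_(n <oo) (lam (U n))%:E)%E); last first.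
  apply: lee_nneseries => n; first by rewrite lee_fin open_content_ge0.
  by rewrite -EFinD lee_fin; case: (H n).
have oU n : open (U n) by case: (H n).
apply: (@le_trans _ _ (lam (\bigcup_n U n))%:E).
  rewrite lee_fin; apply: outer_le; first exact: bigcup_open.
  by apply: subset_bigcup => n _; case: (H n).
suff h K : closed K -> K `<=` \bigcup_n U n -> ((m K)%:E <= \sum_(n <oo) (lam (U n))%:E)%E.
  case E : (\sum_(n <oo) (lam (U n))%:E)%E h => [r| |] h.
  - by rewrite lee_fin; apply: open_content_le => K cK KU; have := h K cK KU; rewrite lee_fin.
  - by rewrite leey.
  - by have := h _ closed0 (@sub0set _ _).
move=> cK KU; have [N [F [cF FU KF]]] := closed_decomposition cK oU KU.
apply: (@le_trans _ _ (\sum_(0 <= n < N) (lam (U n))%:E)%E); last first.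
  by apply: nneseries_lim_ge => n _ _; rewrite lee_fin open_content_ge0.
rewrite sumEFin lee_fin big_mkord.
apply: le_trans (content_mono KF) _; apply: le_trans (content_bigU _ _) _.
by apply: ler_sum => n _; exact: open_content_ge.
Qed.

HB.instance Definition _ := isOuterMeasure.Build R X riesz_outer
  riesz_outer0 riesz_outer_ge0 riesz_outer_mono riesz_outer_subadditive.

(** For an open [V] containing [A], a closed [K] is taken inside the intersection of [V] and [U],
    then a closed [K'] inside [V] minus [K]. They are disjoint, so their contents add up to at most
    the content of [V]. *)
Lemma open_caratheodory (U : set X) : open U -> caratheodory_measurable riesz_outer U.
Proof.
move=> oU; apply: le_caratheodory_measurable => A.
rewrite /riesz_outer -EFinD lee_fin; apply: outer_ge => V oV AV.
have h1 : out (A `&` U) <= lam (V `&` U).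
  by apply: outer_le; [exact: openI|exact: setSI].
apply: le_trans (lerD h1 (lexx _)) _; rewrite -lerBrDr.
apply: open_content_le => K cK KVU; rewrite lerBrDr addrC -lerBrDr.
apply: (@le_trans _ _ (lam (V `\` K))).
  apply: outer_le; first by rewrite setDE; apply: openI => //; exact: closed_openC.
  by move=> x [Ax nUx]; split; [exact: AV|move=> /KVU[]].
apply: open_content_le => K' cK' K'V; rewrite lerBrDr addrC.
apply: le_trans (contentU_disjoint cK cK' _) _.
  by apply/seteqP; split => // x [Kx /K'V[]].
apply: open_content_ge; first exact: closedU.
by move=> x [/KVU[]|/K'V[]].
Qed.

Lemma borel_caratheodory (A : set (borel X)) : measurable A -> caratheodory_measurable riesz_outer A.
Proof.
have : <<s @open X >> `<=` caratheodory_measurable riesz_outer.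
  apply: smallest_sub => [|U]; last exact: open_caratheodory.
  split.
  - exact: caratheodory_measurable_set0.
  - by move=> B mB; rewrite setTD; exact: caratheodory_measurable_setC.
  - by move=> F mF; exact: caratheodory_measurable_bigcup.
exact.
Qed.

Lemma riesz_measure : exists mu : probability (borel X) R, forall A, mu A = riesz_outer A.
Proof.
apply: probability_exists.
- exact: riesz_outer0.
- exact: riesz_outer_ge0.
- move=> F mF tF mUF.
  exact: (@caratheodory_measure_sigma_additive R X riesz_outer F
    (fun n => borel_caratheodory (mF n)) tF (borel_caratheodory mUF)).
- by rewrite /riesz_outer outerT.
Qed.

Lemma continuous_bmf (f : X -> R) : continuous f -> bmf (f : borel X -> R).
Proof.
move=> cf; split; first exact: continuous_borel_fun.
by have [M _ MP] := bounded_continuous dm cX cf; exists M.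
Qed.

Lemma clamp_sum (t : R) n : 0 <= t ->
  \sum_(k < n) Num.min 1 (Num.max 0 (t - k%:R)) = Num.min t n%:R.
Proof.
move=> t0; elim: n => [|n IH]; first by rewrite big_ord0 (min_idPr t0).
rewrite big_ord_recr/= IH -natr1.
have [h|h] := leP t n%:R.
  rewrite (max_idPl _) ?subr_le0// (min_idPr ler01) addr0.
  by rewrite (min_idPl _)// (le_trans h)// lerDl.
rewrite (max_idPr _) ?subr_ge0 1?ltW//.
by have [h'|h'] := leP 1 (t - n%:R); [rewrite (min_idPr _)|rewrite (min_idPl _)]; lra.
Qed.

(** A layer-cake argument: [n g] is the sum of the truncations [gk n k], each dominated by the
    indicator of the level set [K n k], and these indicators sum to at most [1 + n g]. Dividing by a
    large [n] removes the 1. *)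
Lemma state_le_Ex01 (mu : probability (borel X) R) (g : X -> R) :
  (forall K : set X, closed K -> m K <= prob mu K) ->
  continuous g -> (forall x, 0 <= g x) -> (forall x, g x <= 1) -> l g <= Ex mu g.
Proof.
move=> mmu cg g0 g1.
pose gk (n k : nat) x := Num.min 1 (Num.max 0 (n%:R * g x - k%:R)).
have cgk n k : continuous (gk n k).
  move=> x; apply: (@continuous_min R X (cst 1) (fun x => Num.max 0 (n%:R * g x - k%:R))).
    exact: cvg_cst.
  apply: (@continuous_max R X (cst 0) (fun x => n%:R * g x - k%:R)); first exact: cvg_cst.
  by apply: cvgB; [apply: contZ|exact: cvg_cst].
pose K (n k : nat) := [set x | k%:R <= n%:R * g x].
have cK n k : closed (K n k).
  by apply: closed_ge_continuous; exact: contZ.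
have mK n k : measurable (K n k : set (borel X)) := closed_borel (cK n k).
have gkK n k : l (gk n k) <= prob mu (K n k).
  apply: le_trans (mmu _ (cK n k)); apply: content_ge => f cf f0 f1.
  apply: state_le => // x; rewrite /gk; have [h|h] := leP (n%:R * g x) k%:R.
    by rewrite (max_idPl _) ?subr_le0// (min_idPr ler01).
  by apply: le_trans (f1 _ _); [rewrite ge_min lexx|exact: ltW].
have cs n j : continuous (fun x => \sum_(k < j) gk n k x).
  elim: j => [|j IH]; first by under eq_fun do rewrite big_ord0; exact: cst_continuous.
  by under eq_fun do rewrite big_ord_recr/=; exact: contD.
have ls n j : l (fun x => \sum_(k < j) gk n k x) = \sum_(k < j) l (gk n k).
  elim: j => [|j IH].
    by rewrite big_ord0; under eq_fun do rewrite big_ord0; exact: (state_cst sl).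
  by rewrite big_ord_recr/= -IH -(stateD sl)//; congr l; apply/funext => x; rewrite big_ord_recr.
have gs n x : \sum_(k < n) gk n k x = n%:R * g x.
  rewrite clamp_sum ?mulr_ge0//; apply/min_idPl.
  by rewrite ler_piMr.
have main n : n%:R * l g <= 1 + n%:R * Ex mu g.
  rewrite -(stateZ sl)//; under eq_fun do rewrite -gs.
  rewrite ls; apply: (@le_trans _ _ (\sum_(k < n) prob mu (K n k))); first exact: ler_sum.
  have /(_ n)[bs Es] j : bmf (fun x : borel X => \sum_(k < j) \1_(K n k) x : R) /\
      Ex mu (fun x => \sum_(k < j) \1_(K n k) x) = \sum_(k < j) prob mu (K n k).
    elim: j => [|j [IH1 IH2]].
      rewrite big_ord0; under eq_fun do rewrite big_ord0.
      by split; [exact: bmf_cst|exact: Ex_cst].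
    rewrite big_ord_recr/=; under eq_fun do rewrite big_ord_recr/=.
    have bi := bmf_indic R (mK n j).
    by split; [exact: bmfD|rewrite ExD// IH2 Ex_indic].
  rewrite -Es -[X in _ <= X + _](Ex_cst mu 1) -(ExZ mu _ (continuous_bmf cg)).
  have bg := bmfZ n%:R (continuous_bmf cg).
  rewrite -(ExD mu (bmf_cst _ 1) bg).
  apply: Ex_le => //; first by apply: bmfD => //; exact: bmf_cst.
  move=> x; rewrite -gs /=; case: n {bs Es bg} => [|n]; first by rewrite !big_ord0 addr0.
  (* Shift by one level: the indicator of level 0 costs the extra 1, and that of level [k.+1] is at
     most [gk n k]. *)
  rewrite big_ord_recl big_ord_recr/=; apply: lerD.
    by rewrite indicE; case: (_ \in _).
  rewrite -[leLHS]addr0; apply: lerD; last by rewrite /gk le_min ler01 le_max lexx.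
  apply: ler_sum => k _; rewrite indicE /K; case: (boolP (_ \in _)) => [/set_mem /=|_].
    rewrite /bump /= add1n -natr1 => h; rewrite /gk le_min lexx le_max/=.
    by apply/orP; right; lra.
  by rewrite /gk le_min ler01 le_max lexx.
rewrite leNgt; apply/negP => h; have h' : 0 < l g - Ex mu g by rewrite subr_gt0.
pose n := (Num.truncn (l g - Ex mu g)^-1).+1.
have := main n; rewrite leNgt => /negP; apply.
rewrite -ltrBrDr -mulrBr -ltr_pdivrMr// mul1r.
by rewrite /n truncnS_gt.
Qed.

(** One inequality suffices, since it also applies to [- f]; an affine change brings [f] into the
    unit interval. *)
Lemma riesz_representation : exists mu : probability (borel X) R,
  forall f : X -> R, continuous f -> Ex mu f = l f.
Proof.
have [mu muE] := riesz_measure; exists mu.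
have mmu (K : set X) : closed K -> m K <= prob mu K.
  move=> cK; have -> : prob mu K = outer_content K by rewrite /prob muE.
  exact: content_outer.
have le f : continuous f -> l f <= Ex mu f.
  move=> cf; have [M M0 MP] := bounded_continuous dm cX cf.
  have M20 : 0 < 2 * M by rewrite mulr_gt0.
  pose g x := (2 * M)^-1 * (f x + M).
  have cfM : continuous (fun x => f x + M) by apply: contD => //; exact: cst_continuous.
  have cg : continuous g by exact: contZ.
  have := state_le_Ex01 mmu cg.
  rewrite (stateZ sl)// (stateD sl)//; last exact: cst_continuous.
  rewrite ExZ; last exact: continuous_bmf.
  rewrite ExD; [|exact: continuous_bmf|exact: bmf_cst].
  rewrite (Ex_cst mu M) (state_cst sl M) ler_pM2l ?invr_gt0// lerD2r; apply => x.
    rewrite mulr_ge0 ?invr_ge0 ?(ltW M20)//; have := MP x.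
    by rewrite ler_norml => /andP[]; lra.
  rewrite /g mulrC ler_pdivrMr// mul1r; have := MP x.
  by rewrite ler_norml => /andP[]; lra.
move=> f cf; apply/le_anti/andP; split; last exact: le.
have cNf : continuous (fun x => - f x) by move=> x; apply: cvgN; exact: cf.
have := le _ cNf; rewrite ExN; last exact: continuous_bmf.
under eq_fun do rewrite -mulN1r.
by rewrite (stateZ sl)// mulN1r lerN2.
Qed.

End riesz.

(** * Entropy and normalised weights *)

Section partitions.
Context (R : realType) (X : ptopologicalType) (d : X -> X -> R).
Hypothesis dm : compatible_metric d.
Hypothesis cX : compact [set: X].

(** A point is coded by the balls of radius [r / 2] around a finite net that contain it; equal codes
    put two points into a common ball. *)
Lemma fine_partition (r : R) : 0 < r -> exists (T : finType) (q : borel X -> T),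
  rv q /\ forall x y, q x = q y -> d x y < r.
Proof.
move=> r0; have r20 : 0 < r / 2 by rewrite divr_gt0.
have [s sP] := fin_net dm cX r20.
suff [T [q [mq qP]]] : exists (T : finType) (q : borel X -> T), rv q /\
    forall x y z, q x = q y -> z \in s -> d z x < r / 2 -> d z y < r / 2.
  exists T, q; split=> // x y xy; have [z zs zx] := sP x.
  have := qP _ _ _ xy zs zx; have := d_tri dm z x y; rewrite (dC dm x z); lra.
elim: {sP} s => [|z s [T [q [mq qP]]]].
  exists unit, (fun=> tt); split=> // -[]; rewrite (_ : _ @^-1` _ = setT)//.
  by apply/seteqP; split.
exists (T * bool)%type, (fun x => (q x, d z x < r / 2)); split.
  apply: rv_pair => // b.
  have mz : measurable ([set x | d z x < r / 2] : set (borel X)).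
    by apply: open_borel; exact: open_dball.
  case: b; first by rewrite (_ : _ @^-1` _ = [set x | d z x < r / 2])//; apply/seteqP; split.
  rewrite (_ : _ @^-1` _ = ~` [set x | d z x < r / 2]); first exact: measurableC.
  by apply/seteqP; split => x /=; [move=> ->|move/negP/negbTE].
move=> x y z' [xy zxy]; rewrite inE => /predU1P[->|]; last exact: qP.
by rewrite zxy.
Qed.

Lemma disjoint_closed_separated (A : finType) (K : A -> set X) :
  (forall a, closed (K a)) -> (forall a b x, K a x -> K b x -> a = b) ->
  exists2 r : R, 0 < r & forall x a b y z, K a y -> K b z -> d x y < r -> d x z < r -> a = b.
Proof.
move=> cK dK; apply: (compact_unif dm cX) => [x r s sr H a b y z Ka Kb xy xz|x0].
  by apply: (H _ _ y z) => //; exact: lt_le_trans sr.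
have H a : exists r : R, 0 < r /\ (~ K a x0 -> forall y, d x0 y < r -> ~ K a y).
  have [Ka|nKa] := pselect (K a x0); first by exists 1; split=> // /(_ Ka).
  have [r r0 rP] := open_dballP dm (closed_openC (cK a)) nKa.
  by exists r; split=> // _ y /rP.
have /choice[rr rrP] := H.
have [|r r0 rP] := @seq_min_pos R A (enum A) rr; first by move=> a; case: (rrP a).
have r20 : 0 < r / 2 by rewrite divr_gt0.
exists (r / 2), (r / 2); split=> // x x0x a b y z Ka Kb xy xz.
have in0 a' y' : K a' y' -> d x y' < r / 2 -> K a' x0.
  move=> Ka' xy'; apply: contrapT => nK; have [_ /(_ nK y')] := rrP a'; apply => //.
  by have := rP a' (mem_enum _ _); have := d_tri dm x x0 y'; lra.
by apply: (dK _ _ x0); [apply: in0 xy|apply: in0 xz].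
Qed.

End partitions.

Section upper_bound.
Context (R : realType) (X : ptopologicalType) (phi : X -> X)
  (d : X -> X -> R) (eps theta : R).
Hypothesis ES : expanding_system phi d eps theta.
Let dm := es_metric ES.
Let cX := es_compact ES.
Let mphi := continuous_borel_map (es_continuous ES).

Lemma expand_iter n x y : (forall i, (i < n)%N -> d (iter i phi x) (iter i phi y) < eps) ->
  theta ^+ n * d x y <= d (iter n phi x) (iter n phi y).
Proof.
have t0 : 0 < theta := lt_trans ltr01 (es_theta ES).
elim: n => [_|n IH H]; first by rewrite expr0 mul1r.
rewrite exprS -mulrA; apply: le_trans (es_expand ES (H n (ltnSn n))).
by rewrite ler_wpM2l ?(ltW t0)//; apply: IH => i /ltnW; exact: H.
Qed.

(** Orbits that share an itinerary stay within [eps] of each other, so their initial distance is at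
    most about [eps / theta^n]. *)
Lemma itin_diameter (T : finType) (g : X -> T) (r : R) :
  (forall x y, g x = g y -> d x y < eps) -> 0 < r ->
  exists n, forall x y, itin phi g n x = itin phi g n y -> d x y < r.
Proof.
move=> ge r0; have t1 := es_theta ES; have t0 := lt_trans ltr01 t1.
have [||n _ /(_ _ (leqnn n)) nP] := @geometric_small R eps theta^-1 (r / 2) _ _ (divr_gt0 r0 (ltr0Sn R 1)).
- by rewrite invr_ge0 ltW.
- by rewrite invf_lt1.
exists n.+1 => x y xy.
have H i : (i < n.+1)%N -> d (iter i phi x) (iter i phi y) < eps.
  move=> ni; apply: ge; have /ffunP/(_ (Ordinal ni)) := xy.
  by rewrite !ffunE.
have h1 : theta ^+ n * d x y < eps.
  apply: le_lt_trans (H n (ltnSn n)); apply: expand_iter => i ni.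
  by apply: H; exact: ltnW.
apply: (@le_lt_trans _ _ (r / 2)); last by rewrite ltr_pdivrMr// ltr_pMr// ltr1n.
apply: le_trans nP; rewrite exprVn ler_pdivlMr ?exprn_gt0// mulrC.
exact: ltW.
Qed.

Variable mu : probability (borel X) R.
Hypothesis inv : phi_invariant phi mu.

Lemma Ex_sum (I : Type) (r : seq I) (F : I -> borel X -> R) : (forall i, bmf (F i)) ->
  bmf (fun x => \sum_(i <- r) F i x) /\
  Ex mu (fun x => \sum_(i <- r) F i x) = \sum_(i <- r) Ex mu (F i).
Proof.
move=> bF; elim: r => [|i r [IH1 IH2]].
  rewrite big_nil; under eq_fun do rewrite big_nil.
  by split; [exact: bmf_cst|exact: Ex_cst].
rewrite big_cons; under eq_fun do rewrite big_cons.
by split; [exact: bmfD|rewrite ExD// IH2].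
Qed.

Lemma weight_le1 (c : X -> R) : (forall x, 0 <= c x) ->
  (forall y, RPF phi c (cst 1) y <= 1) -> forall x, c x <= 1.
Proof.
move=> c0 c1 x; apply: le_trans (c1 (phi x)); rewrite (RPFE ES).
have xp : x \in preimages phi (phi x) by rewrite (mem_preimages ES).
rewrite (big_rem x xp)/= mulr1 lerDl; apply: sumr_ge0 => z _.
by rewrite mulr1.
Qed.

Lemma continuous_lnc (c : X -> R) : continuous c -> (forall x, 0 < c x) ->
  continuous (fun x => ln (c x)).
Proof.
move=> cc c0 x; apply: (@continuous_comp _ _ _ c (@ln R)); first exact: cc.
exact: continuous_ln.
Qed.

(* Gibbs' inequality for the conditional law of p given the itinerary of the next point: the
   competing weights w a b are the total c-weight of those preimages of a point of the cell b
   that lie near a compact part of the cell a, smoothed by s to stay positive. *)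
Lemma entropy_le_weight (c : X -> R) (T : finType) (p : borel X -> T) :
  continuous c -> (forall x, 0 < c x) -> (forall y, RPF phi c (cst 1) y <= 1) -> rv p ->
  entr phi mu p <= - Ex mu (fun x => ln (c x)).
Proof.
move=> cc c0 c1 mp; have c0' x : 0 <= c x by exact: ltW.
have cle1 := weight_le1 c0' c1.
have clc := continuous_lnc cc c0; have blc := continuous_bmf dm cX clc.
suff H (e' : R) : 0 < e' -> entr phi mu p <= - Ex mu (fun x => ln (c x)) + e'.
  by apply/ler_addgt0Pr.
move=> e'0; pose e : R := e' / 3; have e0 : 0 < e by rewrite divr_gt0.
(* Chosen so that the factor [1 - s] costs exactly [e] in the logarithm. The total error [e'] splits
   into [2 * e] on the compact parts and [e] off them. *)
pose s : R := 1 - expR (- e).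
have s0 : 0 < s by rewrite subr_gt0 -[ltRHS]expR0 ltr_expR oppr_lt0.
have s1E : 1 - s = expR (- e) by rewrite /s opprB addrC subrK.
have [dl dl0 dlP] := dunif_continuous dm cX clc e0.
have [S [q [mq qP]]] := fine_partition dm cX (es_eps ES).
pose A : finType := (T * S)%type; pose g (x : borel X) : A := (p x, q x).
have mg : rv g := rv_pair mp mq.
have geps x y : g x = g y -> d x y < eps by move=> [_ /qP].
pose cA : R := #|A|%:R.
have A0 : 0 < cA by rewrite ltr0n; apply/card_gt0P; exists (g point).
pose M := - ln (s / cA).
have cA1 : 1 <= cA by rewrite ler1n; apply/card_gt0P; exists (g point).
have M0 : 0 <= M.
  rewrite oppr_ge0 ln_le0// ler_pdivrMr// mul1r; apply: le_trans cA1.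
  by rewrite gerBl expR_ge0.
(* Off the compact parts the only bound is [- ln w <= M]; with [cA] cells of defect at most [k] this
   contributes at most [e]. *)
pose k := e / (M + 1) / cA.
have M10 : 0 < M + 1 by rewrite ltr_wpDl.
have k0 : 0 < k by rewrite !divr_gt0.
have /choice[K KP] a := inner_regular dm mu (mg a) k0.
have cK a : closed (K a) by case: (KP a).
have gK a x : K a x -> g x = a by case: (KP a) => _ H _ /H.
have [rho rho0 rhoP] := @disjoint_closed_separated R X d dm cX A K cK
  (fun a b x Ka Kb => etrans (esym (gK _ _ Ka)) (gK _ _ Kb)).
have [dL dL0 dLP] := lifting ES.
(* Three demands on the distance of [phi x] to the chosen point of its cell: a lift near [x] exists,
   the lift is recognised as near [K (g x)], and [ln c] varies by less than [e]. *)
pose d2 := Num.min dL (Num.min rho dl).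
have d20 : 0 < d2 by rewrite !lt_min dL0 rho0 dl0.
have [n nP] := itin_diameter geps d20.
have mi := rv_itin mphi n mg.
pose W := {ffun 'I_n -> A}.
have /choice[yb ybP] : forall b : W, exists y, forall x, itin phi g n x = b -> itin phi g n y = b.
  move=> b; have [[y yE]|H] := pselect (exists y, itin phi g n y = b); first by exists y.
  by exists point => x xE; exfalso; apply: H; exists x.
pose near (a : A) (z : X) := `[< exists2 x, K a x & d z x < rho >].
pose w (a : A) (b : W) : R :=
  (1 - s) * (\sum_(z <- preimages phi (yb b)) (near a z)%:R * c z) + s / cA.
have sum0 a b : 0 <= \sum_(z <- preimages phi (yb b)) (near a z)%:R * c z.
  by apply: sumr_ge0 => z _; rewrite mulr_ge0.
have s10 : 0 < 1 - s by rewrite s1E expR_gt0.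
have w0 a b : 0 < w a b.
  by rewrite ltr_wpDl ?divr_gt0// mulr_ge0// ltW.
(* By the choice of [rho] each preimage is near at most one compact part, so it is counted once, and
   the two summands contribute at most [1 - s] and [s]. *)
have w1 b : \sum_a w a b <= 1.
  rewrite big_split/= -mulr_sumr sumr_const -mulr_natr -/cA.
  rewrite divfK ?gt_eqF// exchange_big/=.
  have h : \sum_(z <- preimages phi (yb b)) \sum_a (near a z)%:R * c z <= 1.
    apply: le_trans (c1 (yb b)); rewrite (RPFE ES); apply: ler_sum => z _.
    rewrite -mulr_suml mulr1 ler_piMl//.
    have [/existsP[a az]|H] := boolP [exists a, near a z]; last first.
      rewrite big1 ?ler01// => a _; move: H; rewrite negb_exists => /forallP/(_ a).
      by move=> /negbTE ->.
    rewrite (bigD1 a)//= az big1 ?addr0// => b' ba.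
    have [b'z|//] := boolP (near b' z).
    move: az b'z => /asboolP[x Kx zx] /asboolP[y Ky zy].
    by rewrite (rhoP z a b' x y Kx Ky zx zy) eqxx in ba.
  by have := ler_wpM2l (ltW s10) h; lra.
(* The lift [z] of [yb b] near [x] is one of the preimages counted by [w]; the passage from [c x] to
   [c z] and the factor [1 - s] cost [e] each. *)
have good x : K (g x) x -> - ln (w (g x) (itin phi g n (phi x))) <= - ln (c x) + 2 * e.
  move=> Kx; set b := itin phi g n (phi x); set y := yb b.
  have /nP : itin phi g n (phi x) = itin phi g n y by rewrite (ybP b (phi x)).
  rewrite !lt_min => /and3P[/[dup] xyL /dLP[z [zy _ xz]] xyrho xydl].
  have xz' : d x z <= d (phi x) y.
    by apply: le_trans xz; rewrite ler_peMl ?(d_ge0 dm)// ltW// (es_theta ES).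
  have nz : near (g x) z by apply/asboolP; exists x => //; rewrite (dC dm) (le_lt_trans xz').
  have lncz : ln (c x) - e <= ln (c z).
    by have := dlP _ _ (le_lt_trans xz' xydl); rewrite ltr_norml => /andP[_]; lra.
  have h : (1 - s) * c z <= w (g x) b.
    rewrite -[leLHS]addr0; apply: lerD; last by rewrite divr_ge0 ?ltW.
    rewrite ler_wpM2l ?(ltW s10)//.
    have zp : z \in preimages phi (yb b) by rewrite (mem_preimages ES) zy.
    rewrite (big_rem z zp)/= nz mul1r lerDl; apply: sumr_ge0 => z' _.
    by rewrite mulr_ge0.
  have : ln ((1 - s) * c z) <= ln (w (g x) b) by rewrite ler_ln ?posrE ?mulr_gt0.
  by rewrite lnM ?posrE// s1E expRK; lra.
have bad x : - ln (w (g x) (itin phi g n (phi x))) <= M.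
  rewrite lerN2 ler_ln ?posrE ?divr_gt0// lerDr.
  by rewrite mulr_ge0// ltW.
pose B a : set (borel X) := g @^-1` [set a] `\` K a.
have mB a : measurable (B a) by apply: measurableD; [exact: mg|exact: closed_borel].
pose ind (x : borel X) : R := \sum_a \1_(B a) x.
have [bind Eind] := Ex_sum (index_enum A) (fun a => bmf_indic R (mB a)).
have ptw x : - ln (w (g x) (itin phi g n (phi x))) <= (- ln (c x) + 2 * e) + M * ind x.
  have [Kx|nKx] := pselect (K (g x) x).
    apply: le_trans (good x Kx) _; rewrite lerDl mulr_ge0//.
    by apply: sumr_ge0 => a _; rewrite indicE ler0n.
  apply: le_trans (bad x) _; rewrite -[leLHS]add0r; apply: lerD.
    by have := ln_le0 (cle1 x); lra.
  rewrite ler_peMr// /ind (bigD1 (g x))//= indicE mem_set//= lerDl.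
  by apply: sumr_ge0 => a _; rewrite indicE ler0n.
have mz := rv_pair mg (rv_phi mphi mi).
have entle : entr phi mu p <= Ex mu (fun x => - ln (w (g x) (itin phi g n (phi x)))).
  apply: (@le_trans _ _ (entr phi mu g)); first exact: (entr_comp mphi inv fst mg).
  apply: le_trans (entr_le mphi inv mg n) _; rewrite dentE//.
  apply: le_trans (cond_ent_le mu mg (rv_phi mphi mi) w0 w1) _.
  by rewrite -(Ex_rv mu (fun u => - ln (w u.1 u.2)) mz).
apply: le_trans entle _.
have b2 : bmf (fun x : borel X => - ln (c x) + 2 * e) := bmfD (bmfN blc) (bmf_cst _ (2 * e)).
apply: le_trans (Ex_le mu (bmf_rv (fun u => - ln (w u.1 u.2)) mz) (bmfD b2 (bmfZ M bind)) ptw) _.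
rewrite (ExD mu b2 (bmfZ M bind)) (ExD mu (bmfN blc) (bmf_cst _ (2 * e))).
rewrite (ExN mu blc) Ex_cst (ExZ mu M bind) Eind.
have h : \sum_a Ex mu (\1_(B a)) <= e / (M + 1).
  apply: (@le_trans _ _ (\sum_(a : A) k)).
    by apply: ler_sum => a _; rewrite Ex_indic//; case: (KP a).
  by rewrite sumr_const -mulr_natr -/cA /k divfK ?gt_eqF.
have h2 : M * (e / (M + 1)) <= e.
  by rewrite mulrCA ler_piMr ?(ltW e0)// ler_pdivrMr// mul1r lerDl.
have := ler_wpM2l M0 h; rewrite /e in h2 *; lra.
Qed.

End upper_bound.

Lemma continuous_sum (R : realType) (X : ptopologicalType) (I : Type) (r : seq I)
  (F : I -> X -> R) : (forall i, continuous (F i)) -> continuous (fun x => \sum_(i <- r) F i x).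
Proof.
move=> cF; elim: r => [|i r IH].
  by under eq_fun do rewrite big_nil; exact: cst_continuous.
by under eq_fun do rewrite big_cons; exact: contD.
Qed.

(** * Two-sided comparison of entropy with weights *)

Section entropy_bounds.
Context (R : realType) (X : ptopologicalType) (phi : X -> X)
  (d : X -> X -> R) (eps theta : R).
Hypothesis ES : expanding_system phi d eps theta.
Let dm := es_metric ES.
Let cX := es_compact ES.
Let mphi := continuous_borel_map (es_continuous ES).
Variable mu : probability (borel X) R.
Hypothesis inv : phi_invariant phi mu.

Lemma continuous_comp_phi (f : X -> R) : continuous f -> continuous (fun x => f (phi x)).
Proof.
move=> cf x; apply: (@continuous_comp _ _ _ phi f); first exact: (es_continuous ES).
exact: cf.
Qed.

(* Coboundary change: the weight c u / (lam u o phi) is normalised and has the same integral. *)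
Lemma KSentropy_le_supersolution (c u : X -> R) lam : continuous c -> (forall x, 0 < c x) ->
  continuous u -> (forall x, 0 < u x) -> 0 < lam ->
  (forall y, RPF phi c u y <= lam * u y) ->
  (KSentropy phi mu <= (ln lam - Ex mu (fun x => ln (c x)))%:E)%E.
Proof.
move=> cc c0 cu u0 l0 Lu; apply: (KSentropy_le mphi inv) => T g mg.
pose v x := (lam * u (phi x))^-1.
have v0 x : 0 < v x by rewrite invr_gt0 mulr_gt0.
pose c' x := c x * u x * v x.
have cup := continuous_comp_phi cu.
have cv : continuous v.
  move=> x; apply: cvgV; first by rewrite gt_eqF ?mulr_gt0.
  by apply: cvgMl_tmp; exact: cup.
have cc' : continuous c' by apply: contM => //; exact: contM.
have c'0 x : 0 < c' x by rewrite !mulr_gt0.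
have Lc' y : RPF phi c' (cst 1) y <= 1.
  rewrite (_ : RPF _ _ _ _ = RPF phi c (fun x => (lam * u (phi x))^-1 * u x) y); last first.
    by rewrite !(RPFE ES); apply: eq_bigr => x _; rewrite /c' /v mulr1; ring.
  rewrite (RPF_pullback ES c u (fun z => (lam * u z)^-1)) mulrC.
  by rewrite ler_pdivrMr ?mulr_gt0// mul1r.
apply: le_trans (entropy_le_weight ES inv cc' c'0 Lc' mg) _.
have blc := continuous_bmf dm cX (continuous_lnc cc c0).
have blu := continuous_bmf dm cX (continuous_lnc cu u0).
have blup := continuous_bmf dm cX (continuous_comp_phi (continuous_lnc cu u0)).
have E : Ex mu (fun x => ln (c' x)) = Ex mu (fun x => ln (c x)) +
    (Ex mu (fun x => ln (u x)) + (- ln lam + - Ex mu (fun x => ln (u (phi x))))).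
  rewrite -(ExN mu blup) -[X in _ + (_ + (X + _))](Ex_cst mu).
  rewrite -(ExD mu (bmf_cst _ _) (bmfN blup)) -(ExD mu blu (bmfD (bmf_cst _ _) (bmfN blup))).
  rewrite -(ExD mu blc (bmfD blu (bmfD (bmf_cst _ _) (bmfN blup)))); congr Ex.
  apply/funext => x; rewrite /c' lnM ?posrE ?mulr_gt0// [ln (c x * u x)]lnM ?posrE//.
  by rewrite /v lnV ?posrE ?mulr_gt0// lnM ?posrE//=; ring.
have E2 : Ex mu (fun x => ln (u (phi x))) = Ex mu (fun x => ln (u x)).
  exact: (Ex_invariant mphi inv blu).
rewrite E E2; lra.
Qed.

(** For the weight 1 the operator counts preimages, and a bound [M] on their number gives
    [h(mu) <= ln M]. *)
Lemma KSentropy_lty : (KSentropy phi mu < +oo)%E.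
Proof.
have [M M0 MP] := RPF1_bound ES (@cst_continuous X R 1).
apply: le_lt_trans (ltry (ln M - Ex mu (fun x => ln (cst (1 : R) x)))).
apply: (@KSentropy_le_supersolution (cst 1) (cst 1)) => //; try exact: cst_continuous.
by move=> y; rewrite mulr1.
Qed.

Definition KSr := fine (KSentropy phi mu).

Lemma KSentropyE : KSentropy phi mu = KSr%:E.
Proof.
rewrite fineK// fin_numElt KSentropy_lty andbT.
by apply: lt_le_trans (KSentropy_ge0 mphi inv); rewrite ltNy0.
Qed.

(** The weight [c e^g] may vanish, so [c] is replaced by [c + k]. The extra term is at most [k * B],
    and the slack [(lam' - lam) * u >= lam' - lam] pays for it. *)
Lemma entropy_le_perturbed (c g u : X -> R) lam lam' : continuous c -> (forall x, 0 <= c x) ->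
  continuous g -> continuous u -> (forall x, 1 <= u x) -> 0 <= lam -> lam < lam' ->
  (forall y, RPF phi (fun x => c x * expR (g x)) u y <= lam * u y) ->
  exists2 k0 : R, 0 < k0 & forall k, 0 < k -> k <= k0 ->
    KSr + Ex mu (fun x => ln (c x + k)) + Ex mu g <= ln lam'.
Proof.
move=> cc c0 cg cu u1 l0 ll Lu.
have u0 x : 0 < u x := lt_le_trans ltr01 (u1 x).
have ce : continuous (fun x => expR (g x)).
  by move=> x; apply: (@continuous_comp _ _ _ g expR); [exact: cg|exact: continuous_expR].
have cL := RPF_continuous ES ce cu.
have [B B0 BP] := bounded_continuous dm cX cL.
exists ((lam' - lam) / B); first by rewrite divr_gt0// subr_gt0.
move=> k k_gt0 kk.
have ck : continuous (fun x => c x + k) by apply: contD => //; exact: cst_continuous.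
have ck0 x : 0 < c x + k by rewrite ltr_wpDl.
have cw : continuous (fun x => (c x + k) * expR (g x)) by exact: contM.
have w0 x : 0 < (c x + k) * expR (g x) by rewrite mulr_gt0 ?expR_gt0.
have := KSentropy_le_supersolution cw w0 cu u0 (le_lt_trans l0 ll).
rewrite KSentropyE lee_fin => H.
have {}H : KSr <= ln lam' - Ex mu (fun x => ln ((c x + k) * expR (g x))).
  apply: H => y.
  rewrite (_ : RPF _ _ _ _ = RPF phi (fun x => c x * expR (g x)) u y +
      k * RPF phi (fun x => expR (g x)) u y); last first.
    rewrite -(RPFZ ES) !(RPFE ES) -big_split/=; apply: eq_bigr => x _; ring.
  apply: le_trans (lerD (Lu y) (_ : _ <= (lam' - lam) * u y)) _; last by rewrite -mulrDl addrC subrK.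
  apply: (@le_trans _ _ (k * B)).
    by rewrite ler_wpM2l ?(ltW k_gt0)//; apply: le_trans (ler_norm _) (BP y).
  apply: (@le_trans _ _ (lam' - lam)); first by rewrite -ler_pdivlMr.
  by rewrite ler_peMr// subr_ge0 ltW.
have E : Ex mu (fun x => ln ((c x + k) * expR (g x))) = Ex mu (fun x => ln (c x + k)) + Ex mu g.
  rewrite -ExD; [|exact: (continuous_bmf dm cX (continuous_lnc ck ck0))|exact: (continuous_bmf dm cX cg)].
  by congr Ex; apply/funext => x; rewrite lnM ?posrE ?expR_gt0// expRK.
by move: H; rewrite E; lra.
Qed.

Lemma tent_sum_le1 (A : finType) (K : A -> set X) (r : R) (x : X) : 0 < r -> r <= 1 ->
  (forall a b y z, K a y -> K b z -> d x y < r -> d x z < r -> a = b) ->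
  \sum_a tent d (K a) r x <= 1.
Proof.
move=> r0 r1 sep.
have [/existsP[a az]|H] := boolP [exists a, tent d (K a) r x != 0]; last first.
  rewrite big1 ?ler01// => a _; move: H; rewrite negb_exists => /forallP/(_ a).
  by rewrite negbK => /eqP.
rewrite (bigD1 a)//= big1 ?addr0 ?(tent_le1 dm)// => b ba.
apply/eqP/negPn/negP => bz.
have [y Ky xy] := tent_supp r0 r1 az; have [z Kz xz] := tent_supp r0 r1 bz.
by rewrite (sep _ _ _ _ Ky Kz xy xz) eqxx in ba.
Qed.

(* w approximates the conditional probability of the cell of x given the n-itinerary of phi x,
   made continuous by tent functions on compact parts of the cells. *)
Lemma entropy_ge_weight (e : R) : 0 < e -> exists w : X -> R,
  [/\ continuous w, forall x, 0 < w x, forall y, RPF phi w (cst 1) y <= 1 + e &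
      - Ex mu (fun x => ln (w x)) <= KSr + e].
Proof.
move=> e0; have e20 : 0 < e / 2 by rewrite divr_gt0.
(* Two preimages in the support of the tent of one cell are within [3 * (eps / 3)], hence equal. *)
have ep3 : 0 < eps / 3 by rewrite divr_gt0// (es_eps ES).
have [A [g [mg gP]]] := fine_partition dm cX ep3.
have [n nP] := dent_le_entr mphi inv mg e20.
have mi := rv_itin mphi n mg; have mip := rv_phi mphi mi.
have mz := rv_pair mg mip.
have [N NP] := size_preimages ES.
pose W : finType := {ffun 'I_n -> A}.
pose z (x : borel X) : A * W := (g x, (itin phi g n \o phi) x).
(* A floor for [w]: the first entry makes [- ln tau] nonnegative, the second bounds the sum of [tau]
   over a fibre by [e]. *)
pose tau := Num.min 2^-1 (e / N.+1%:R).
have tau0 : 0 < tau by rewrite lt_min invr_gt0 ltr0Sn divr_gt0.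
have tau1 : tau <= 1 by rewrite ge_min; apply/orP; left; lra.
pose M := - ln tau.
have M0 : 0 <= M by rewrite oppr_ge0 ln_le0.
pose cW : R := #|W|%:R.
have W0 : 0 < cW by rewrite ltr0n; apply/card_gt0P; exists (itin phi g n point).
pose k := e / 2 / (M + 1) / cW.
have M10 : 0 < M + 1 by rewrite ltr_wpDl.
have k0 : 0 < k by rewrite !divr_gt0.
have /choice[K KP] b := inner_regular dm mu (mi b) k0.
have cK b : closed (K b) by case: (KP b).
have gK b x : K b x -> itin phi g n x = b by case: (KP b) => _ H _ /H.
have [rho rho0 rhoP] := @disjoint_closed_separated R X d dm cX W K cK
  (fun a b x Ka Kb => etrans (esym (gK _ _ Ka)) (gK _ _ Kb)).
pose rh := Num.min rho 1; pose re := Num.min (eps / 3) 1.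
have rh0 : 0 < rh by rewrite lt_min rho0 ltr01.
have rh1 : rh <= 1 by rewrite ge_min lexx orbT.
have re0 : 0 < re by rewrite lt_min ep3 ltr01.
have re1 : re <= 1 by rewrite ge_min lexx orbT.
pose pb b := tent d (K b) rh.
pose pa a := tent d (g @^-1` [set a]) re.
have pb0 b y : 0 <= pb b y by exact: tent_ge0.
have pa0 a y : 0 <= pa a y by exact: tent_ge0.
have sumb y : \sum_b pb b y <= 1.
  apply: tent_sum_le1 => // a b y' z' Ka Kb; rewrite !lt_min => /andP[h1 _] /andP[h2 _].
  exact: (rhoP y a b y' z').
(* Tents of different cells [a] may overlap. What normalises [w] is that a fibre meets each of them
   at most once, while the [G (a, b)] sum to at most 1 over [a]. *)
have suma a y : \sum_(x <- preimages phi y) pa a x <= 1.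
  have [/hasP[x xp xa]|H] := boolP (has (fun x => pa a x != 0) (preimages phi y)); last first.
    rewrite big_seq big1 ?ler01// => x xp; apply/eqP.
    by move: H; rewrite -all_predC => /allP/(_ x xp)/=; rewrite negbK.
  rewrite (bigD1_seq x xp (uniq_preimages phi y))/= big_seq_cond big1 ?addr0; first exact: (tent_le1 dm).
  move=> x' /andP[x'p xx']; apply/eqP/negPn/negP => xa'.
  have [y1 gy1 xy1] := tent_supp re0 re1 xa; have [y2 gy2 xy2] := tent_supp re0 re1 xa'.
  have xx : x' = x.
    apply: (locally_injective ES); last first.
      by move: xp x'p; rewrite !(mem_preimages ES) => /eqP -> /eqP ->.
    have h : d y1 y2 < eps / 3 by apply: gP; rewrite gy1 gy2.
    move: xy1 xy2; rewrite !lt_min => /andP[xy1 _] /andP[xy2 _].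
    have h1 := d_tri dm y2 x' x; have h2 := d_tri dm y1 y2 x.
    rewrite (dC dm y2 y1) (dC dm y1 x) in h2; lra.
  by rewrite xx eqxx in xx'.
pose G (u : A * W) := pr mu z u / pr mu (itin phi g n \o phi) u.2.
have G0 u : 0 <= G u by rewrite divr_ge0 ?pr_ge0.
have prle u : pr mu z u <= pr mu (itin phi g n \o phi) u.2 := pr_comp_ge mu snd u mz.
have Gsum b : \sum_a G (a, b) <= 1.
  rewrite /G /= -mulr_suml (pr_marginal2 mu b mg mip).
  have [->|n0] := eqVneq (pr mu (itin phi g n \o phi) b) 0; first by rewrite mul0r ler01.
  by rewrite divff.
have G1 u : G u <= 1.
  case: u => a b; apply: le_trans (Gsum b); rewrite (bigD1 a)//= lerDl.
  exact: sumr_ge0.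
pose w x := tau + \sum_(u : A * W) G u * (pa u.1 x * pb u.2 (phi x)).
have wtau x : tau <= w x.
  by rewrite lerDl; apply: sumr_ge0 => u _; rewrite mulr_ge0 ?G0// mulr_ge0.
have w0 x : 0 < w x := lt_le_trans tau0 (wtau x).
have cw : continuous w.
  apply: contD; first exact: cst_continuous.
  apply: continuous_sum => u; apply: contZ; apply: contM.
    exact: tent_continuous.
  by apply: continuous_comp_phi; exact: tent_continuous.
exists w; split=> //.
  move=> y; rewrite (RPFE ES).
  rewrite (_ : \sum_(_ <- _) _ = \sum_(x <- preimages phi y) tau +
      \sum_(x <- preimages phi y) \sum_b \sum_a pb b y * (G (a, b) * pa a x)); last first.
    rewrite -big_split/= big_seq [RHS]big_seq; apply: eq_bigr => x.
    rewrite (mem_preimages ES) => /eqP xy; rewrite mulr1 /w; congr (_ + _).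
    rewrite exchange_big/= pair_big/=; apply: eq_bigr => -[a b] _ /=; rewrite xy; ring.
  rewrite addrC; apply: lerD.
    rewrite exchange_big/=; apply: le_trans (sumb y); apply: ler_sum => b _.
    rewrite exchange_big/=.
    apply: (@le_trans _ _ (\sum_a pb b y * G (a, b))).
      apply: ler_sum => a _; rewrite -mulr_sumr ler_wpM2l// -mulr_sumr.
      by rewrite ler_piMr.
    by rewrite -mulr_sumr ler_piMr.
  rewrite big_const_seq count_predT iter_addr addr0 -(mulr_natl tau).
  apply: (@le_trans _ _ (N.+1%:R * tau)).
    by rewrite ler_wpM2r ?(ltW tau0)// ler_nat (leq_trans (NP y)).
  rewrite mulrC -ler_pdivlMr// ge_min; apply/orP; right.
  exact: lexx.
pose B b : set (borel X) := itin phi g n @^-1` [set b] `\` K b.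
have mB b : measurable (B b) by apply: measurableD; [exact: mi|exact: closed_borel].
have bI b : bmf (fun x : borel X => \1_(B b) (phi x) : R).
  rewrite (_ : (fun x => _) = \1_(phi @^-1` B b)); first exact: bmf_indic (mphi (mB b)).
  by apply/funext => x; rewrite !indicE; congr (_%:R); apply/idP/idP => /set_mem h; apply/mem_set.
have EI b : Ex mu (fun x : borel X => \1_(B b) (phi x) : R) <= k.
  have -> : Ex mu (fun x : borel X => \1_(B b) (phi x) : R) = prob mu (B b).
    by rewrite -(Ex_indic mu (mB b)); exact: (Ex_invariant mphi inv (bmf_indic R (mB b))).
  by case: (KP b).
pose ind (x : borel X) : R := \sum_b \1_(B b) (phi x).
have [bind Eind] := Ex_sum mu (index_enum W) bI.
(* The maximum with [tau] keeps the logarithm bounded for pairs of probability zero, where [G]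
   vanishes. *)
pose F u := - ln (Num.max tau (G u)).
have F0 u : 0 <= F u by rewrite oppr_ge0 ln_le0// ge_max tau1 G1.
have ptw x : - ln (w x) <= F (z x) + M * ind x.
  set b := itin phi g n (phi x).
  have [Kx|nKx] := pselect (K b (phi x)).
    rewrite -[leLHS]addr0; apply: lerD; last first.
      by rewrite mulr_ge0//; apply: sumr_ge0 => b' _; rewrite indicE ler0n.
    rewrite lerN2 ler_ln ?posrE ?lt_max ?tau0// ge_max wtau/=.
    rewrite /w (bigD1 (z x))//= /pa /pb (tent_in dm) // (tent_in dm) // !mulr1.
    rewrite addrCA lerDl addr_ge0 ?(ltW tau0)//.
    by apply: sumr_ge0 => u _; rewrite mulr_ge0 ?G0// mulr_ge0 ?tent_ge0.
  rewrite -[leLHS]add0r; apply: lerD => //.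
  apply: (@le_trans _ _ M); first by rewrite lerN2 ler_ln ?posrE.
  rewrite ler_peMr// /ind (bigD1 b)//= indicE mem_set//= lerDl.
  by apply: sumr_ge0 => a _; rewrite indicE ler0n.
have blw := continuous_bmf dm cX (continuous_lnc cw w0).
have bF : bmf (fun x : borel X => F (z x)) := bmf_rv F mz.
rewrite -(ExN mu blw).
apply: le_trans (Ex_le mu (bmfN blw) (bmfD bF (bmfZ M bind)) ptw) _.
rewrite (ExD mu bF (bmfZ M bind)) (ExZ mu M bind) Eind (Ex_rv mu F mz).
have h1 : \sum_u pr mu z u * F u <= dent phi mu g n.
  rewrite dentE// {2}/ent -(expect_comp mu snd (fun b => - ln (pr mu (itin phi g n \o phi) b)) mz).
  rewrite -sumrB; apply: ler_sum => u _.
  have := pr_ge0 mu z u; rewrite le_eqVlt => /predU1P[<-|p0]; first by rewrite !mul0r subr0.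
  have q0 := lt_le_trans p0 (prle u).
  rewrite -mulrBr ler_wpM2l ?(ltW p0)// opprK addrC -[leRHS]opprK opprB -ln_div ?posrE//.
  rewrite lerN2 ler_ln ?posrE ?lt_max ?tau0 ?divr_gt0// le_max.
  by apply/orP; right; exact: lexx.
have h2 : \sum_b Ex mu (fun x : borel X => \1_(B b) (phi x) : R) <= e / 2 / (M + 1).
  apply: (@le_trans _ _ (\sum_(b : W) k)); first exact: ler_sum.
  by rewrite sumr_const -(mulr_natr k) -/cW /k divfK ?gt_eqF.
have h3 : M * (e / 2 / (M + 1)) <= e / 2.
  by rewrite mulrCA ler_piMr ?(ltW e20)// ler_pdivrMr// mul1r lerDl.
have h4 : entr phi mu g <= KSr.
  by rewrite -lee_fin -KSentropyE; exact: (KSentropy_ge mphi inv mg).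
have := ler_wpM2l M0 h2; lra.
Qed.

End entropy_bounds.

(** * The integral of [ln c] in the presence of zeros *)

Section log_integral.
Context (R : realType) (X : ptopologicalType) (d : X -> X -> R).
Hypothesis dm : compatible_metric d.
Hypothesis cX : compact [set: X].
Variable mu : probability (borel X) R.
Variable c : X -> R.
Hypothesis cc : continuous c.
Hypothesis c0 : forall x, 0 <= c x.

Definition Exln k := Ex mu (fun x => ln (c x + k)).

Lemma bmf_lnc k : 0 < k -> bmf (fun x : borel X => ln (c x + k)).
Proof.
move=> k0; apply: (continuous_bmf dm cX); apply: continuous_lnc.
  by apply: contD => //; exact: cst_continuous.
by move=> x; rewrite ltr_wpDl.
Qed.

Lemma Exln_mono k k' : 0 < k -> k <= k' -> Exln k <= Exln k'.
Proof.
move=> k0 kk; have k'0 := lt_le_trans k0 kk.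
apply: Ex_le; [exact: bmf_lnc|exact: bmf_lnc|move=> x].
by rewrite ler_ln ?posrE ?ltr_wpDl// lerD2l.
Qed.

Local Notation h n := (n.+1%:R^-1 : R).
Let h0 n : 0 < h n. Proof. by rewrite invr_gt0. Qed.

(** [K] bounds [ln (c + k)] from above for small [k], [Iinf] is the integral of [K - ln c], obtained
    by monotone convergence, and [P] is that of the positive part of [ln c]. Finiteness of [P] keeps
    the formula free of indeterminate differences when [Iinf] is infinite. *)
Lemma lnE_parts : exists (K : R) (Iinf P : \bar R),
  [/\ (P \is a fin_num)%E,
    (\int[mu]_(x in setT) lnE (c x) = P - (Iinf + P - K%:E))%E &
    (fun n => (K - Exln (h n))%:E) @ \oo --> Iinf /\
    forall n, ((K - Exln (h n))%:E <= Iinf)%E].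
Proof.
have [B B0 BP] := bounded_continuous dm cX cc.
pose K := ln (B + 1).
have cB x : c x <= B := le_trans (ler_norm _) (BP x).
have hle1 n : h n <= 1 by rewrite invf_le1 ?ler1n.
have lnleK n x : ln (c x + h n) <= K.
  rewrite ler_ln ?posrE; [|by rewrite ltr_wpDl|by rewrite addr_gt0].
  by apply: lerD.
have K0 : 0 <= K by rewrite ln_ge0// lerDr ltW.
pose F n (x : borel X) : \bar R := (K - ln (c x + h n))%:E.
pose G (x : borel X) : \bar R := (K%:E - lnE (c x))%E.
have F0 n x : (0 <= F n x)%E by rewrite lee_fin subr_ge0.
have bF n : bmf (fun x : borel X => K - ln (c x + h n)).
  by apply: bmfD; [exact: bmf_cst|apply: bmfN; exact: bmf_lnc].
have mF n : measurable_fun setT (F n) by apply/measurable_EFinP; case: (bF n).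
have ndF x n m : (n <= m)%N -> (F n x <= F m x)%E.
  move=> nm; rewrite lee_fin lerB// ler_ln ?posrE ?ltr_wpDl//.
  by rewrite lerD2l lef_pV2 ?posrE// ler_nat.
have GNy x : c x <= 0 -> G x = +oo%E by move=> cx; rewrite /G /lnE cx.
have GE x : ~~ (c x <= 0) -> G x = (K - ln (c x))%:E by move=> cx; rewrite /G /lnE (negbTE cx).
have FG x : F ^~ x @ \oo --> G x.
  have [cx|cx] := boolP (c x <= 0).
    rewrite (GNy _ cx) /F; have -> : c x = 0 by apply/le_anti; rewrite cx c0.
    apply/cvgeyPge => A.
    near=> n; rewrite lee_fin add0r lnV ?posrE// opprK.
    rewrite -lerBlDl -ler_expR lnK ?posrE//.
    have : n%:R >= expR (A - K) by near: n; exact: nbhs_infty_ger.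
    by move/le_trans; apply; rewrite ler_nat.
  rewrite (GE _ cx); rewrite -ltNge in cx.
  apply: cvg_EFin; first exact: nearW.
  apply: (@cvgB _ R^o); first exact: cvg_cst.
  apply: continuous_cvg; first exact: continuous_ln.
  rewrite -[X in _ --> X]addr0; apply: cvgD; first exact: cvg_cst.
  exact: cvg_harmonic.
have FleG n x : (F n x <= G x)%E.
  have [cx|cx] := boolP (c x <= 0); first by rewrite (GNy _ cx) leey.
  rewrite (GE _ cx) lee_fin lerB//; rewrite -ltNge in cx.
  by rewrite ler_ln ?posrE ?addr_gt0// lerDl ltW.
have G0 x : (0 <= G x)%E := le_trans (F0 0%N x) (FleG 0%N x).
have mG : measurable_fun setT G by apply: (emeasurable_fun_cvg F) => // x _; exact: FG.
have fG x : lnE (c x) = (K%:E - G x)%E.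
  by rewrite /G /lnE; case: ifP => // _; rewrite -!EFinB; congr _%:E; ring.
have mf : measurable_fun setT (fun x : borel X => lnE (c x)).
  rewrite (_ : (fun x => _) = fun x => (K%:E - G x)%E); last exact/funext.
  by apply: emeasurable_funB => //; exact: measurable_cst.
pose f (x : borel X) := lnE (c x).
have IF n : (\int[mu]_x F n x = (K - Exln (h n))%:E)%E.
  rewrite (ExE mu (bF n)) (ExD mu (bmf_cst _ K) (bmfN (bmf_lnc (h0 n)))).
  by rewrite (ExN mu (bmf_lnc (h0 n))) (Ex_cst mu K).
exists K, (\int[mu]_x G x)%E, (\int[mu]_x (f^\+ x))%E.
have fpK x : (f^\+ x <= K%:E)%E.
  rewrite funeposE /f ge_max lee_fin K0 andbT /lnE; case: ifPn => cx; first exact: leNye.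
  rewrite -ltNge in cx; rewrite lee_fin ler_ln ?posrE ?addr_gt0//.
  by apply: le_trans (cB x) _; rewrite lerDl.
have fp0 x : (0 <= f^\+ x)%E := funepos_ge0 f x.
have mfp := measurable_funepos mf.
have Pfin : (\int[mu]_x (f^\+ x) \is a fin_num)%E.
  rewrite ge0_fin_numE; last exact: integral_ge0.
  apply: (@le_lt_trans _ _ (\int[mu]_x (K%:E))%E).
    exact: ge0_le_integral.
  by rewrite (ExE mu (bmf_cst _ K)) ltry.
split=> //.
  rewrite integralE -/f.
  (* [G = K - f] is rearranged so that only nonnegative functions are integrated. *)
  have E : (\int[mu]_x G x + \int[mu]_x (f^\+ x) = K%:E + \int[mu]_x (f^\- x))%E.
    rewrite -(ge0_integralD mu measurableT (fun x _ => G0 x) mG (fun x _ => fp0 x) mfp).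
    rewrite -(Ex_cst mu K) -(ExE mu (bmf_cst _ K)) -ge0_integralD//; [|exact/measurable_EFinP/measurable_cst|exact: measurable_funeneg].
    apply: eq_integral => x _; rewrite funeposE funenegE /f /G /lnE.
    case: ifPn => _ /=; first by rewrite (max_idPr (leNye 0)) (max_idPl (leey 0)).
    rewrite -!EFin_max -!EFinD; congr _%:E.
    by case: (lerP (ln (c x)) 0); case: (lerP (- ln (c x)) 0); lra.
  rewrite E; congr (_ - _)%E.
  by rewrite addeAC subee ?add0e.
split; last by move=> n; rewrite -IF; apply: ge0_le_integral.
have := @cvg_monotone_convergence _ _ R mu setT measurableT F mF (fun n x _ => F0 n x)
  (fun x _ n m nm => ndF x n m nm).
rewrite (_ : (fun n => _) = fun n => (K - Exln (h n))%:E); last by apply/funext.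
rewrite (_ : (\int[mu]_(x in setT) _)%E = (\int[mu]_x G x)%E)//.
by apply: eq_integral => x _; apply: cvg_lim => //; exact: FG.
Unshelve. all: by end_near.
Qed.

Lemma integral_lnE_le k : 0 < k -> (\int[mu]_(x in setT) lnE (c x) <= (Exln k)%:E)%E.
Proof.
move=> k0; have [K [I [P [Pfin -> [_ HI]]]]] := lnE_parts.
have [n nk] : exists n, h n <= k.
  exists (Num.truncn k^-1); rewrite -[leRHS]invrK lef_pV2 ?posrE ?invr_gt0//.
  by rewrite ltW// truncnS_gt.
apply: (@le_trans _ _ (Exln (h n))%:E); last by rewrite lee_fin Exln_mono.
have := HI n; rewrite -(fineK Pfin); case: I {HI} => [r| |] //=.
  by rewrite !lee_fin; lra.
by move=> _; exact: leNye.
Qed.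

Lemma integral_lnE_ge r : (forall k, 0 < k -> r <= Exln k) ->
  (r%:E <= \int[mu]_(x in setT) lnE (c x))%E.
Proof.
move=> H; have [K [I [P [Pfin -> [cI HI]]]]] := lnE_parts.
have IK : (I <= (K - r)%:E)%E.
  rewrite -(cvg_lim (@ereal_hausdorff R) cI).
  apply: lime_le; first by apply/cvg_ex; exists I.
  by apply: nearW => n; rewrite lee_fin lerB// H.
have := HI 0%N; rewrite -(fineK Pfin); case: I IK {HI cI} => [s| |] //=.
by rewrite !lee_fin; lra.
Qed.

End log_integral.

(** * Equilibrium functionals *)

Section ultralimit.
Context (R : realType) (U : set_system nat).
Hypothesis UU : UltraFilter U.
Hypothesis Uoo : \oo `<=` U.

Lemma ultra_bounded_cvg (u : nat -> R) M : (forall n, `|u n| <= M) -> cvg (u @ U).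
Proof.
move=> uM; have FF : ProperFilter (u @ U) by exact: fmap_proper_filter.
have cM := @segment_compact R (- M) M.
have [|p [_ clp]] := cM (u @ U) FF.
  rewrite /nbhs /=; apply: (@filterS _ _ _ setT); last exact: filterT.
  by move=> n _ /=; rewrite in_itv/= -ler_norml.
apply/cvg_ex; exists p => V nV; rewrite /nbhs /=.
have [//|UV] := in_ultra_setVsetC (u @^-1` V) UU.
have [q [q1 q2]] := clp (~` V) V UV nV.
by have := q1 q2.
Qed.

Definition ulim (u : nat -> R) : R := lim (u @ U).

Lemma ulimP (u : nat -> R) M : (forall n, `|u n| <= M) -> u @ U --> ulim u.
Proof. by move=> uM; exact: (ultra_bounded_cvg uM). Qed.

Lemma ulim_unique (u : nat -> R) (a : R) : u @ U --> a -> ulim u = a.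
Proof. by move=> ua; apply: cvg_lim => //; exact: Rhausdorff. Qed.

Lemma ulimD (u v : nat -> R) M N : (forall n, `|u n| <= M) -> (forall n, `|v n| <= N) ->
  ulim (fun n => u n + v n) = ulim u + ulim v.
Proof.
by move=> uM vN; apply: ulim_unique; apply: cvgD; [exact: ulimP uM|exact: ulimP vN].
Qed.

Lemma ulimZ a (u : nat -> R) M : (forall n, `|u n| <= M) ->
  ulim (fun n => a * u n) = a * ulim u.
Proof. by move=> uM; apply: ulim_unique; apply: cvgMl_tmp; exact: ulimP uM. Qed.

Lemma ulim_le (u v : nat -> R) M (a : R) J : (forall n, `|u n| <= M) -> v @ \oo --> a ->
  (forall n, (J <= n)%N -> u n <= v n) -> ulim u <= a.
Proof.
move=> uM va uv; have va' : v @ U --> a by move=> V nV; apply: Uoo; exact: va.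
apply: (ler_cvg_to (ulimP uM) va'); apply: Uoo; exists J => // n /= Jn; exact: uv.
Qed.

Lemma ulim_ge (u v : nat -> R) M (a : R) J : (forall n, `|u n| <= M) -> v @ \oo --> a ->
  (forall n, (J <= n)%N -> v n <= u n) -> a <= ulim u.
Proof.
move=> uM va uv; have va' : v @ U --> a by move=> V nV; apply: Uoo; exact: va.
apply: (ler_cvg_to va' (ulimP uM)); apply: Uoo; exists J => // n /= Jn; exact: uv.
Qed.

End ultralimit.

Lemma free_ultrafilter : exists U : set_system nat, UltraFilter U /\ \oo `<=` U.
Proof. exact: ultraFilterLemma. Qed.

Section state_limits.
Context (R : realType) (X : ptopologicalType) (d : X -> X -> R).
Hypothesis dm : compatible_metric d.
Hypothesis cX : compact [set: X].
Variable U : set_system nat.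
Hypothesis UU : UltraFilter U.
Hypothesis Uoo : \oo `<=` U.

Lemma state_bound (l : (X -> R) -> R) (f : X -> R) M : state l -> continuous f ->
  (forall x, `|f x| <= M) -> `|l f| <= M.
Proof.
move=> sl cf fM; rewrite ler_norml; apply/andP; split.
  rewrite -(state_cst sl (- M)); apply: (state_le sl) => //; first exact: cst_continuous.
  by move=> x; have := fM x; rewrite ler_norml => /andP[].
rewrite -(state_cst sl M); apply: (state_le sl) => //; first exact: cst_continuous.
by move=> x; have := fM x; rewrite ler_norml => /andP[].
Qed.

Variable l : nat -> (X -> R) -> R.
Hypothesis sl : forall j, state (l j).

Definition state_ulim (f : X -> R) : R := ulim U (fun j => l j f).

Lemma state_seq_bound (f : X -> R) : continuous f -> exists M, forall j, `|l j f| <= M.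
Proof.
move=> cf; have [M _ MP] := bounded_continuous dm cX cf.
by exists M => j; exact: state_bound.
Qed.

Lemma state_ulim_state : state state_ulim.
Proof.
split=> [f g cf cg|a f cf|f cf f0|].
- have [M MP] := state_seq_bound cf; have [N NP] := state_seq_bound cg.
  rewrite /state_ulim -(ulimD UU MP NP); congr ulim; apply/funext => j.
  exact: (stateD (sl j)).
- have [M MP] := state_seq_bound cf.
  rewrite /state_ulim -(ulimZ UU a MP); congr ulim; apply/funext => j.
  exact: (stateZ (sl j)).
- have [M MP] := state_seq_bound cf.
  apply: (ulim_ge UU Uoo (v := cst 0) (J := 0%N) MP); first exact: cvg_cst.
  by move=> j _; exact: (state_ge0 (sl j)).
apply: (ulim_unique UU); rewrite (_ : (fun j => _) = cst 1); first exact: cvg_cst.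
by apply/funext => j; exact: (state1 (sl j)).
Qed.

End state_limits.

Section equilibrium_functionals.
Context (R : realType) (X : ptopologicalType) (phi : X -> X)
  (d : X -> X -> R) (eps theta : R).
Hypothesis ES : expanding_system phi d eps theta.
Let dm := es_metric ES.
Let cX := es_compact ES.
Variable c : X -> R.
Hypothesis cc : continuous c.
Hypothesis c_ge0 : forall x, 0 <= c x.
Local Notation L := (RPF phi c).
Local Notation r0 := (growth_rate phi c).
Hypothesis r0_gt0 : 0 < r0.

(* l is a subgradient at 0 of the convex function g |-> ln (spectral radius of L_(c e^g)) *)
Definition subgradient (l : (X -> R) -> R) := forall (g : X -> R) lam, continuous g -> 0 < lam ->
  (forall y, RPF phi (fun x => c x * expR (g x)) (cst 1) y <= lam) -> l g <= ln lam - ln r0.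

(** All three conditions are equalities or weak inequalities between values of [l], hence survive
    pointwise limits. *)
Record equilibrium_functional (l : (X -> R) -> R) : Prop := EquilibriumFunctional {
  ef_state : state l;
  ef_invariant : forall g : X -> R, continuous g -> l (fun x => g (phi x)) = l g;
  ef_subgradient : subgradient l }.

Lemma eq_iter_RPF n (f g : X -> R) y : f =1 g -> iter n L f y = iter n L g y.
Proof. by move=> /funext ->. Qed.

Definition birkhoff (g : X -> R) n x := \sum_(i < n) g (iter i phi x).

Lemma birkhoffS g n x : birkhoff g n.+1 x = g x + birkhoff g n (phi x).
Proof.
by rewrite /birkhoff big_ord_recl; congr (_ + _); apply: eq_bigr => i _; rewrite -iterSr.
Qed.

Lemma birkhoff_phi g n x : birkhoff (fun z => g (phi z)) n x - birkhoff g n x =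
  g (iter n phi x) - g x.
Proof.
elim: n => [|n IH]; first by rewrite /birkhoff !big_ord0 !subrr.
rewrite /birkhoff !big_ord_recr/= -!/(birkhoff _ _ _).
by rewrite opprD addrACA IH; ring.
Qed.

Lemma iter_RPF_exp g n (f : X -> R) y :
  iter n L (fun x => expR (birkhoff g n x) * f x) y =
  iter n (RPF phi (fun x => c x * expR (g x))) f y.
Proof.
elim: n f y => [|n IH] f y.
  by rewrite /= /birkhoff big_ord0 expR0 mul1r.
rewrite !iterSr -IH; apply: eq_iter_RPF => z.
rewrite (RPF_weightM ES) -(RPF_pullback ES c _ (fun z => expR (birkhoff g n z))).
rewrite !(RPFE ES); apply: eq_bigr => x _.
by rewrite birkhoffS expRD; ring.
Qed.

(** The points of the [n]-th preimage of [y], weighted by [L^n] and normalised, carry a probability;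
    this is the mean under it of the average of [g] along the first [n] orbit points. *)
Definition gibbs_average n y (g : X -> R) : R :=
  iter n L (birkhoff g n) y / (n%:R * iter n L (cst 1) y).

Section gibbs_average.
Variables (n : nat) (y : X).
Hypothesis n0 : (0 < n)%N.
Hypothesis L0 : 0 < iter n L (cst 1) y.

Let nL0 : 0 < n%:R * iter n L (cst 1) y.
Proof. by rewrite mulr_gt0// ltr0n. Qed.

Lemma gibbs_average_state : state (gibbs_average n y).
Proof.
split=> [f g cf cg|a f cf|f cf f0|].
- rewrite /gibbs_average -mulrDl -(iter_RPFD ES); congr (_ / _).
  by apply: eq_iter_RPF => x; rewrite /birkhoff -big_split.
- rewrite /gibbs_average mulrA -(iter_RPFZ ES c n (birkhoff f n)); congr (_ / _).
  by apply: eq_iter_RPF => x; rewrite /birkhoff mulr_sumr.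
- rewrite divr_ge0 ?(ltW nL0)// (iter_RPF_ge0 ES)// => x.
  exact: sumr_ge0.
rewrite /gibbs_average (_ : birkhoff _ _ = fun x => n%:R * cst 1 x).
  by rewrite (iter_RPFZ ES) divff// gt_eqF.
by apply/funext => x; rewrite /birkhoff sumr_const card_ord mulr1.
Qed.

Lemma gibbs_average_phi (g : X -> R) M : continuous g -> (forall x, `|g x| <= M) ->
  `|gibbs_average n y (fun x => g (phi x)) - gibbs_average n y g| <= 2 * M / n%:R.
Proof.
move=> cg gM; rewrite /gibbs_average -mulrBl.
have -> : iter n L (birkhoff (fun x => g (phi x)) n) y - iter n L (birkhoff g n) y =
    iter n L (fun x => g (iter n phi x) - g x) y.
  rewrite -[X in _ - X]mul1r -mulNr -(iter_RPFZ ES) -(iter_RPFD ES).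
  by apply: eq_iter_RPF => x; rewrite mulN1r birkhoff_phi.
rewrite normrM normfV (ger0_norm (ltW nL0)) ler_pdivrMr//.
rewrite mulrA divfK ?pnatr_eq0 -?lt0n//.
apply: (iter_RPF_bound ES) => // x.
apply: le_trans (ler_normB _ _) _; have := gM x; have := gM (iter n phi x); lra.
Qed.

(* Jensen's inequality in the form exp S >= exp m (1 + S - m), with m the mean of S. *)
Lemma gibbs_average_subgradient (g : X -> R) lam : continuous g -> 0 < lam ->
  (forall y, RPF phi (fun x => c x * expR (g x)) (cst 1) y <= lam) ->
  gibbs_average n y g <= ln lam - ln (iter n L (cst 1) y) / n%:R.
Proof.
move=> cg lam0 Hlam; pose m := n%:R * gibbs_average n y g.
have nR0 : 0 < n%:R :> R by rewrite ltr0n.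
have mE : iter n L (birkhoff g n) y = m * iter n L (cst 1) y.
  by rewrite /m /gibbs_average; field; rewrite !gt_eqF.
have h1 : expR m * iter n L (cst 1) y <= iter n L (fun x => expR (birkhoff g n x) * cst 1 x) y.
  have -> : expR m * iter n L (cst 1) y =
      iter n L (fun x => (expR m * (1 - m)) * cst 1 x + expR m * birkhoff g n x) y.
    by rewrite (iter_RPFD ES) !(iter_RPFZ ES) mE; ring.
  apply: (iter_RPF_le ES) => // x /=; rewrite !mulr1 -mulrDr.
  have -> : expR (birkhoff g n x) = expR m * expR (birkhoff g n x - m).
    by rewrite -expRD addrCA subrr addr0.
  rewrite ler_wpM2l ?expR_ge0//; have := expR_ge1Dx (birkhoff g n x - m); lra.
rewrite iter_RPF_exp in h1.
have h2 : iter n (RPF phi (fun x => c x * expR (g x))) (cst 1) y <= lam ^+ n.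
  rewrite -[leRHS]mulr1; apply: (@iter_RPF_supersolution _ _ _ _ _ _ ES _ _ (cst 1)) => //.
  - by move=> x; rewrite mulr_ge0// expR_ge0.
  - exact: ltW.
  - by move=> z; rewrite mulr1.
have h3 := le_trans h1 h2.
have : ln (expR m * iter n L (cst 1) y) <= ln (lam ^+ n).
  by rewrite ler_ln ?posrE ?mulr_gt0 ?expR_gt0 ?exprn_gt0.
rewrite lnM ?posrE ?expR_gt0// expRK lnXn// -(mulr_natl (ln lam)) => h4.
have E : n%:R * (ln lam - ln (iter n L (cst 1) y) / n%:R) =
    n%:R * ln lam - ln (iter n L (cst 1) y) by field; rewrite gt_eqF.
rewrite -(ler_pM2l nR0) E -/m; lra.
Qed.

End gibbs_average.

Variable U : set_system nat.
Hypothesis UU : UltraFilter U.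
Hypothesis Uoo : \oo `<=` U.

Lemma equilibrium_functional_ulim (l : nat -> (X -> R) -> R) J :
  (forall j, state (l j)) -> (forall j, (J <= j)%N -> equilibrium_functional (l j)) ->
  equilibrium_functional (state_ulim U l).
Proof.
move=> sl el; split.
- exact: (state_ulim_state dm cX UU Uoo sl).
- move=> g cg; have cgp := continuous_comp_phi ES cg.
  have [M MP] := state_seq_bound dm cX sl cg.
  apply: (ulim_unique UU) => V nV.
  have := ulimP UU MP nV; rewrite /nbhs /= => h.
  have hJ : U [set j | (J <= j)%N] by apply: Uoo; exact: nbhs_infty_ge.
  apply: filterS (filterI h hJ) => j [/= Vj Jj].
  by rewrite (ef_invariant (el j Jj) cg).
move=> g lam cg lam0 H; have [M MP] := state_seq_bound dm cX sl cg.
apply: (ulim_le UU Uoo (v := cst (ln lam - ln r0)) (J := J) MP); first exact: cvg_cst.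
by move=> j /el /ef_subgradient; apply.
Qed.

Lemma equilibrium_functional_exists : exists l, equilibrium_functional l.
Proof.
(* Positive parameters increasing to [r0]. Below [r0] there are arbitrarily long times [n] with
   [L^n 1 > lam^n] at some point [y], which makes the bound [- ln (L^n 1 y) / n] tend to at most
   [- ln r0]. *)
pose lam (j : nat) : R := r0 * (1 - j.+2%:R^-1).
have hj j : 0 < (1 - j.+2%:R^-1 : R) < 1.
  by rewrite subr_gt0 gtrBl invr_gt0 ltr0Sn andbT invf_lt1 ?ltr0Sn// ltr1n.
have lam0 j : 0 < lam j by rewrite mulr_gt0//; case/andP: (hj j).
have lamr j : lam j < r0 by rewrite gtr_pMr//; case/andP: (hj j).
have /choice[n /choice[y H]] j := growth_rate_gt ES cc c_ge0 j.+1 (lam0 j) (lamr j).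
have n0 j : (0 < n j)%N by case: (H j) => h _; exact: leq_ltn_trans h.
have nR0 j : 0 < (n j)%:R :> R by rewrite ltr0n.
have L0 j : 0 < iter (n j) L (cst 1) (y j).
  by case: (H j) => _; apply: le_lt_trans; rewrite exprn_ge0// ltW.
pose l j := gibbs_average (n j) (y j).
have sl j : state (l j) by exact: gibbs_average_state.
have lncvg : (fun j => ln (lam j)) @ \oo --> ln r0.
  apply: continuous_cvg; first exact: continuous_ln.
  rewrite -[X in _ --> X]mulr1; apply: cvgMl_tmp; rewrite -[X in _ --> X]subr0.
  apply: cvgB; first exact: cvg_cst.
  have := @cvg_harmonic R; rewrite -(cvg_shiftS (@harmonic R : nat -> R^o)); exact.
have lnlam j : ln (lam j) <= ln (iter (n j) L (cst 1) (y j)) / (n j)%:R.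
  rewrite ler_pdivlMr// mulr_natr -lnXn//.
  by rewrite ler_ln ?posrE ?exprn_gt0//; case: (H j) => _ /ltW.
exists (state_ulim U l); split.
- exact: (state_ulim_state dm cX UU Uoo sl).
- move=> g cg; have cgp := continuous_comp_phi ES cg.
  have [M M0 MP] := bounded_continuous dm cX cg.
  have [B BP] := state_seq_bound dm cX sl cg.
  have [B' BP'] := state_seq_bound dm cX sl cgp.
  have hn j : `|l j (fun x => g (phi x)) - l j g| <= 2 * M / j.+1%:R.
    apply: le_trans (gibbs_average_phi (n0 j) (L0 j) cg MP) _.
    rewrite ler_wpM2l ?mulr_ge0 ?(ltW M0)// lef_pV2 ?posrE// ler_nat.
    by case: (H j).
  have c0 : (fun j : nat => 2 * M / j.+1%:R) @ \oo --> (0 : R).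
    by rewrite -[X in _ --> X](mulr0 (2 * M)); apply: cvgMl_tmp; exact: cvg_harmonic.
  have bd j : `|l j (fun x => g (phi x)) + (- 1) * l j g| <= B' + B.
    by rewrite mulN1r; apply: le_trans (ler_normB _ _) _; exact: lerD.
  have Bm j : `|(-1) * l j g| <= B by rewrite mulN1r normrN.
  have E : ulim U (fun j => l j (fun x => g (phi x)) + (-1) * l j g) =
      state_ulim U l (fun x => g (phi x)) - state_ulim U l g.
    by rewrite (ulimD UU BP' Bm) (ulimZ UU _ BP) mulN1r.
  apply/eqP; rewrite -subr_eq0 -E; apply/eqP/le_anti/andP; split.
    apply: (ulim_le UU Uoo (J := 0%N) bd c0) => j _.
    by rewrite mulN1r; apply: le_trans (hn j); exact: ler_norm.
  have c0' : (fun j : nat => - (2 * M / j.+1%:R)) @ \oo --> (0 : R).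
    by rewrite -[X in _ --> X]oppr0; apply: cvgN.
  apply: (ulim_ge UU Uoo (J := 0%N) bd c0') => j _.
  by rewrite mulN1r; have := hn j; rewrite ler_norml => /andP[].
move=> g la cg la0 Hla; have [B BP] := state_seq_bound dm cX sl cg.
have cv : (fun j => ln la - ln (lam j)) @ \oo --> ln la - ln r0.
  by apply: cvgB => //; exact: cvg_cst.
apply: (ulim_le UU Uoo (J := 0%N) BP cv) => j _.
apply: le_trans (gibbs_average_subgradient (n0 j) (L0 j) cg la0 Hla) _.
by rewrite lerB.
Qed.

End equilibrium_functionals.

Lemma Ex_state (R : realType) (X : ptopologicalType) (d : X -> X -> R)
  (mu : probability (borel X) R) : compatible_metric d -> compact [set: X] ->
  state (fun f : X -> R => Ex mu f).
Proof.
move=> dm cX; split=> [f g cf cg|a f cf|f cf f0|].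
- by rewrite -ExD//; exact: (continuous_bmf dm cX).
- by rewrite -ExZ//; exact: (continuous_bmf dm cX).
- rewrite -[leLHS](Ex_cst mu 0); apply: Ex_le => //; first exact: bmf_cst.
  exact: (continuous_bmf dm cX).
exact: Ex_cst.
Qed.

Section equilibrium_measures.
Context (R : realType) (X : ptopologicalType) (phi : X -> X)
  (d : X -> X -> R) (eps theta : R).
Hypothesis ES : expanding_system phi d eps theta.
Let dm := es_metric ES.
Let cX := es_compact ES.
Let mphi := continuous_borel_map (es_continuous ES).
Variable c : X -> R.
Hypothesis cc : continuous c.
Hypothesis c_ge0 : forall x, 0 <= c x.
Local Notation r0 := (growth_rate phi c).

Section one_measure.
Variable mu : probability (borel X) R.
Hypothesis inv : phi_invariant phi mu.

Lemma entropy_le_growth lam : r0 < lam ->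
  exists2 k0 : R, 0 < k0 & forall k, 0 < k -> k <= k0 ->
    KSr phi mu + Exln mu c k <= ln lam.
Proof.
move=> rl; pose l1 := (r0 + lam) / 2.
have rge0 := growth_rate_ge0 ES cc c_ge0.
have rl1 : r0 < l1 by rewrite /l1; lra.
have [u [cu u1 Lu]] := supersolution ES cc c_ge0 rl1.
have [|||y|k0 k00 H] := @entropy_le_perturbed _ _ _ _ _ _ ES mu inv c (cst 0) u l1 lam cc c_ge0
  _ cu u1 _ _ _.
- exact: cst_continuous.
- by rewrite /l1; lra.
- by rewrite /l1; lra.
- rewrite (_ : (fun x => _) = c); first exact: Lu.
  by apply/funext => x; rewrite /= expR0 mulr1.
exists k0 => // k kp kk; have := H k kp kk.
by rewrite (Ex_cst mu 0) addr0.
Qed.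

Lemma pressure_le lam : r0 < lam -> (pressure_fun phi c mu <= (ln lam)%:E)%E.
Proof.
move=> /entropy_le_growth[k k0 H]; have := H k k0 (lexx _); rewrite -lee_fin => h.
apply: le_trans h; rewrite /pressure_fun (KSentropyE ES inv) addeC EFinD leeD2l//.
exact: (integral_lnE_le dm cX).
Qed.

Lemma pressure_le_lnE : (pressure_fun phi c mu <= lnE r0)%E.
Proof.
have rge0 := growth_rate_ge0 ES cc c_ge0; rewrite /lnE; case: ifPn => [r0le|].
  have r00 : r0 = 0 by apply/le_anti; rewrite r0le rge0.
  (* With growth rate 0 every [lam = expR e] is admissible, which forces the pressure to be
     [-oo]. *)
  have H (e : R) : (pressure_fun phi c mu <= e%:E)%E.
    rewrite -(expRK e); apply: pressure_le; rewrite r00; exact: expR_gt0.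
  case: (pressure_fun phi c mu) H => [r| |] H //.
    by have := H (r - 1)%R; rewrite lee_fin lerBrDr gerDl ler10.
  by have := H 0%R.
rewrite -ltNge => r0p; apply/lee_addgt0Pr => e e0.
rewrite -EFinD -(expRK e) -lnM ?posrE ?expR_gt0//; apply: pressure_le.
by rewrite ltr_pMr// -[ltLHS]expR0 ltr_expR.
Qed.

Hypothesis r0_gt0 : 0 < r0.

Lemma subgradient_entropy : subgradient phi c (fun f : X -> R => Ex mu f) ->
  forall k, 0 < k -> ln r0 <= KSr phi mu + Exln mu c k.
Proof.
move=> sub k k0; apply/ler_addgt0Pr => e e0.
have e20 : 0 < e / 2 by rewrite divr_gt0.
have [w [cw w0 w1 wh]] := entropy_ge_weight ES inv e20.
have ck : continuous (fun x => c x + k) by apply: contD => //; exact: cst_continuous.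
have ck0 x : 0 < c x + k by rewrite ltr_wpDl.
have clw := continuous_lnc cw w0; have clck := continuous_lnc ck ck0.
pose g x := ln (w x) + (- 1) * ln (c x + k).
have cg : continuous g by apply: contD => //; exact: contZ.
have l0 : 0 < 1 + e / 2 by rewrite addr_gt0.
have := sub g (1 + e / 2) cg l0.
have bw := continuous_bmf dm cX clw; have bck := continuous_bmf dm cX clck.
rewrite (ExD mu bw (bmfZ (-1) bck)) (ExZ mu (-1) bck) mulN1r => H.
have {}H : Ex mu (fun x => ln (w x)) - Exln mu c k <= ln (1 + e / 2) - ln r0.
  (* Here [c e^g = w c / (c + k) <= w], so the bound for [w] serves as the parameter in the
     subgradient inequality. *)
  apply: H => y; apply: le_trans (w1 y); rewrite !(RPFE ES); apply: ler_sum => x _.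
  rewrite !mulr1 /g mulN1r expRD lnK ?posrE// expRN lnK ?posrE//.
  rewrite mulrCA ler_piMr ?(ltW (w0 x))// ler_pdivrMr// mul1r lerDl; exact: ltW.
have : ln (1 + e / 2) <= e / 2 by apply: le_ln1Dx; lra.
lra.
Qed.

Lemma pressure_ge : (forall k, 0 < k -> ln r0 <= KSr phi mu + Exln mu c k) ->
  pressure_fun phi c mu = lnE r0.
Proof.
move=> H; apply/le_anti; rewrite pressure_le_lnE/=.
rewrite /lnE (leNgt r0) r0_gt0/= /pressure_fun (KSentropyE ES inv).
rewrite -leeBlDr// -EFinB; apply: (integral_lnE_ge dm cX cc c_ge0) => k k0.
by rewrite lerBlDl H.
Qed.

End one_measure.

Section mixture.
Variables (mu mu1 mu2 : probability (borel X) R) (t : R).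
Hypotheses (inv : phi_invariant phi mu) (inv1 : phi_invariant phi mu1)
  (inv2 : phi_invariant phi mu2).
Hypotheses (t0 : 0 < t) (t1 : t < 1).
Hypothesis mix : forall A : set (borel X), measurable A ->
  prob mu A = t * prob mu1 A + (1 - t) * prob mu2 A.

Let s0 : 0 < 1 - t. Proof. by rewrite subr_gt0. Qed.

Lemma KSr_mix : KSr phi mu <= t * KSr phi mu1 + (1 - t) * KSr phi mu2.
Proof.
rewrite -lee_fin -(KSentropyE ES inv); apply: (KSentropy_le mphi inv) => T g mg.
apply: le_trans (entr_mix mphi inv inv1 inv2 t0 t1 mix mg) _.
have h (nu : probability (borel X) R) : phi_invariant phi nu -> entr phi nu g <= KSr phi nu.
  by move=> nui; rewrite -lee_fin -(KSentropyE ES nui); exact: (KSentropy_ge mphi nui mg).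
by apply: lerD; rewrite ler_wpM2l ?(ltW t0) ?(ltW s0)// h.
Qed.

(** [f] is uniformly approximated by a function constant on the cells of a fine partition, for which
    the identity is a finite sum. *)
Lemma Ex_mix (f : X -> R) : continuous f -> Ex mu f = t * Ex mu1 f + (1 - t) * Ex mu2 f.
Proof.
move=> cf; have bf := continuous_bmf dm cX cf.
suff H (e : R) : 0 < e -> `|Ex mu f - (t * Ex mu1 f + (1 - t) * Ex mu2 f)| <= e.
  apply/eqP; rewrite -subr_eq0 -normr_eq0; apply/eqP/le_anti; rewrite normr_ge0 andbT.
  by apply/ler_addgt0Pr => e e0; rewrite add0r; exact: H.
move=> e0; have e20 : 0 < e / 2 by rewrite divr_gt0.
have [r rgt0 rP] := dunif_continuous dm cX cf e20.
have [T [q [mq qP]]] := fine_partition dm cX rgt0.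
have /choice[z zP] : forall a : T, exists z, forall x, q x = a -> q z = a.
  move=> a; have [[z za]|H] := pselect (exists z, q z = a); first by exists z.
  by exists point => x xa; exfalso; apply: H; exists x.
pose F a := f (z a).
have Fq x : `|f x - F (q x)| <= e / 2.
  by apply/ltW/rP/qP; rewrite (zP (q x) x).
have bF : bmf (fun x : borel X => F (q x)) := bmf_rv F mq.
have close (nu : probability (borel X) R) : `|Ex nu f - \sum_a pr nu q a * F a| <= e / 2.
  rewrite -(Ex_rv nu F mq) ler_norml; apply/andP; split.
    rewrite lerBrDl -(Ex_cst nu (- (e / 2))) -(ExD nu bF (bmf_cst _ _)).
    apply: Ex_le => //; first by apply: bmfD => //; exact: bmf_cst.
    by move=> x; have := Fq x; rewrite ler_norml /= => /andP[]; lra.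
  rewrite lerBlDl -[X in _ <= _ + X](Ex_cst nu) -(ExD nu bF (bmf_cst _ _)).
  apply: Ex_le => //; first by apply: bmfD => //; exact: bmf_cst.
  by move=> x; have := Fq x; rewrite ler_norml /= => /andP[]; lra.
have E : \sum_a pr mu q a * F a =
    t * (\sum_a pr mu1 q a * F a) + (1 - t) * (\sum_a pr mu2 q a * F a).
  rewrite !mulr_sumr -big_split/=; apply: eq_bigr => a _.
  by rewrite /pr mix//; ring.
have c0 := close mu; have c1 := close mu1; have c2 := close mu2.
have -> : Ex mu f - (t * Ex mu1 f + (1 - t) * Ex mu2 f) =
    (Ex mu f - \sum_a pr mu q a * F a) - (t * (Ex mu1 f - \sum_a pr mu1 q a * F a) +
      (1 - t) * (Ex mu2 f - \sum_a pr mu2 q a * F a)) by rewrite E; ring.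
apply: le_trans (ler_normB _ _) _; rewrite (splitr e); apply: lerD => //.
apply: le_trans (ler_normD _ _) _; rewrite !normrM (gtr0_norm t0) (gtr0_norm s0).
have h1 := ler_wpM2l (ltW t0) c1; have h2 := ler_wpM2l (ltW s0) c2; lra.
Qed.

Hypothesis r0_gt0 : 0 < r0.

(* Entropy is affine, so an equilibrium mixture forces both components to be extremal: perturb
   the weight by g for mu1 only and use the unperturbed upper bound for mu2. *)
Lemma entropy_mix_subgradient :
  (forall k, 0 < k -> ln r0 <= KSr phi mu + Exln mu c k) ->
  subgradient phi c (fun f : X -> R => Ex mu1 f).
Proof.
move=> Heq g lam cg lam0 Hlam; apply/ler_addgt0Pr => e e0.
(* The weighted errors of the two components add up to [e'], and the final inequality is divided by
   [t]. *)
pose e' := e * t; have e'0 : 0 < e' by rewrite mulr_gt0.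
have ex1 : 1 < expR e' by rewrite -[ltLHS]expR0 ltr_expR.
have [k1 k10 H1] := @entropy_le_perturbed _ _ _ _ _ _ ES mu1 inv1 c g (cst 1) lam (lam * expR e')
  cc c_ge0 cg (@cst_continuous X R 1) (fun=> lexx _) (ltW lam0) ltac:(by rewrite ltr_pMr)
  ltac:(by move=> y; rewrite mulr1).
have [|k2 k20 H2] := @entropy_le_growth mu2 inv2 (r0 * expR e'); first by rewrite ltr_pMr.
pose k := Num.min k1 k2.
have kp : 0 < k by rewrite lt_min k10.
have kk1 : k <= k1 by rewrite ge_min lexx.
have kk2 : k <= k2 by rewrite ge_min lexx orbT.
have {}H1 := H1 k kp kk1; have {}H2 := H2 k kp kk2.
rewrite !lnM ?posrE ?expR_gt0// !expRK in H1 H2.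
have Hm := Heq k kp; have Km := KSr_mix.
have ck : continuous (fun x => c x + k) by apply: contD => //; exact: cst_continuous.
have ck0 x : 0 < c x + k by rewrite ltr_wpDl.
have Em : Exln mu c k = t * Exln mu1 c k + (1 - t) * Exln mu2 c k.
  exact: (Ex_mix (continuous_lnc ck ck0)).
rewrite -(ler_pM2l t0).
rewrite /Exln in H1 H2 Em Hm *.
have a1 := ler_wpM2l (ltW t0) H1; have a2 := ler_wpM2l (ltW s0) H2.
rewrite Em in Hm; rewrite /e' in a1 a2.
have te : t * e * t + (1 - t) * (e * t) = t * e by ring.
move: a1 a2 Hm Km te; rewrite !mulrDr mulrBl mul1r; lra.
Qed.

End mixture.

End equilibrium_measures.

(** * Ergodic equilibrium states *)

Section separating_family.
Context (R : realType) (X : ptopologicalType) (d : X -> X -> R).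
Hypothesis dm : compatible_metric d.
Hypothesis cX : compact [set: X].

Definition cone (r : R) z x := Num.max 0 (r - d z x).

Lemma cone_continuous r z : continuous (cone r z).
Proof.
move=> x; apply: (@continuous_max R X (cst 0) (fun x => r - d z x)); first exact: cvg_cst.
apply: cvgB; first exact: cvg_cst.
apply: (lipschitz_continuous dm (k := 1)) => a b; rewrite mul1r ler_norml.
by have := d_tri dm a z b; have := d_tri dm b z a; rewrite (dC dm b a) => *; apply/andP; split; lra.
Qed.

Lemma cone_ge0 r z x : 0 <= cone r z x. Proof. by rewrite le_max lexx. Qed.

(** Normalised cones on a [1 / (n + 1)]-net form a partition of unity. Interpolating a continuous
    [g] at the net points by it is uniformly accurate, so the countably many cones determine all
    integrals. *)
Lemma separating_family : exists f : nat -> X -> R, (forall k, continuous (f k)) /\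
  forall mu nu : probability (borel X) R, (forall k, Ex mu (f k) = Ex nu (f k)) ->
  forall A : set (borel X), measurable A -> mu A = nu A.
Proof.
have r0 n : 0 < n.+1%:R^-1 :> R by rewrite invr_gt0.
have /choice[s sP] n := fin_net dm cX (r0 n).
pose S n x := \sum_(z <- s n) cone n.+1%:R^-1 z x.
have S0 n x : 0 < S n x.
  have [z zs zx] := sP n x; rewrite /S (big_rem z zs)/= ltr_wpDr//.
    by apply: sumr_ge0 => w _; exact: cone_ge0.
  by rewrite lt_max subr_gt0 zx orbT.
pose F n z x := (S n x)^-1 * cone n.+1%:R^-1 z x.
have cS n : continuous (S n) by apply: continuous_sum => z; exact: cone_continuous.
have cF n z : continuous (F n z).
  apply: contM; last exact: cone_continuous.
  by move=> x; apply: cvgV; [rewrite gt_eqF|exact: cS].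
pose f k := if (unpickle k : option (nat * nat)) is Some p then F p.1 (nth point (s p.1) p.2)
  else cst 0.
have cf k : continuous (f k).
  by rewrite /f; case: unpickle => [p|]; [exact: cF|exact: cst_continuous].
exists f; split=> // mu nu H.
have HF n z : z \in s n -> Ex mu (F n z) = Ex nu (F n z).
  by move=> zs; have := H (pickle (n, index z (s n))); rewrite /f pickleK /= nth_index.
apply: (prob_eq dm) => g cg.
suff H2 (e : R) : 0 < e -> `|Ex mu g - Ex nu g| <= e.
  apply/eqP; rewrite -subr_eq0 -normr_eq0; apply/eqP/le_anti; rewrite normr_ge0 andbT.
  by apply/ler_addgt0Pr => e e0; rewrite add0r; exact: H2.
move=> e0; have e20 : 0 < e / 2 by rewrite divr_gt0.
have [r rgt0 rP] := dunif_continuous dm cX cg e20.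
pose n := Num.truncn r^-1.
have nr : n.+1%:R^-1 <= r.
  by rewrite -[leRHS]invrK lef_pV2 ?posrE ?invr_gt0// ltW// truncnS_gt.
pose h x := \sum_(z <- s n) g z * F n z x.
have ch : continuous h by apply: continuous_sum => z; exact: contZ.
have bF z : bmf (fun x : borel X => g z * F n z x).
  by apply: bmfZ; exact: (continuous_bmf dm cX).
have Eh : Ex mu h = Ex nu h.
  rewrite (Ex_sum mu (s n) bF).2 (Ex_sum nu (s n) bF).2.
  rewrite big_seq [RHS]big_seq; apply: eq_bigr => z zs.
  by rewrite !ExZ ?HF//; exact: (continuous_bmf dm cX).
have F1 x : \sum_(z <- s n) F n z x = 1.
  by rewrite /F -mulr_sumr mulVf// gt_eqF// S0.
have F0 z x : 0 <= F n z x by rewrite mulr_ge0 ?cone_ge0// invr_ge0 ltW.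
have gh x : `|g x - h x| <= e / 2.
  have -> : g x - h x = \sum_(z <- s n) (g x - g z) * F n z x.
    rewrite -[X in X - _ = _]mulr1 -[X in _ * X - _ = _](F1 x) mulr_sumr -sumrB.
    by apply: eq_bigr => z _; rewrite mulrBl.
  apply: le_trans (ler_norm_sum _ _ _) _.
  rewrite -[leRHS]mulr1 -[X in _ <= _ * X](F1 x) mulr_sumr; apply: ler_sum => z _.
  rewrite normrM (ger0_norm (F0 z x)).
  have [h0|h0] := leP n.+1%:R^-1 (d z x).
    by rewrite /F /cone (max_idPl _) ?subr_le0// !mulr0.
  apply: ler_wpM2r => //; apply/ltW; rewrite distrC; apply: rP; exact: lt_le_trans h0 nr.
have bg := continuous_bmf dm cX cg; have bh := continuous_bmf dm cX ch.
have close (la : probability (borel X) R) : `|Ex la g - Ex la h| <= e / 2.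
  rewrite -(stateB (Ex_state la dm cX)) //.
  apply: (state_bound (Ex_state la dm cX)) => //.
  by move=> z; apply: cvgB; [exact: cg|exact: ch].
rewrite (splitr e) -[X in X - _](subrK (Ex mu h)) {2}Eh -addrA.
apply: le_trans (ler_normD _ _) _; apply: lerD => //.
by rewrite distrC.
Qed.

End separating_family.

Section conditional_measures.
Context (R : realType) (X : ptopologicalType) (phi : X -> X).
Variable mu : probability (borel X) R.
Hypothesis inv : phi_invariant phi mu.

Lemma conditional_invariant (A : set (borel X)) : measurable A -> phi @^-1` A = A ->
  0 < prob mu A -> exists nu : probability (borel X) R, phi_invariant phi nu /\
    forall B : set (borel X), measurable B -> prob nu B = (prob mu A)^-1 * prob mu (B `&` A).
Proof.
move=> mA pA A0; have k0 : 0 <= (prob mu A)^-1 by rewrite invr_ge0 ltW.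
have [nu nuE] : exists nu : probability (borel X) R,
    forall B, nu B = mscale (NngNum k0) (mrestr mu mA) B.
  apply: probability_exists.
  - exact: measure0.
  - by move=> B; exact: measure_ge0.
  - exact: measure_semi_sigma_additive.
  - have -> : mscale (NngNum k0) (mrestr mu mA) setT = ((prob mu A)^-1%:E * mu (setT `&` A))%E by [].
    rewrite setTI; transitivity ((prob mu A)^-1%:E * (prob mu A)%:E)%E.
      by congr (_ * _)%E; exact: probE.
    by rewrite -EFinM mulVf ?gt_eqF.
have nuE' B : nu B = ((prob mu A)^-1%:E * mu (B `&` A))%E by rewrite nuE.
exists nu; split.
  move=> B mB; rewrite !nuE'; congr (_ * _)%E.
  have -> : phi @^-1` B `&` A = phi @^-1` (B `&` A) by rewrite preimage_setI pA.
  by apply: inv; exact: measurableI.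
move=> B mB; rewrite /prob nuE' fineM// fin_num_measure//; exact: measurableI.
Qed.

End conditional_measures.

Section lexicographic_face.
Context (R : realType) (X : ptopologicalType) (d : X -> X -> R).
Hypothesis dm : compatible_metric d.
Hypothesis cX : compact [set: X].
Variable U : set_system nat.
Hypothesis UU : UltraFilter U.
Hypothesis Uoo : \oo `<=` U.
Variable K : ((X -> R) -> R) -> Prop.
Hypothesis K_state : forall l, K l -> state l.
Hypothesis K_ulim : forall (l : nat -> (X -> R) -> R) J, (forall j, state (l j)) ->
  (forall j, (J <= j)%N -> K (l j)) -> K (state_ulim U l).
Hypothesis K_ex : exists l, K l.
Variable f : nat -> X -> R.
Hypothesis cf : forall k, continuous (f k).

Fixpoint face k (l : (X -> R) -> R) : Prop :=
  if k is j.+1 then face j l /\ forall l', face j l' -> l' (f j) <= l (f j) else K l.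

Lemma face_le j k l : (j <= k)%N -> face k l -> face j l.
Proof.
elim: k => [|k IH]; first by rewrite leqn0 => /eqP ->.
by rewrite leq_eqVlt => /predU1P[->//|]; rewrite ltnS => jk [/(IH jk)].
Qed.

Lemma face_state k l : face k l -> state l.
Proof. by move=> /(face_le (leq0n k)); exact: K_state. Qed.

Lemma face_ulim k (l : nat -> (X -> R) -> R) J : (forall j, state (l j)) ->
  (forall j, (J <= j)%N -> face k (l j)) -> face k (state_ulim U l).
Proof.
move=> sl; elim: k => [|k IH] H /=; first exact: K_ulim H.
split; first by apply: IH => j /H [].
move=> l' l'k; have [M MP] := state_seq_bound dm cX sl (@cf k).
apply: (ulim_ge UU Uoo (v := cst (l' (f k))) (J := J) MP); first exact: cvg_cst.
by move=> j /H[_]; apply.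
Qed.

(** The supremum of the values at [f k] is attained by the ultralimit of a maximising sequence,
    which stays in the face. *)
Lemma face_nonempty k : exists l, face k l.
Proof.
elim: k => [//|k [l0 l0k]].
pose A := [set l (f k) | l in face k].
have [M _ MP] := bounded_continuous dm cX (@cf k).
have A0 : A !=set0 by exists (l0 (f k)); exists l0.
have hA : has_sup A.
  split=> //; exists M => _ [l lk <-].
  apply: le_trans (ler_norm _) _; exact: (state_bound (face_state lk) (@cf k) MP).
have /choice[l lP] j : exists l, face k l /\ sup A - j.+1%:R^-1 < l (f k).
  have j0 : 0 < j.+1%:R^-1 :> R by rewrite invr_gt0.
  by have [_ [l lk <-] h] := sup_adherent j0 hA; exists l.
have sl j : state (l j) by exact: face_state (lP j).1.
exists (state_ulim U l); split; first by apply: (@face_ulim k l 0) => // j _; exact: (lP j).1.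
move=> l' l'k; have [B BP] := state_seq_bound dm cX sl (@cf k).
have cv : (fun j : nat => sup A - j.+1%:R^-1) @ \oo --> sup A.
  rewrite -[X in _ --> X]subr0; apply: cvgB; first exact: cvg_cst.
  exact: cvg_harmonic.
apply: (@le_trans _ _ (sup A)); first by apply: (ub_le_sup hA.2); exists l'.
by apply: (ulim_ge UU Uoo (J := 0%N) BP cv) => j _; exact: ltW (lP j).2.
Qed.

(** Diagonal choice: the [j]-th functional lies in [face k] once [j >= k], which is why closedness
    is stated for sequences eventually in the set. *)
Lemma face_inter_nonempty : exists l, forall k, face k l.
Proof.
have /choice[l lP] := face_nonempty; exists (state_ulim U l) => k.
apply: (@face_ulim k l k) => [j|j kj]; first exact: face_state (lP j).
exact: face_le (lP j).
Qed.

(* The lexicographic maximum is an extreme point of K, as far as the f k can tell. *)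
Lemma face_inter_extreme l l1 l2 t : (forall k, face k l) -> K l1 -> K l2 -> 0 < t -> t < 1 ->
  (forall g, continuous g -> l g = t * l1 g + (1 - t) * l2 g) ->
  forall k, l1 (f k) = l2 (f k).
Proof.
move=> lF K1 K2 t0 t1 mix.
(* Both values are at most the maximum [l (f k)], which is their average with positive weights; so
   both attain it, and both functionals pass to the next face. *)
have eqk k : face k l1 -> face k l2 -> l1 (f k) = l (f k) /\ l2 (f k) = l (f k).
  have [_ lmax] := lF k.+1; move=> /lmax h1 /lmax h2; have := mix _ (@cf k) => h.
  split; apply/eqP; rewrite eq_le ?h1 ?h2/=; nra.
have H k : face k l1 /\ face k l2.
  elim: k => [//|k [F1 F2]]; have [e1 e2] := eqk k F1 F2; have [_ lmax] := lF k.+1.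
  by split; split=> // l' /lmax; rewrite ?e1 ?e2.
by move=> k; have [e1 e2] := eqk k (H k).1 (H k).2; rewrite e1 e2.
Qed.

End lexicographic_face.

Section ergodic_equilibrium.
Context (R : realType) (X : ptopologicalType) (phi : X -> X)
  (d : X -> X -> R) (eps theta : R).
Hypothesis ES : expanding_system phi d eps theta.
Let dm := es_metric ES.
Let cX := es_compact ES.
Let mphi := continuous_borel_map (es_continuous ES).

Lemma ergodic_equilibrium_pos (c : X -> R) : continuous c -> (forall x, 0 <= c x) ->
  0 < growth_rate phi c ->
  exists2 mu : probability (borel X) R, phi_ergodic phi mu &
    pressure_fun phi c mu = lnE (growth_rate phi c).
Proof.
move=> cc c_ge0 r0.
have [U [UU Uoo]] := free_ultrafilter.
have [f [cf sepf]] := separating_family dm cX.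
pose K := equilibrium_functional phi c.
have Ku := equilibrium_functional_ulim ES (c := c) UU Uoo.
have Kex : exists l, K l := equilibrium_functional_exists ES cc c_ge0 r0 UU Uoo.
have Ks l : K l -> state l := @ef_state _ _ _ _ l.
have [l lF] := face_inter_nonempty dm cX UU Uoo Ks Ku Kex cf.
have Kl : K l := lF 0%N.
have [mu muE] := riesz_representation dm cX (ef_state Kl).
have inv : phi_invariant phi mu.
  apply: (invariant_of_Ex dm mphi (fun g cg => continuous_bmf dm cX cg)) => g cg.
  rewrite !muE//; first exact: (ef_invariant Kl).
  by move=> x; apply: continuous_comp; [exact: (es_continuous ES)|exact: cg].
have sub : subgradient phi c (fun g : X -> R => Ex mu g).
  by move=> g lam cg lam0 H; rewrite muE//; exact: (ef_subgradient Kl).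
have ent := subgradient_entropy ES cc c_ge0 inv sub.
exists mu; last exact: (pressure_ge ES cc c_ge0 inv r0 ent).
split=> // A mA pA.
have [A0|] := leP (prob mu A) 0.
  by left; rewrite (probE mu mA); congr (_%:E); apply/le_anti; rewrite A0 prob_ge0.
move=> A0; have [A1|A1] := leP 1 (prob mu A).
  right; rewrite (probE mu mA); congr (_%:E); apply/le_anti; rewrite A1 andbT.
  rewrite -(probT mu); exact: prob_le.
exfalso.
have pA' : phi @^-1` (~` A) = ~` A by rewrite preimage_setC; congr (~` _).
have mA' : measurable (~` A) by exact: measurableC.
have PC : prob mu (~` A) = 1 - prob mu A.
  rewrite -(probT mu) -(setUCr A) (probU mu mA mA' (setICr A)); ring.
have A'0 : 0 < prob mu (~` A) by rewrite PC subr_gt0.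
have [mu1 [inv1 mu1E]] := conditional_invariant inv mA pA A0.
have [mu2 [inv2 mu2E]] := conditional_invariant inv mA' pA' A'0.
have mix B : measurable B -> prob mu B = prob mu A * prob mu1 B + (1 - prob mu A) * prob mu2 B.
  move=> mB; rewrite mu1E// mu2E// PC !mulrA divff ?gt_eqF// divff ?gt_eqF ?subr_gt0// !mul1r.
  rewrite -probU; [by rewrite -setIUr setUCr setIT|exact: measurableI|exact: measurableI|].
  by rewrite setIACA setICr setI0.
(* The same mixture with the roles exchanged, because [entropy_mix_subgradient] concludes for the
   first component. *)
have mix' B : measurable B -> prob mu B = (1 - prob mu A) * prob mu2 B + (1 - (1 - prob mu A)) * prob mu1 B.
  by move=> mB; rewrite subKr addrC; exact: mix.
have s0 : 0 < 1 - prob mu A by rewrite subr_gt0.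
have s1 : 1 - prob mu A < 1 by rewrite gtrBl.
have Kmu (nu : probability (borel X) R) : phi_invariant phi nu ->
    subgradient phi c (fun g : X -> R => Ex nu g) -> K (fun g => Ex nu g).
  move=> inu snu; split=> //; first exact: Ex_state dm cX.
  move=> g cg; exact: (Ex_invariant mphi inu (continuous_bmf dm cX cg)).
have K1 := Kmu _ inv1 (entropy_mix_subgradient ES cc c_ge0 inv inv1 inv2 A0 A1 mix r0 ent).
have K2 := Kmu _ inv2 (entropy_mix_subgradient ES cc c_ge0 inv inv2 inv1 s0 s1 mix' r0 ent).
have E := face_inter_extreme cf lF K1 K2 A0 A1 (l := l).
have {}E : forall k, Ex mu1 (f k) = Ex mu2 (f k).
  apply: E => g cg; rewrite -muE//.
  exact: (Ex_mix ES A0 A1 mix cg).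
(* Equality of the two conditional measures is absurd: [A] has mass 1 under [mu1] and 0 under
   [mu2]. *)
have := sepf mu1 mu2 E A mA; move/(congr1 fine).
rewrite -/(prob mu1 A) -/(prob mu2 A) mu1E// mu2E// setIid setICr.
rewrite mulVf ?gt_eqF// /prob measure0 mulr0 => /eqP; by rewrite oner_eq0.
Qed.

(** [L^n 1] counts [n]-step preimages, and [iter n phi x] has at least the preimage [x]. This makes
    the positive case available for the weight 1, which supplies an ergodic measure when the growth
    rate of [c] is 0. *)
Lemma growth_rate_cst1_gt0 : 0 < growth_rate phi (cst 1 : X -> R).
Proof.
have c0 : forall x : X, 0 <= cst (1 : R) x by [].
have cc : continuous (cst 1 : X -> R) by exact: cst_continuous.
have le1 n x : 1 <= iter n (RPF phi (cst 1)) (cst 1) (iter n phi x) :> R.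
  elim: n => [|n IH] //=; rewrite (RPFE ES) (big_rem (iter n phi x))/=; last first.
    by rewrite (mem_preimages ES).
  rewrite mul1r ler_wpDr//; apply: sumr_ge0 => z _.
  by rewrite mul1r; exact: (iter_RPF_ge0 ES).
rewrite ltNge; apply/negP => r0.
have [|h [C CP]] := growth_rate_lt ES cc c0 (lam := 1 / 2); first by lra.
suff : (1 : R) <= 0 by rewrite ler10.
apply: (@geometric_le0 _ C (1 / 2)) => [||n]; [lra|lra|].
exact: le_trans (le1 n point) (CP _ _).
Qed.

Lemma ergodic_equilibrium (c : X -> R) : continuous c -> (forall x, 0 <= c x) ->
  exists2 mu : probability (borel X) R, phi_ergodic phi mu &
    pressure_fun phi c mu = lnE (growth_rate phi c).
Proof.
move=> cc c_ge0; have := growth_rate_ge0 ES cc c_ge0; rewrite le_eqVlt.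
case/predU1P=> [r00|]; last exact: ergodic_equilibrium_pos.
have c1 : continuous (cst 1 : X -> R) by exact: cst_continuous.
have [mu emu _] := ergodic_equilibrium_pos c1 (fun=> ler01) growth_rate_cst1_gt0.
exists mu => //; have := pressure_le_lnE ES cc c_ge0 emu.1.
by rewrite -r00 /lnE lexx leeNy_eq => /eqP.
Qed.

End ergodic_equilibrium.

Theorem mainTheorem4 (R : realType) (X : ptopologicalType) (phi : X -> X)
  (c : X -> R) :
  compact [set: X] -> expanding R phi -> open_map phi ->
  continuous c -> (forall x, 0 <= c x) ->
  [/\ (forall mu : probability (borel X) R,
         phi_invariant phi mu -> (KSentropy phi mu < +oo)%E),
      (exists2 mu0 : probability (borel X) R, phi_invariant phi mu0 &
         pressure_fun phi c mu0 = lnE (spectral_radius phi c) /\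
         forall mu : probability (borel X) R, phi_invariant phi mu ->
           (pressure_fun phi c mu <= pressure_fun phi c mu0)%E) &
      (exists2 mu1 : probability (borel X) R, phi_ergodic phi mu1 &
         pressure_fun phi c mu1 = lnE (spectral_radius phi c) /\
         forall mu : probability (borel X) R, phi_ergodic phi mu ->
           (pressure_fun phi c mu <= pressure_fun phi c mu1)%E)].
Proof.
move=> cX [cphi [d [dm [eps [theta [e0 t1 Hexp]]]]]] ophi cc c_ge0.
have ES := ExpandingSystem dm cX cphi ophi e0 t1 Hexp.
have [mu emu pmu] := ergodic_equilibrium ES cc c_ge0.
have pmu' : pressure_fun phi c mu = lnE (spectral_radius phi c).
  by rewrite (spectral_radiusE ES cc c_ge0).
have pmax (nu : probability (borel X) R) : phi_invariant phi nu ->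
    (pressure_fun phi c nu <= pressure_fun phi c mu)%E.
  by move=> inu; rewrite pmu; exact: (pressure_le_lnE ES cc c_ge0 inu).
split; first by move=> nu inu; exact: (KSentropy_lty ES inu).
  by exists mu; [exact: emu.1|split].
by exists mu => //; split=> // nu [inu _]; exact: pmax.
Qed.
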